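(* Let $N\ge1$ be an integer and $0<\theta\le2$. Let $F$ be an increasing, nonnegative continuous function in $[0,\infty)$ such that (C1) there exist $R\ge0$ and $d>1$ such that the function $(R,\infty)\ni\tau\mapsto\tau^{-d}F(\tau)\in(0,\infty)$ is increasing. Furthermore, assume that there exists a continuous function $G$ in $[R,\infty)$ satisfying the following conditions: (C2) there exists $p\in[d,d+1)$ such that $G(\tau)\succeq\tau^{-p}F(\tau)>0$ as $\tau\to\infty$; (C3) for any $a\ge1$, $b>0$, and $c\in\mathbb{R}$, $G(a\tau^bG(\tau)^c)\asymp G(\tau)$ as $\tau\to\infty$; (C4) there exists $\delta\in(0,1)$ such that the function $(R,\infty)\ni\tau\mapsto\tau^{-\delta}G(\tau)$ is decreasing. Let $\alpha>1$. Then there exists $\varepsilon>0$ such that if $\mu\in\mathcal{L}_0$ satisfies $$\sup_{x\in\mathbb{R}^N}\left[\frac{1}{|B(x,\sigma)|}\int_{B(x,\sigma)}\mu(y)^\alpha\,dy\right]^{\frac{1}{\alpha}}\le\varepsilon\sigma^{-\frac{\theta}{p-1}}G(\sigma^{-1})^{-\frac{1}{p-1}}$$ for small enough $\sigma>0$, then the problem $\partial_tu+(-\Delta)^{\frac{\theta}{2}}u=F(u)$ in $\mathbb{R}^N\times(0,T)$, $u(0)=\mu$, possesses a solution $u$ in $Q_T$ for some $T>0$, with $u$ satisfying $$0\le u(x,t)\le2[S(t)\mu^\alpha](x)^{\frac{1}{\alpha}}+R\le Ct^{-\frac{1}{p-1}}G(t^{-1})^{-\frac{1}{p-1}}$$ in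 $Q_T$ for some $C>0$.
   Context: ''Increasing'' and ''decreasing'' are meant in the non-strict sense. $\mathcal{L}_0$ is the set of nonnegative Lebesgue measurable functions on $\mathbb{R}^N$; $\mu\in\mathcal{L}_0$ is identified with the measure $d\mu=\mu(x)\,dx$. $B(x,\sigma)$ is the Euclidean ball with centre $x$ and radius $\sigma$, $|B(x,\sigma)|$ its Lebesgue measure; $Q_T:=\mathbb{R}^N\times(0,T)$. $f_1(\tau)\succeq f_2(\tau)$ as $\tau\to\infty$ means: there exists $C>0$ such that $f_2(\tau)\le Cf_1(\tau)$ for all large enough $\tau$; $f_1\asymp f_2$ as $\tau\to\infty$ means that both $f_1\succeq f_2$ and $f_2\succeq f_1$ as $\tau\to\infty$. $\Gamma_\theta=\Gamma_\theta(x,t)$ is the fundamental solution of $\partial_tu+(-\Delta)^{\theta/2}u=0$ in $\mathbb{R}^N\times(0,\infty)$ (for each $t>0$, the function with Fourier transform $e^{-t|\xi|^\theta}$), and $[S(t)g](x):=\int_{\mathbb{R}^N}\Gamma_\theta(x-y,t)g(y)\,dy$ for $g\in\mathcal{L}_0$. A solution of the problem in $Q_T$ is a nonnegative, measurable, almost everywhere finite function $u$ in $Q_T$ such that $$u(x,t)=\int_{\mathbb{R}^N}\Gamma_\theta(x-y,t)\,d\mu(y)+\int_0^t\int_{\mathbb{R}^N}\Gamma_\theta(x-y,t-s)F(u(y,s))\,dy\,ds$$ for almost all $(x,t)\in Q_T$. The constant $\varepsilon$ does not depend on $\mu$; the threshold for $\sigma$, and $T$, $C$ may depend on $\mu$.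 *)

(* Defs.v *)
From HB Require Import structures.
From mathcomp Require Import all_boot all_order all_algebra.
From mathcomp Require Import all_classical all_reals all_analysis.
From mathcomp Require Import measurable_realfun.
Set Implicit Arguments.
Unset Strict Implicit.
Unset Printing Implicit Defensive.
Import Order.TTheory GRing.Theory Num.Theory.
Import numFieldNormedType.Exports.
Local Open Scope classical_set_scope.
Local Open Scope ring_scope.

(* R^n, with the product sigma-algebra of the Borel sigma-algebra that carries
   lebesgue_measure. *)
Notation Rn R n := (n.-tuple (measurableTypeR R)).

Section lebesgue_measure_tuple.
Context {R : realType}.
Implicit Types n : nat.

Definition tuple_cons n (z : measurableTypeR R * Rn R n) : Rn R n.+1 :=
  [tuple of z.1 :: z.2].

Definition tuple_uncons n (x : Rn R n.+1) : measurableTypeR R * Rn R n :=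
  (thead x, [tuple of behead x]).

Lemma tuple_consK n : cancel (@tuple_cons n) (@tuple_uncons n).
Proof. by move=> [a x]; congr pair => //; exact: val_inj. Qed.

Lemma tuple_unconsK n : cancel (@tuple_uncons n) (@tuple_cons n).
Proof. by move=> x; rewrite [RHS]tuple_eta; exact: val_inj. Qed.

Lemma measurable_tuple_cons n : measurable_fun setT (@tuple_cons n).
Proof. exact: measurable_cons. Qed.

Lemma measurable_tuple_uncons n : measurable_fun setT (@tuple_uncons n).
Proof.
apply/measurable_fun_pair; first exact: measurable_tnth.
exact: measurable_behead.
Qed.

Definition cons_measure n (m : {sigma_finite_measure set (Rn R n) -> \bar R})
    : set (Rn R n.+1) -> \bar R :=
  pushforward (lebesgue_measure \x m)%E (@tuple_cons n).

Section cons_measure.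
Context n (m : {sigma_finite_measure set (Rn R n) -> \bar R}).

HB.instance Definition _ := Measure.copy (cons_measure m)
  (measure_function_pushforward__canonical__measure_function_Measure
     (lebesgue_measure \x m)%E (@measurable_tuple_cons n)).

Let sigma_finite_cons_measure : sigma_finite setT (cons_measure m).
Proof.
have /sigma_finiteP[F [TF ndF Foo]] := sigma_finiteT (@lebesgue_measure R).
have /sigma_finiteP[G [TG ndG Goo]] := sigma_finiteT m.
exists (fun k => @tuple_uncons n @^-1` (F k `*` G k)).
  rewrite -preimage_bigcup [X in _ @^-1` X](_ : _ = setT) ?preimage_setT//.
  rewrite -subTset -setXTT TF TG => -[x y] [/= [i _ Fix] [j _ Gjy]].
  exists (maxn i j) => //; split.
  - by move: x Fix; exact/subsetPset/ndF/leq_maxl.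
  - by move: y Gjy; exact/subsetPset/ndG/leq_maxr.
move=> k; have [mF Fk] := Foo k; have [mG Gk] := Goo k; split.
  rewrite -[X in measurable X]setTI; apply: measurable_tuple_uncons => //.
  exact: measurableX.
rewrite /cons_measure /pushforward -comp_preimage.
rewrite (_ : @tuple_uncons n \o @tuple_cons n = id); last first.
  by apply/funext => z /=; rewrite tuple_consK.
by rewrite preimage_id product_measure1E// lte_mul_pinfty// ge0_fin_numE.
Qed.

HB.instance Definition _ :=
  @Measure_isSigmaFinite.Build _ _ _ (cons_measure m) sigma_finite_cons_measure.

End cons_measure.

(* Lebesgue measure on R^n, as the n-fold product of lebesgue_measure *)
Fixpoint leb n : {sigma_finite_measure set (Rn R n) -> \bar R} :=
  match n return {sigma_finite_measure set (Rn R n) -> \bar R} with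
  | 0%N => dirac ([tuple] : Rn R 0)
  | k.+1 => cons_measure (leb k)
  end.

End lebesgue_measure_tuple.

Section euclidean.
Context {R : realType} {N : nat}.
Implicit Types x y : Rn R N.

Definition dotp x y : R := \sum_(i < N) (tnth x i : R) * (tnth y i : R).

Definition enorm x : R := Num.sqrt (dotp x x).

Definition vsub x y : Rn R N :=
  [tuple ((tnth x i : R) - (tnth y i : R))%R | i < N].

Definition eball x (sigma : R) : set (Rn R N) :=
  [set y | enorm (vsub y x) < sigma].

End euclidean.

(* Measurability of f on D with respect to the completion of mu: the library's
   measurable sets of R^n are the Borel ones, and Lebesgue measurability is
   measurability for the completed sigma-algebra. *)
Definition completed_measurable_fun d (T : measurableType d) (R : realType)
    (mu : set T -> \bar R) (D : set T) (f : T -> \bar R) : Prop :=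
  measurable_fun (D : set (g_sigma_algebraType (completed_algebra_gen mu)))
    (f : g_sigma_algebraType (completed_algebra_gen mu) -> \bar R).

Section fractional_heat.
Context {R : realType} {N : nat}.
Variable theta : R.
Local Open Scope ereal_scope.
Implicit Types (x y xi : Rn R N) (t : R).

(* The function of x with Fourier transform exp(-t|xi|^theta), i.e. the inverse
   Fourier transform
     (2 pi)^-N \int e^(i x.xi) exp(-t|xi|^theta) dxi;
   the imaginary part of the integrand is odd in xi and integrates to 0. *)
Definition Gamma x t : R :=
  ((2 * pi) ^- N *
   \int[leb N]_xi (cos (dotp x xi) * expR (- (t * enorm xi `^ theta))))%R.

Definition heat_semigroup t (g : Rn R N -> \bar R) x : \bar R :=
  \int[leb N]_y ((Gamma (vsub x y) t)%:E * g y).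

Definition cylinder (T : R) : set (Rn R N * measurableTypeR R) :=
  [set z | (0 < (z.2 : R) < T)%R].

Definition leb_time : set (Rn R N * measurableTypeR R) -> \bar R :=
  leb N \x @lebesgue_measure R.

HB.instance Definition _ := Measure.on leb_time.

(* u is [0, +oo]-valued and finite almost everywhere; F (fine (u z)) is F(u(z))
   wherever u is finite, and the null set where it is not does not affect the
   integrals. *)
Definition is_solution (F : R -> R) (mu : Rn R N -> \bar R) (T : R)
    (u : Rn R N * measurableTypeR R -> \bar R) : Prop :=
  [/\ forall z, cylinder T z -> 0 <= u z,
      completed_measurable_fun leb_time (cylinder T) u,
      {ae leb_time, forall z, cylinder T z -> u z \is a fin_num} &
      {ae leb_time, forall z, cylinder T z ->
        u z = \int[leb N]_y ((Gamma (vsub z.1 y) z.2)%:E * mu y) +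
              \int[@lebesgue_measure R]_(s in `]0%R, (z.2 : R)[%classic)
                \int[leb N]_y ((Gamma (vsub z.1 y) (z.2 - s))%:E *
                               (F (fine (u (y, s))))%:E)} ].

Definition power_mean (alpha : R) (mu : Rn R N -> \bar R) x (sigma : R)
    : \bar R :=
  (((fine (leb N (eball x sigma)))^-1)%:E *
   \int[leb N]_(y in eball x sigma) (mu y `^ alpha)) `^ alpha^-1.

End fractional_heat.

Section asymptotics.
Context {R : realType}.
Implicit Types f : R -> R.

Definition succeq_infty f1 f2 : Prop :=
  exists2 C : R, 0 < C & \forall tau \near +oo, f2 tau <= C * f1 tau.

Definition asymp_infty f1 f2 : Prop :=
  succeq_infty f1 f2 /\ succeq_infty f2 f1.

End asymptotics.

(* Main.v *)
Require Import Defs.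
From HB Require Import structures.
From mathcomp Require Import all_boot all_order all_algebra.
From mathcomp Require Import all_classical all_reals all_analysis.
From mathcomp Require Import measurable_realfun.
From mathcomp Require Import ring lra.
Set Implicit Arguments.
Unset Strict Implicit.
Unset Printing Implicit Defensive.
Import Order.TTheory GRing.Theory Num.Theory.
Import numFieldNormedType.Exports.
Local Open Scope classical_set_scope.
Local Open Scope ring_scope.

(** A solution is the limit of a Picard iteration trapped below an explicit
    supersolution, and the supersolution comes from the linear flow.

    Let b = min (alpha, d), U = S(t) mu^b, v = U^(1/b), and let
    k(t) = t^(-1/(p-1)) G(1/t)^(-1/(p-1)) be the critical profile.  Averages of
    mu^alpha over balls of radius t^(1/theta) control S(t) mu^alpha pointwise,
    so the smallness assumption on mu and Jensen's inequality give v <= e k(t)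
    with e as small as desired.  Then w = 2 v + R is a supersolution:
    - S(t) mu <= v, by Jensen's inequality;
    - where v <= R, F(w) <= F(3R), whose time integral is at most R for small t;
    - where v > R, F(w) <= F(3v).  Here 3v <= k(s), so F(3v) <= (3v)^d k^-d F(k)
      because tau^-d F(tau) increases; k^-p F(k) <= C G(k), and G(k(s)) is
      comparable to G(1/s).  With k^(p-1) = 1/(s G(1/s)) this reads
      F(3v) <= C U k(s)^(1-b) / s.  As S(t-s) U(s) <= U(t), the space integral
      leaves C U(t) k(s)^(1-b) / s;
    - as tau^-delta G(tau) decreases, k(s)^(1-b) <= (s/t)^gamma k(t)^(1-b) with
      gamma > 0, so the time integral converges at s = 0 and is at most
      C v^b k(t)^(1-b) <= v once e is small.
    This is the content of [source_control], [duhamel_supersolution] and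
    [duhamel_solution].

    Of the fractional heat kernel only four inequalities enter: positivity, mass
    at most 1, Gamma_t * Gamma_s <= Gamma_(t+s), and the bound of Gamma_t * g by
    averages of g over balls.  Each of them survives pointwise limits by Fatou's
    lemma and holds for Gaussians, hence for the inverse Fourier transform of any
    integrable function in the closure of positive combinations of Gaussians
    ([mixture], [mixture_transfer]).  The symbol exp (-t |xi|^theta) lies in that
    closure: with l = |xi|^2 and r = theta/2 at most 1, l^r is the limit of
    n^r (1 - exp (-l/n))^r, and 1 - (1-x)^r is a power series with nonnegative
    coefficients ([mixture_stable]). *)

(** * Integration over tuples, balls and cubes *)

Section leb_integral.
Context {R : realType}.
Local Open Scope ereal_scope.

Lemma ge0_integral_leb0 (f : Rn R 0 -> \bar R) :
  measurable_fun setT f -> \int[leb 0]_x f x = f [tuple].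
Proof. by move=> mf; rewrite /= integral_dirac// diracT mul1e. Qed.

Lemma ge0_integral_lebS n (f : Rn R n.+1 -> \bar R) :
  measurable_fun setT f -> (forall x, 0 <= f x) ->
  \int[leb n.+1]_x f x =
  \int[@lebesgue_measure R]_a \int[leb n]_y f (tuple_cons (a, y)).
Proof.
move=> mf f0; rewrite /= /cons_measure ge0_integral_pushforward//; last first.
  exact: measurable_tuple_cons.
rewrite preimage_setT fubini_tonelli1//.
- by apply: measurableT_comp => //; exact: measurable_tuple_cons.
- by move=> z /=; exact: f0.
Qed.

Lemma measurable_coord n (i : 'I_n) :
  measurable_fun [set: Rn R n] (fun x : Rn R n => tnth x i : R).
Proof. exact: measurable_tnth. Qed.

Lemma tnth_tuple_cons0 n (a : R) (y : Rn R n) :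
  tnth (tuple_cons (a, y)) ord0 = a.
Proof. by []. Qed.

Lemma tnth_tuple_consS n (a : R) (y : Rn R n) (i : 'I_n) :
  tnth (tuple_cons (a, y)) (lift ord0 i) = tnth y i.
Proof. by rewrite (tnth_nth a) /= (tnth_nth a). Qed.

(** Tonelli reduces every Gaussian integral on R^n to a one-dimensional one. *)
Lemma integral_leb_prod n (f : 'I_n -> R -> R) (c : 'I_n -> R) :
  (forall i, measurable_fun setT (f i)) -> (forall i x, (0 <= f i x)%R) ->
  (forall i, \int[@lebesgue_measure R]_a (f i a)%:E = (c i)%:E) ->
  \int[leb n]_x (\prod_(i < n) f i (tnth x i))%R%:E = (\prod_(i < n) c i)%R%:E.
Proof.
elim: n f c => [|n IH] f c mf f0 fc.
  rewrite ge0_integral_leb0; first by rewrite !big_ord0.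
  by under eq_fun do rewrite big_ord0; exact: measurable_cst.
have mp : forall (k : nat) (g : 'I_k -> R -> R),
    (forall i, measurable_fun setT (g i)) ->
    measurable_fun [set: Rn R k] (fun x : Rn R k => (\prod_(i < k) g i (tnth x i))%R).
  move=> k g mg; apply: measurable_prod => i _.
  by apply: (measurableT_comp (mg i)); exact: measurable_coord.
rewrite ge0_integral_lebS; last 2 first.
- by apply/measurable_EFinP; exact: mp.
- by move=> x; rewrite lee_fin prodr_ge0.
under eq_integral => a _.
  under eq_integral => y _.
    rewrite big_ord_recl tnth_tuple_cons0.
    under eq_bigr do rewrite tnth_tuple_consS.
    rewrite EFinM; over.
  rewrite ge0_integralZl//; last 3 first.
  - by apply/measurable_EFinP; apply: (mp n (fun i => f (lift ord0 i))).
  - by move=> x _; rewrite lee_fin prodr_ge0.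
  - by rewrite lee_fin.
  rewrite (IH (fun i => f (lift ord0 i)) (fun i => c (lift ord0 i)))//.
  over.
rewrite ge0_integralZr//; last 3 first.
- by apply/measurable_EFinP; exact: mf.
- by move=> x _; rewrite lee_fin.
- rewrite lee_fin prodr_ge0// => i _; rewrite -lee_fin -fc.
  by apply: integral_ge0 => x _; rewrite lee_fin.
by rewrite fc big_ord_recl EFinM.
Qed.

End leb_integral.

Section euclidean_measurability.
Context {R : realType} {N : nat}.

Lemma measurable_dotp d (X : measurableType d) (f g : X -> Rn R N) :
  measurable_fun setT f -> measurable_fun setT g ->
  measurable_fun setT (fun x => dotp (f x) (g x)).
Proof.
move=> mf mg; apply: measurable_sum => i; apply: measurable_funM.
- by apply: (measurableT_comp (measurable_coord i)).
- by apply: (measurableT_comp (measurable_coord i)).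
Qed.

Lemma measurable_enorm d (X : measurableType d) (f : X -> Rn R N) :
  measurable_fun setT f -> measurable_fun setT (fun x => enorm (f x)).
Proof.
move=> mf; apply: (measurableT_comp (f := @Num.sqrt R)).
  apply: continuous_measurable_fun; exact: sqrt_continuous.
exact: measurable_dotp.
Qed.

Lemma tnth_vsub (x y : Rn R N) i : tnth (vsub x y) i = tnth x i - tnth y i :> R.
Proof. by rewrite tnth_mktuple. Qed.

Lemma measurable_vsub d (X : measurableType d) (f g : X -> Rn R N) :
  measurable_fun setT f -> measurable_fun setT g ->
  measurable_fun setT (fun x => vsub (f x) (g x)).
Proof.
move=> mf mg; apply/measurable_fun_tnthP => i /=.
rewrite (_ : _ \o _ = (fun x => (tnth (f x) i : R) - (tnth (g x) i : R))); last first.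
  by apply/funext => x /=; rewrite tnth_vsub.
apply: measurable_funB.
- by apply: (measurableT_comp (measurable_coord i)).
- by apply: (measurableT_comp (measurable_coord i)).
Qed.

Lemma dotp_ge0 (x : Rn R N) : 0 <= dotp x x.
Proof. by apply: sumr_ge0 => i _; rewrite -expr2 sqr_ge0. Qed.

Lemma enorm_ge0 (x : Rn R N) : 0 <= enorm x.
Proof. exact: sqrtr_ge0. Qed.

Lemma sqr_enorm (x : Rn R N) : enorm x ^+ 2 = dotp x x.
Proof. by rewrite sqr_sqrtr// dotp_ge0. Qed.

Definition rn0 : Rn R N := [tuple (0 : R) | i < N].

Lemma dotp0l (y : Rn R N) : dotp rn0 y = 0.
Proof. by rewrite /dotp big1// => i _; rewrite tnth_mktuple mul0r. Qed.

(** Open cubes are products of intervals, so their volume follows from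
    one-dimensional data; balls are compared with cubes in both directions. *)
Definition cube (x : Rn R N) (a : R) : set (Rn R N) :=
  [set y | forall i, `|(tnth y i : R) - tnth x i| < a].

Lemma indic_cubeE (x : Rn R N) (a : R) y :
  \1_(cube x a) y = \prod_(i < N) \1_(ball (tnth x i : R) a) (tnth y i) :> R.
Proof.
rewrite indicE; case: (boolP (y \in cube x a)) => yx.
  rewrite big1// => i _; rewrite indicE mem_set//=.
  move: yx; rewrite inE => /(_ i); rewrite /ball/=.
  by rewrite distrC.
have [i hi] : exists i, ~ `|(tnth y i : R) - tnth x i| < a.
  apply/existsNP => H; move/negP: yx; apply; rewrite inE; exact: H.
rewrite (bigD1 i)//= indicE memNset ?mul0r// /ball/= distrC.
exact: hi.
Qed.

Lemma measurable_cube (x : Rn R N) a : measurable (cube x a).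
Proof.
rewrite (_ : cube x a = \bigcap_(i in [set: 'I_N])
    ((fun y : Rn R N => tnth y i : R) @^-1` (ball (tnth x i : R) a))); last first.
  apply/seteqP; split=> y /=.
    by move=> h i _; rewrite /ball/= distrC; exact: h.
  by move=> h i; have := h i I; rewrite /ball/= distrC.
apply: fin_bigcap_measurable; first exact: finite_finset.
move=> i _; rewrite -[X in measurable X]setTI.
by apply: measurable_coord => //; exact: measurable_ball.
Qed.

Lemma leb_cube (x : Rn R N) a : 0 <= a -> leb N (cube x a) = ((2 * a) ^+ N)%:E.
Proof.
move=> a0; rewrite -[cube x a]setIT -(integral_indic (leb N))//; last exact: measurable_cube.
under eq_integral do rewrite indic_cubeE.
rewrite (integral_leb_prod (f := fun i => \1_(ball (tnth x i : R) a))
  (c := fun=> 2 * a))//.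
- by rewrite prodr_const card_ord.
- by move=> i; apply: measurable_indic; exact: measurable_ball.
- move=> i; rewrite integral_indic//; last exact: measurable_ball.
  rewrite setIT; have := lebesgue_measure_ball (tnth x i : R) a0.
  by rewrite mulr_natl => <-.
Qed.

End euclidean_measurability.

(** * Gaussian integrals on the line *)

Section heat1.
Context {R : realType}.
Notation mu := (@lebesgue_measure R).

(** Fundamental solution of the heat equation on the line at time a. *)
Definition heat1 (a x : R) : R := (Num.sqrt (4 * pi * a))^-1 * expR (- (x ^+ 2 / (4 * a))).

Lemma heat1_ge0 a x : 0 <= heat1 a x.
Proof. by rewrite mulr_ge0 ?expR_ge0// invr_ge0 sqrtr_ge0. Qed.

(** A translate of the heat kernel is a normal density of variance 2a; its mass is
    then known. *)
Lemma heat1_normal_pdf a x y : 0 < a ->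
  heat1 a (x - y) = normal_pdf x (Num.sqrt (2 * a)) y.
Proof.
move=> a0; rewrite normal_pdfE ?gt_eqF ?sqrtr_gt0 ?mulr_gt0//.
rewrite /heat1 /normal_peak /normal_fun sqr_sqrtr ?mulr_ge0 ?ltW//.
congr (_^-1 * expR _).
  by congr Num.sqrt; rewrite mulr2n; ring.
rewrite mulNr; congr (- (_ / _)); first by ring.
by rewrite mulr2n; ring.
Qed.

Lemma measurable_heat1 a : measurable_fun setT (heat1 a).
Proof.
apply: measurable_funM => //; apply: measurableT_comp => //.
apply: measurableT_comp => //; apply: measurable_funM => //.
Qed.

Lemma integral_heat1 a x : 0 < a -> (\int[mu]_y (heat1 a (x - y))%:E = 1)%E.
Proof.
move=> a0; under eq_integral do rewrite heat1_normal_pdf//.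
exact: integral_normal_pdf.
Qed.

Lemma heat1N a x : heat1 a (- x) = heat1 a x.
Proof. by rewrite /heat1 sqrrN. Qed.

(** Completing the square in z turns the product of two kernels into a kernel in
    x - y times a kernel centred at the weighted mean m of x and y. *)
Lemma integral_heat1_conv a b x y : 0 < a -> 0 < b ->
  (\int[mu]_z (heat1 a (x - z) * heat1 b (z - y))%:E = (heat1 (a + b) (x - y))%:E)%E.
Proof.
move=> a0 b0; have ab0 : 0 < a + b by rewrite addr_gt0.
(* the minimiser in z of (x - z)^2 / a + (z - y)^2 / b *)
pose m := (b * x + a * y) / (a + b).
have ab'0 : 0 < a * b / (a + b) by rewrite divr_gt0// mulr_gt0.
transitivity (\int[mu]_z ((heat1 (a + b) (x - y))%:E *
   (heat1 (a * b / (a + b)) (m - z))%:E))%E; last first.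
  rewrite ge0_integralZl//; first by rewrite integral_heat1// mule1.
  - apply/measurable_EFinP; apply: (measurableT_comp (measurable_heat1 _)).
    exact: measurable_funB.
  - by move=> z _; rewrite lee_fin heat1_ge0.
  - by rewrite lee_fin heat1_ge0.
apply: eq_integral => z _; rewrite -EFinM; congr EFin.
rewrite /heat1 mulrACA -expRD [RHS]mulrACA -expRD; congr (_ * expR _).
  rewrite -!invfM -!sqrtrM; last 2 first.
  - by rewrite !mulr_ge0 ?pi_ge0// ltW.
  - by rewrite !mulr_ge0 ?pi_ge0// ltW.
  by congr (Num.sqrt _)^-1; field; rewrite gt_eqF.
by rewrite /m; field; rewrite !gt_eqF.
Qed.

Lemma gauss_heat1 a x : 0 < a -> expR (- (a * x ^+ 2)) =
  Num.sqrt (pi / a) * heat1 (4 * a)^-1 x.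
Proof.
move=> a0; rewrite /heat1.
rewrite (_ : 4 * pi * (4 * a)^-1 = pi / a); last by field; rewrite gt_eqF.
rewrite mulVKf ?gt_eqF ?sqrtr_gt0 ?divr_gt0 ?pi_gt0//.
by congr (expR (- _)); field; rewrite gt_eqF.
Qed.

Lemma integral_gauss_scaled a : 0 < a ->
  (\int[mu]_x (expR (- (a * x ^+ 2)))%:E = (Num.sqrt (pi / a))%:E)%E.
Proof.
move=> a0; under eq_integral do rewrite gauss_heat1// EFinM.
rewrite ge0_integralZl//; last 2 first.
- by apply/measurable_EFinP; exact: measurable_heat1.
- by move=> z _; rewrite lee_fin heat1_ge0.
under eq_integral => y _ do rewrite -heat1N -[- y]add0r.
by rewrite integral_heat1 ?mule1// invr_gt0 mulr_gt0.
Qed.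

Lemma measurable_gauss_scaled a : measurable_fun setT (fun x : R => expR (- (a * x ^+ 2))).
Proof.
apply: measurableT_comp => //; apply: measurableT_comp => //.
by apply: measurable_funM => //; exact: measurable_funX.
Qed.

Lemma integrable_gauss_scaled a : 0 < a ->
  mu.-integrable setT (EFin \o (fun x : R => expR (- (a * x ^+ 2)))).
Proof.
move=> a0; apply/integrableP; split.
  by apply/measurable_EFinP; exact: measurable_gauss_scaled.
under eq_integral do rewrite /= ger0_norm ?expR_ge0//.
by rewrite integral_gauss_scaled// ltry.
Qed.

Lemma normr_le_gauss a (x : R) : 0 < a ->
  `|x| <= (1 + a^-1) * expR (a * x ^+ 2).
Proof.
move=> a0; have := expR_ge1Dx (a * x ^+ 2) => h.
apply: le_trans (_ : (1 + a^-1) * (1 + a * x ^+ 2) <= _); last first.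
  by rewrite ler_pM2l// addr_gt0// invr_gt0.
have -> : x ^+ 2 = `|x| ^+ 2 by rewrite real_normK// num_real.
have n0 := normr_ge0 x; set u := `|x| in n0 *.
have -> : (1 + a^-1) * (1 + a * u ^+ 2) = 1 + a^-1 + a * u ^+ 2 + u ^+ 2.
  by field; rewrite gt_eqF.
have : 0 < a^-1 by rewrite invr_gt0.
have : 0 <= a * u ^+ 2 by rewrite mulr_ge0 ?sqr_ge0// ltW.
nra.
Qed.

End heat1.

Section gauss_fourier1.
Context {R : realType}.
Notation mu := (@lebesgue_measure R).

Definition sym_itv (n : nat) : set R := `[- n%:R, n%:R]%classic.

(** Improper integrals over R are computed as limits over symmetric intervals, where
    the fundamental theorem of calculus and reflection are available. *)
Lemma cvg_integral_sym_itv (f : R -> R) : mu.-integrable setT (EFin \o f) ->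
  (\int[mu]_(y in sym_itv n) (f y)%:E)%E @[n --> \oo] --> (\int[mu]_y (f y)%:E)%E.
Proof.
move=> fi; under eq_fun do rewrite integral_mkcond.
have H := @dominated_convergence _ _ R mu setT measurableT
  (fun n => (fun y => (f y)%:E) \_ (sym_itv n))
  (EFin \o f) (abse \o (EFin \o f)).
refine (let: And3 _ _ h := H _ _ _ _ _ in h).
- move=> n; apply/(measurable_restrictT _ _).1; first exact: measurable_itv.
  by apply: measurable_funTS; case/integrableP: fi.
- by case/integrableP: fi.
- apply/aeW => y _; apply: cvg_near_cst.
  near=> n; rewrite patchE mem_set//= /sym_itv/= in_itv/= -ler_norml.
  near: n; exact: nbhs_infty_ger.
- exact: integrable_abse.
- apply/aeW => y n _ /=; rewrite patchE; case: ifP => // _.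
  by rewrite (_ : point = 0%E)// abse0 lee_fin.
Unshelve. all: by end_near. Qed.

Lemma is_derive_cosM (y x : R) :
  is_derive x (1 : R) (fun x => cos (x * y)) (- (y * sin (x * y))).
Proof.
apply: (@is_derive_eq _ _ _ (cos \o (fun x => x * y)) x 1 ).
by rewrite /GRing.scale/=; ring.
Qed.

Lemma is_derive_gauss_scaled (a y : R) :
  is_derive y (1 : R) (fun y : R => expR (- (a * y ^+ 2))) (- (2 * a * y) * expR (- (a * y ^+ 2))).
Proof.
apply: (@is_derive_eq _ _ _ (expR \o (fun y => - (a * y ^+ 2))) y 1 ).
by rewrite /GRing.scale/=; ring.
Qed.

Lemma is_derive_sinM (y x : R) :
  is_derive y (1 : R) (fun y => sin (x * y)) (x * cos (x * y)).
Proof.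
apply: (@is_derive_eq _ _ _ (sin \o (fun y => x * y)) y 1 ).
by rewrite /GRing.scale/=; ring.
Qed.

Variable a : R.
Hypothesis a0 : 0 < a.
Let e y := expR (- (a * y ^+ 2)).

Lemma measurable_trigM (f : R -> R) (x : R) : continuous f ->
  measurable_fun setT (fun y => f (x * y)).
Proof.
move=> cf; apply: (measurableT_comp (f := f)).
  exact: continuous_measurable_fun.
exact: measurable_funM.
Qed.

Lemma integrable_gauss_dom (f : R -> R) (C : R) :
  measurable_fun setT f -> (forall y, `|f y| <= C * expR (- (a / 2 * y ^+ 2))) ->
  mu.-integrable setT (EFin \o f).
Proof.
move=> mf fC; apply: (@le_integrable _ _ _ mu setT measurableT _
  (EFin \o (fun y => C * expR (- (a / 2 * y ^+ 2))))) => //.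
- exact/measurable_EFinP.
- by move=> y _ /=; rewrite lee_fin (le_trans (fC y))// ler_norm.
- rewrite (_ : _ \o _ = (fun y => C%:E * (expR (- (a / 2 * y ^+ 2)))%:E)%E)//.
  by apply: integrableZl => //; apply: integrable_gauss_scaled; rewrite divr_gt0.
Qed.

Lemma gauss_le_half y : e y <= expR (- (a / 2 * y ^+ 2)).
Proof.
rewrite ler_expR lerN2 ler_wpM2r ?sqr_ge0// ler_pdivrMr// ler_peMr ?ltW//.
by rewrite ltr1n.
Qed.

Lemma normrM_gauss_le y : `|y| * e y <= (1 + (a / 2)^-1) * expR (- (a / 2 * y ^+ 2)).
Proof.
have a20 : 0 < a / 2 by rewrite divr_gt0.
have := normr_le_gauss y a20.
have -> : e y = expR (- (a / 2 * y ^+ 2)) * expR (- (a / 2 * y ^+ 2)).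
  by rewrite -expRD; congr expR; field.
move=> h; rewrite mulrA ler_pM2r ?expR_gt0//.
rewrite expRN ler_pdivrMr ?expR_gt0//.
Qed.

Lemma measurable_gauss : measurable_fun setT e.
Proof. exact: measurable_gauss_scaled. Qed.

Lemma integrable_trigM_gauss (f : R -> R) x : continuous f -> (forall x, `|f x| <= 1) ->
  mu.-integrable setT (EFin \o (fun y => f (x * y) * e y)).
Proof.
move=> cf f1; apply: (@integrable_gauss_dom _ 1).
  by apply: measurable_funM; [exact: measurable_trigM|exact: measurable_gauss].
move=> y; rewrite mul1r normrM; apply: le_trans (gauss_le_half y).
by rewrite (ger0_norm (expR_ge0 _)) ler_piMl// expR_ge0.
Qed.

Lemma norm_sin_le1 (x : R) : `|sin x| <= 1.
Proof. by rewrite ler_norml sin_geN1 sin_le1. Qed.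

Lemma norm_cos_le1 (x : R) : `|cos x| <= 1.
Proof. by rewrite ler_norml cos_geN1 cos_le1. Qed.

Lemma integrable_MtrigM_gauss (f : R -> R) x : continuous f -> (forall x, `|f x| <= 1) ->
  mu.-integrable setT (EFin \o (fun y => y * f (x * y) * e y)).
Proof.
move=> cf f1; apply: (@integrable_gauss_dom _ (1 + (a / 2)^-1)).
  apply: measurable_funM; last exact: measurable_gauss.
  by apply: measurable_funM => //; exact: measurable_trigM.
move=> y; apply: le_trans (normrM_gauss_le y).
rewrite !normrM (ger0_norm (expR_ge0 _)) ler_wpM2r ?expR_ge0//.
by rewrite ler_piMr.
Qed.

Lemma continuous_gauss : continuous e.
Proof.
move=> y; apply: differentiable_continuous; apply/derivable1_diffP.
by have [] := is_derive_gauss_scaled a y.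
Qed.

Lemma continuous_trigM (f : R -> R) (x : R) : continuous f -> continuous (fun y : R => f (x * y)).
Proof.
move=> cf y; apply: (@continuous_comp _ _ _ ( *%R x) f); last exact: cf.
exact: mulrl_continuous.
Qed.

(** The derivative of sin (x y) exp (-a y^2) in y is the difference of the two
    integrands, and its integral over R vanishes. *)
Lemma gauss_by_parts x :
  \int[mu]_y (y * sin (x * y) * e y) = x / (2 * a) * \int[mu]_y (cos (x * y) * e y).
Proof.
pose g y := x * (cos (x * y) * e y) - (2 * a) * (y * sin (x * y) * e y).
have ic := integrable_trigM_gauss x (@continuous_cos R) norm_cos_le1.
have is_ := integrable_MtrigM_gauss x (@continuous_sin R) norm_sin_le1.
have ic' : mu.-integrable setT (EFin \o (fun y => x * (cos (x * y) * e y))).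
  rewrite (_ : _ \o _ = (fun y => x%:E * (cos (x * y) * e y)%:E)%E)//.
  exact: integrableZl.
have is' : mu.-integrable setT (EFin \o (fun y => (2 * a) * (y * sin (x * y) * e y))).
  rewrite (_ : _ \o _ = (fun y => (2 * a)%:E * (y * sin (x * y) * e y)%:E)%E)//.
  exact: integrableZl.
have ig : mu.-integrable setT (EFin \o g).
  rewrite (_ : EFin \o g = (fun y => (x * (cos (x * y) * e y))%:E -
     (2 * a * (y * sin (x * y) * e y))%:E)%E)//.
  exact: integrableB.
suff g0 : \int[mu]_y g y = 0.
  move: g0; rewrite RintegralB// RintegralZl// RintegralZl//.
  move=> /subr0_eq h; apply: (mulfI (_ : 2 * a != 0)).
    by rewrite gt_eqF// mulr_gt0.
  by rewrite -h; field; rewrite gt_eqF.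
pose F y := sin (x * y) * e y.
have dF y : is_derive y (1 : R) F (g y).
  have d1 := is_derive_sinM x y; have d2 := is_derive_gauss_scaled a y.
  apply: (@is_derive_eq _ _ _ ((fun y => sin (x * y)) * e)).
  by rewrite /g /GRing.scale/= -/(e y); ring.
have cg : continuous g.
  have ce := continuous_gauss.
  have cc (f : R -> R) : continuous f -> continuous (fun y : R => f (x * y)).
    by move=> cf; exact: continuous_trigM.
  move=> y; apply: cvgB; apply: cvgM; do ?exact: cvg_cst.
    by apply: cvgM; [apply: cc; exact: continuous_cos|exact: ce].
  apply: cvgM; last exact: ce.
  by apply: cvgM; [exact: cvg_id|apply: cc; exact: continuous_sin].
have gE n : (\int[mu]_(y in sym_itv n.+1) (g y)%:E = (2 * F n.+1%:R)%:E)%E.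
  rewrite (@continuous_FTC2 _ g F).
  - rewrite -EFinB; congr EFin; rewrite /F mulrN sinN /e sqrrN; ring.
  - by rewrite gtrN// ltr0n.
  - exact: continuous_subspaceT.
  - split.
    + by move=> y _; have [] := dF y.
    + apply: cvg_at_right_filter; apply: differentiable_continuous.
      by apply/derivable1_diffP; have [] := dF (- n.+1%:R).
    + apply: cvg_at_left_filter; apply: differentiable_continuous.
      by apply/derivable1_diffP; have [] := dF (n.+1%:R).
  - by move=> y _; rewrite derive1E; have [_] := dF y.
have F0 : F n.+1%:R @[n --> \oo] --> (0 : R).
  apply: norm_cvg0.
  apply: (@squeeze_cvgr _ _ _ _ (fun=> 0) (fun n => a^-1 * n.+1%:R^-1)) => //.
  - near=> n; rewrite normr_ge0/= /F normrM (ger0_norm (expR_ge0 _)).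
    apply: le_trans (_ : e n.+1%:R <= _).
      by rewrite ler_piMl ?expR_ge0// norm_sin_le1.
    rewrite /e expRN -invfM lef_pV2 ?posrE ?expR_gt0 ?mulr_gt0//.
    apply: le_trans (expR_ge1Dx _).
    rewrite ler_wpDl// ler_pM2l// expr2 ler_pMr ?ltr0n// ler1n//.
  - exact: cvg_cst.
  - rewrite -[X in _ --> X](mulr0 a^-1); apply: cvgM; first exact: cvg_cst.
    exact: cvg_harmonic.
have := cvg_integral_sym_itv ig; rewrite -cvg_shiftS.
under eq_fun do rewrite gE.
move=> h; rewrite /Rintegral.
have h2 : (2 * F n.+1%:R)%:E @[n --> \oo] --> (0 : \bar R)%E.
  apply: cvg_EFin; first by near=> n.
  rewrite /= -[X in _ --> X](mulr0 2); apply: cvgM => //; exact: cvg_cst.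
by rewrite (cvg_unique _ h h2).
Unshelve. all: by end_near. Qed.

(** The form in which the heat kernel appears as a Fourier transform. *)
Lemma heat1_peak x :
  2 * pi * heat1 a x = Num.sqrt (pi / a) * expR (- (x ^+ 2 / (4 * a))).
Proof.
apply/esym; rewrite /heat1 mulrA; congr (_ * _).
have a_0 : a != 0 by rewrite gt_eqF.
have fieldE (q : R) : q != 0 -> 4 * q * a = (2 * q) ^+ 2 * (q / a)^-1.
  by move=> q0; field; rewrite q0 a_0.
rewrite fieldE ?gt_eqF ?pi_gt0//.
have p0 : 0 <= 2 * pi :> R by rewrite mulr_ge0// pi_ge0.
rewrite (@sqrtrM _ ((2 * pi) ^+ 2)) ?sqr_ge0// sqrtr_sqr ger0_norm// sqrtrV; last first.
  by rewrite divr_ge0 ?pi_ge0// ltW.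
rewrite invfM invrK mulrA divff ?mul1r//.
by rewrite gt_eqF// mulr_gt0// pi_gt0.
Qed.

Let J x := \int[mu]_y (cos (x * y) * e y).

(** Differentiation under the integral sign and integration by parts give the
    equation J' = - x / (2a) J. *)
Lemma is_derive_cos_gauss x : is_derive x (1 : R) J (- (x / (2 * a)) * J x).
Proof.
have C0 : 0 <= 1 + (a / 2)^-1.
  by apply: addr_ge0 => //; rewrite invr_ge0; apply: divr_ge0 => //; exact: ltW.
have partialE z y : partial1of2 (fun x y => cos (x * y) * e y) z y = - (y * sin (z * y) * e y).
  rewrite /partial1of2 derive1E.
  suff : is_derive z (1 : R) (fun x => cos (x * y) * e y) (- (y * sin (z * y) * e y)) by case.
  have d1 := is_derive_cosM y z.
  apply: (@is_derive_eq _ _ _ ((fun x => cos (x * y)) * cst (e y))).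
  by rewrite /GRing.scale/=; ring.
have := @cvg_differentiation_under_integral R _ _ mu (fun x y => cos (x * y) * e y)
  setT measurableT x (x - 1) (x + 1).
move=> /(_ _ _ _ (fun y => (1 + (a / 2)^-1) * expR (- (a / 2 * y ^+ 2)))).
have -> : \int[mu]_y partial1of2 (fun x y => cos (x * y) * e y) x y = - (x / (2 * a)) * J x.
  under eq_Rintegral do rewrite partialE -mulN1r.
  rewrite RintegralZl//; last exact: (integrable_MtrigM_gauss x (@continuous_sin R) norm_sin_le1).
  by rewrite gauss_by_parts /J; ring.
move=> H.
have {}H : (h^-1 *: (J (h + x) - J x))%R @[h --> 0^'] --> - (x / (2 * a)) * J x.
  apply: H.
  - by rewrite /= in_itv/=; apply/andP; split; lra.
  - by move=> z _; exact: (integrable_trigM_gauss z (@continuous_cos R) norm_cos_le1).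
  - move=> z y _ _; apply: derivableM; last exact: derivable_cst.
    by have [] := is_derive_cosM y z.
  - by move=> y; rewrite mulr_ge0 ?expR_ge0.
  - apply: (@integrable_gauss_dom _ (1 + (a / 2)^-1)).
      by apply: measurable_funM => //; exact: measurable_gauss_scaled.
    by move=> y; rewrite ger0_norm// mulr_ge0 ?expR_ge0.
  - move=> z y _ _; rewrite partialE normrN.
    apply: le_trans (normrM_gauss_le y).
    rewrite !normrM (ger0_norm (expR_ge0 _)) ler_wpM2r ?expR_ge0//.
    by rewrite ler_piMr// norm_sin_le1.
split; first by apply/cvg_ex; eexists; under eq_fun do rewrite /= scaler1; exact: H.
by apply/cvg_lim => //; under eq_fun do rewrite /= scaler1; exact: H.
Qed.

(** J solves a linear first-order equation, so J (x) exp (x^2 / 4a) is constant, equal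
    to its value at 0. *)
Lemma Rintegral_cos_gauss x : J x = 2 * pi * heat1 a x.
Proof.
have d1 z : is_derive z (1 : R) (fun x => expR ((4 * a)^-1 * x ^+ 2))
    (z / (2 * a) * expR ((4 * a)^-1 * z ^+ 2)).
  apply: (@is_derive_eq _ _ _ (expR \o (fun x => (4 * a)^-1 * x ^+ 2))).
  by rewrite /GRing.scale/=; field; rewrite gt_eqF.
have d0 z : is_derive z (1 : R) (J * (fun x => expR ((4 * a)^-1 * x ^+ 2))) 0.
  have d2 := is_derive_cos_gauss z.
  apply: is_derive_eq.
  by rewrite /GRing.scale/=; ring.
have J0 : J 0 = Num.sqrt (pi / a).
  rewrite /J /Rintegral; under eq_integral do rewrite mul0r cos0 mul1r.
  by rewrite integral_gauss_scaled.
have := is_derive_0_is_cst x 0 d0.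
rewrite !mulrfctE J0 expr0n/= mulr0 expR0 mulr1 => JE.
have -> : J x = Num.sqrt (pi / a) * expR (- ((4 * a)^-1 * x ^+ 2)).
  by rewrite -JE -mulrA -expRD subrr expR0 mulr1.
by rewrite heat1_peak [_^-1 * _]mulrC.
Qed.

End gauss_fourier1.

Section odd_integral.
Context {R : realType}.
Notation mu := (@lebesgue_measure R).

Lemma Rintegral_odd (f : R -> R) : continuous f -> (forall y, f (- y) = - f y) ->
  mu.-integrable setT (EFin \o f) -> \int[mu]_y f y = 0.
Proof.
move=> cf fodd fi.
have f0 n : (\int[mu]_(y in sym_itv n) (f y)%:E = 0)%E.
  have ifn : mu.-integrable (sym_itv n) (EFin \o f).
    apply: integrableS fi => //; exact: measurable_itv.
  have := @integration_by_substitution_oppr R f (- n%:R) n%:R.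
  rewrite opprK => /(_ _ _)-/(_ _ _)/=.
  have -> : (\int[mu]_(x in `[(- n%:R)%R, n%:R%R]) (f (- x))%:E =
             - \int[mu]_(x in `[(- n%:R)%R, n%:R%R]) (f x)%:E)%E.
    rewrite -integralN//; last first.
      by apply: integrable_add_def; [exact: measurable_itv|exact: ifn].
    by apply: eq_integral => y _; rewrite fodd.
  move=> /(_ _ _)h.
  have {}h : (\int[mu]_(x in `[(- n%:R)%R, n%:R%R]) (f x)%:E = - \int[mu]_(x in `[(- n%:R)%R, n%:R%R]) (f x)%:E)%E.
    apply: h; first by rewrite ge0_cp.
    exact: continuous_subspaceT.
  have fin : (\int[mu]_(y in sym_itv n) (f y)%:E)%E \is a fin_num.
    by apply: integrable_fin_num; first exact: measurable_itv.
  have opp_fix (I : \bar R) : I \is a fin_num -> (I = - I)%E -> (I = 0)%E.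
    by case: I => // r _ [rr]; congr EFin; lra.
  exact: opp_fix fin h.
have := cvg_integral_sym_itv fi; under eq_fun do rewrite f0.
move=> h; rewrite /Rintegral.
by rewrite (cvg_unique _ h (cvg_cst _)).
Qed.

End odd_integral.

Section gauss_fourier.
Context {R : realType}.
Notation mu := (@lebesgue_measure R).
Variable s : R.
Hypothesis s0 : 0 < s.
Local Notation e y := (expR (- (s * y ^+ 2))).
Local Notation g x := (expR (- (x ^+ 2 / (4 * s)))).

(** The term A with |b| <= A makes the integrand nonnegative, so that Tonelli's theorem
    applies when the dimension is raised. *)
Lemma integral_cos_gauss_affine (A b c x : R) : `|b| <= A ->
  (\int[mu]_y ((A + b * cos (c + x * y)) * e y)%:E =
   (Num.sqrt (pi / s) * (A + b * cos c * g x))%:E)%E.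
Proof.
move=> bA.
have ie := integrable_gauss_scaled s0.
have ic := integrable_trigM_gauss s0 x (@continuous_cos R) norm_cos_le1.
have is_ := integrable_trigM_gauss s0 x (@continuous_sin R) norm_sin_le1.
have iZ (k : R) f : mu.-integrable setT (EFin \o f) ->
    mu.-integrable setT (fun y => k%:E * (f y)%:E)%E.
  by move=> fi; exact: integrableZl.
have Ic : (\int[mu]_y (cos (x * y) * e y)%:E = (Num.sqrt (pi / s) * g x)%:E)%E.
  have := Rintegral_cos_gauss s0 x; rewrite /Rintegral => h.
  rewrite -[LHS](fineK (integrable_fin_num _ ic))// h.
  by rewrite heat1_peak.
have Is : (\int[mu]_y (sin (x * y) * e y)%:E = 0%:E)%E.
  have := @Rintegral_odd R (fun y => sin (x * y) * e y); rewrite /Rintegral => h.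
  rewrite -[LHS](fineK (integrable_fin_num _ is_))// h//.
  - move=> y; apply: cvgM; last exact: continuous_gauss.
    by apply: continuous_trigM; exact: continuous_sin.
  - by move=> y; rewrite mulrN sinN sqrrN mulNr.
rewrite (_ : (fun y => _) = (fun y => A%:E * (e y)%:E +
   ((b * cos c)%:E * (cos (x * y) * e y)%:E - (b * sin c)%:E * (sin (x * y) * e y)%:E))%E); last first.
  by apply/funext => y; rewrite -!EFinM -EFinB -EFinD; congr EFin; rewrite cosD; ring.
rewrite integralD//; last 2 first.
- exact: iZ.
- by apply: integrableB => //; exact: iZ.
rewrite integralB//; last 2 first.
- exact: iZ.
- exact: iZ.
rewrite !integralZl// Ic Is integral_gauss_scaled// -!EFinM -EFinB -EFinD.
by congr EFin; ring.
Qed.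
End gauss_fourier.

(** * The Gaussian heat kernel *)

Section heat_kernel.
Context {R : realType}.

Definition gaussian {N} (s : R) (xi : Rn R N) : R := expR (- (s * dotp xi xi)).

Definition heat {N} (s : R) (x : Rn R N) : R := \prod_(i < N) heat1 s (tnth x i).

Lemma gaussianE N s (xi : Rn R N) :
  gaussian s xi = \prod_(i < N) expR (- (s * (tnth xi i : R) ^+ 2)).
Proof.
rewrite /gaussian /dotp mulr_sumr -sumrN expR_sum; apply: eq_bigr => i _.
by rewrite expr2.
Qed.

Lemma dotp_cons n (x0 a : R) (x y : Rn R n) :
  dotp (tuple_cons (x0, x)) (tuple_cons (a, y)) = x0 * a + dotp x y.
Proof.
rewrite /dotp big_ord_recl !tnth_tuple_cons0; congr (_ + _).
by apply: eq_bigr => i _; rewrite !tnth_tuple_consS.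
Qed.

Lemma measurable_gaussian N s : measurable_fun setT (@gaussian N s).
Proof.
apply: measurableT_comp => //; apply: measurableT_comp => //.
by apply: measurable_funM => //; exact: measurable_dotp.
Qed.

Lemma measurable_cos_dotp N (c : R) x :
  measurable_fun setT (fun xi : Rn R N => cos (c + dotp x xi)).
Proof.
apply: (measurableT_comp (f := cos)).
  by apply: continuous_measurable_fun; exact: continuous_cos.
by apply: measurable_funD => //; exact: measurable_dotp.
Qed.

Variable s : R.
Hypothesis s0 : 0 < s.

(** Induction on the dimension: integrating out all coordinates but the first leaves an
    integrand of the same affine shape, with b multiplied by a number in [0, 1]. *)
Lemma integral_affine_cos_gaussian n (A b c : R) (x : Rn R n) : `|b| <= A ->
  (\int[leb n]_xi ((A + b * cos (c + dotp x xi)) * gaussian s xi)%:E =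
  (Num.sqrt (pi / s) ^+ n *
   (A + b * cos c * \prod_(i < n) expR (- ((tnth x i : R) ^+ 2 / (4 * s)))))%:E)%E.
Proof.
have mf m (A' b' c' : R) (y : Rn R m) : measurable_fun setT
   (fun xi => ((A' + b' * cos (c' + dotp y xi)) * gaussian s xi)%:E).
  apply/measurable_EFinP; apply: measurable_funM; last exact: measurable_gaussian.
  by apply: measurable_funD => //; apply: measurable_funM => //; exact: measurable_cos_dotp.
have f0 (A' b' t : R) : `|b'| <= A' -> 0 <= A' + b' * cos t.
  move=> bA; have : `|b' * cos t| <= A'.
    rewrite normrM; apply: le_trans bA; rewrite ler_piMr//.
    exact: norm_cos_le1.
  by rewrite ler_norml => /andP[h _]; lra.
elim: n A b c x => [|n IH] A b c x bA.
  rewrite ge0_integral_leb0//.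
  by rewrite gaussianE /dotp !big_ord0 addr0 !mulr1 mul1r.
rewrite ge0_integral_lebS//; last first.
  by move=> xi; rewrite lee_fin mulr_ge0 ?expR_ge0// f0.
rewrite -(tuple_unconsK x); case: (tuple_uncons x) => x0 x'.
set P := \prod_(i < n) expR (- ((tnth x' i : R) ^+ 2 / (4 * s))).
have P0 : 0 <= P by apply: prodr_ge0 => i _; exact: expR_ge0.
(* keeps |b P| <= A, so that the integrand over the first coordinate is nonnegative *)
have P1 : P <= 1.
  apply: prodr_ile1 => i _; rewrite expR_ge0/= -[leRHS]expR0 ler_expR oppr_le0.
  by rewrite divr_ge0 ?sqr_ge0// mulr_ge0// ltW.
under eq_integral => a _.
  under eq_integral => y _.
    rewrite dotp_cons addrA.
    rewrite (_ : _ * gaussian _ _ = expR (- (s * a ^+ 2)) *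
      ((A + b * cos (c + x0 * a + dotp x' y)) * gaussian s y)); last first.
      rewrite /gaussian dotp_cons mulrDr opprD expRD -expr2.
      by rewrite mulrCA.
    rewrite EFinM.
    over.
  rewrite ge0_integralZl//; last 2 first.
  - exact: mf.
  - by move=> y _; rewrite lee_fin mulr_ge0 ?expR_ge0// f0.
  rewrite IH// -/P -EFinM.
  rewrite (_ : expR _ * (_ * _) = Num.sqrt (pi / s) ^+ n *
     ((A + (b * P) * cos (c + x0 * a)) * expR (- (s * a ^+ 2)))); last by ring.
  rewrite EFinM.
  over.
rewrite ge0_integralZl//; last 2 first.
- apply/measurable_EFinP; apply: measurable_funM; last exact: measurable_gauss_scaled.
  apply: measurable_funD => //; apply: measurable_funM => //.
  apply: (measurableT_comp (f := cos)).
    by apply: continuous_measurable_fun; exact: continuous_cos.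
  by apply: measurable_funD => //; exact: measurable_funM.
- move=> a _; rewrite lee_fin mulr_ge0 ?expR_ge0// f0//.
  by rewrite normrM (ger0_norm P0); apply: le_trans bA; rewrite ler_piMr.
rewrite integral_cos_gauss_affine//; last first.
  by rewrite normrM (ger0_norm P0); apply: le_trans bA; rewrite ler_piMr.
rewrite -EFinM; congr EFin; rewrite big_ord_recl tnth_tuple_cons0.
under eq_bigr do rewrite tnth_tuple_consS.
by rewrite -/P (exprS _ n); ring.
Qed.

Lemma integral_gaussian N :
  (\int[leb N]_xi (gaussian s xi)%:E = (Num.sqrt (pi / s) ^+ N)%:E)%E.
Proof.
have := @integral_affine_cos_gaussian N 1 0 0 (rn0 : Rn R N).
rewrite normr0 ler01 => /(_ isT); rewrite !mul0r addr0 mulr1 => <-.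
by apply: eq_integral => xi _; rewrite mul0r addr0 mul1r.
Qed.

Lemma integrable_gaussian N : (leb N).-integrable setT (EFin \o @gaussian N s).
Proof.
apply/integrableP; split; first by apply/measurable_EFinP; exact: measurable_gaussian.
under eq_integral do rewrite /= ger0_norm ?expR_ge0//.
by rewrite integral_gaussian ltry.
Qed.

Lemma integrable_cos_dotpM N (x : Rn R N) (m : Rn R N -> R) :
  (leb N).-integrable setT (EFin \o m) ->
  (leb N).-integrable setT (EFin \o (fun xi => cos (dotp x xi) * m xi)).
Proof.
move=> im; have mm : measurable_fun setT m.
  by apply/measurable_EFinP; case/integrableP: im.
apply: le_integrable im => //.
  apply/measurable_EFinP; apply: measurable_funM => //.
  have := measurable_cos_dotp 0 x; congr measurable_fun.
  by apply/funext => xi; rewrite add0r.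
by move=> xi _ /=; rewrite lee_fin normrM ler_piMl// norm_cos_le1.
Qed.

(** Fourier inversion for Gaussians, read off from the affine identity with A = b = 1
    by subtracting the constant term. *)
Lemma Rintegral_cos_gaussian N (x : Rn R N) :
  \int[leb N]_xi (cos (dotp x xi) * gaussian s xi) = (2 * pi) ^+ N * heat s x.
Proof.
have i1 := integrable_gaussian N.
have i2 := integrable_cos_dotpM x i1.
have := @RintegralD _ _ R (leb N) setT _ _ measurableT i1 i2.
have -> : \int[leb N]_xi (gaussian s xi) = Num.sqrt (pi / s) ^+ N.
  by rewrite /Rintegral integral_gaussian.
have -> : \int[leb N]_xi (gaussian s xi + cos (dotp x xi) * gaussian s xi) =
   Num.sqrt (pi / s) ^+ N + (2 * pi) ^+ N * heat s x.
  rewrite /Rintegral.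
  under eq_integral => xi _.
    rewrite -[X in (X + _)%R]mul1r -mulrDl -[X in (1 + X)%R]mul1r -[dotp x xi]add0r.
    over.
  rewrite integral_affine_cos_gaussian ?normr1//= cos0 !mul1r mulrDr mulr1.
  have expE (q : R) : q ^+ N = \prod_(i < N) q by rewrite prodr_const card_ord.
  congr (_ + _); rewrite /heat !(expE _) -!big_split/=.
  by apply: eq_bigr => i _; rewrite heat1_peak.
by move=> /addrI ->.
Qed.

Lemma heat_ge0 N (x : Rn R N) : 0 <= heat s x.
Proof. by apply: prodr_ge0 => i _; exact: heat1_ge0. Qed.

Lemma integral_heat N (x : Rn R N) :
  (\int[leb N]_y (heat s (vsub x y))%:E = 1)%E.
Proof.
rewrite /heat; under eq_integral => y _ do under eq_bigr do rewrite tnth_vsub.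
rewrite (integral_leb_prod (f := fun i z => heat1 s ((tnth x i : R) - z)) (c := fun=> 1)).
- by rewrite big1.
- by move=> i; apply: (measurableT_comp (measurable_heat1 _)); exact: measurable_funB.
- by move=> i z; exact: heat1_ge0.
- by move=> i; rewrite integral_heat1.
Qed.

Lemma measurable_heat N d (X : measurableType d) (f : X -> Rn R N) :
  measurable_fun setT f -> measurable_fun setT (fun x => heat s (f x)).
Proof.
move=> mf; apply: measurable_prod => i _.
apply: (measurableT_comp (measurable_heat1 _)).
by apply: (measurableT_comp (measurable_coord i)).
Qed.

End heat_kernel.

Lemma integral_heat_conv {R : realType} (a b : R) N (x y : Rn R N) : 0 < a -> 0 < b ->
  (\int[leb N]_z (heat a (vsub x z) * heat b (vsub z y))%:E = (heat (a + b) (vsub x y))%:E)%E.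
Proof.
move=> a0 b0; rewrite /heat; under eq_integral => z _.
  rewrite -big_split/=.
  under eq_bigr do rewrite !tnth_vsub.
  over.
rewrite (integral_leb_prod
  (f := fun i z => heat1 a ((tnth x i : R) - z) * heat1 b (z - (tnth y i : R)))
  (c := fun i => heat1 (a + b) ((tnth x i : R) - tnth y i))).
- by congr EFin; apply: eq_bigr => i _; rewrite tnth_vsub.
- move=> i; apply: measurable_funM.
    by apply: (measurableT_comp (measurable_heat1 _)); exact: measurable_funB.
  by apply: (measurableT_comp (measurable_heat1 _)); exact: measurable_funB.
- by move=> i z; rewrite mulr_ge0 ?heat1_ge0.
- by move=> i; exact: integral_heat1_conv.
Qed.

Section heat_average.
Context {R : realType} {N : nat}.
Implicit Types (x y z : Rn R N) (s a : R).

(** When a displacement v satisfies v^2 <= s, doubling the time of the kernel absorbs it,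
    since (u + v)^2 <= 2 u^2 + 2 v^2. *)
Lemma heat1_sub_le s a (u v : R) : 0 < s -> a ^+ 2 <= s -> `|v| <= a ->
  heat1 s u <= Num.sqrt 2 * expR 1 * heat1 (2 * s) (u + v).
Proof.
move=> s0 as_ va; rewrite /heat1.
rewrite (_ : 4 * pi * (2 * s) = 2 * (4 * pi * s)); last by ring.
have p0 : 0 < 4 * pi * s by rewrite !mulr_gt0// pi_gt0.
rewrite [Num.sqrt (2 * _)]sqrtrM//.
have s20 : 0 < Num.sqrt 2 :> R by rewrite sqrtr_gt0.
have q0 : 0 < Num.sqrt (4 * pi * s) by rewrite sqrtr_gt0.
set q := Num.sqrt (4 * pi * s) in q0 *; set r := Num.sqrt 2 in s20 *.
rewrite [leRHS](_ : _ = q^-1 * expR (1 - (u + v) ^+ 2 / (4 * (2 * s)))); last first.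
  by rewrite expRD; field; rewrite !gt_eqF.
rewrite ler_pM2l ?invr_gt0// ler_expR.
have v2 : v ^+ 2 <= s.
  apply: le_trans as_; rewrite -[v ^+ 2]real_normK ?num_real//.
  by rewrite ler_pXn2r// nnegrE// (le_trans _ va).
have -> : - (u ^+ 2 / (4 * s)) = - (2 * u ^+ 2) / (8 * s) by field; rewrite gt_eqF.
have -> : 1 - (u + v) ^+ 2 / (4 * (2 * s)) = (8 * s - (u + v) ^+ 2) / (8 * s).
  by field; rewrite gt_eqF.
rewrite ler_pM2r ?invr_gt0 ?mulr_gt0//.
have := sqr_ge0 (u - v); lra.
Qed.

Lemma heat_sub_le s a x y z : 0 < s -> a ^+ 2 <= s -> cube y a z ->
  heat s (vsub x y) <= (Num.sqrt 2 * expR 1) ^+ N * heat (2 * s) (vsub x z).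
Proof.
move=> s0 as_ yz; rewrite -[N in _ ^+ N]card_ord -prodr_const -big_split/=.
apply: ler_prod => i _; rewrite heat1_ge0/=.
rewrite !tnth_vsub; have := @heat1_sub_le s a ((tnth x i : R) - tnth y i) (tnth y i - tnth z i) s0 as_.
rewrite addrA subrK; apply; rewrite distrC ltW//; exact: yz.
Qed.

(** At times below a^2 the kernel is compared with the kernel at time a^2; the ratio of
    the peaks is written through the value at the origin because that expression is
    linear in the kernel and therefore passes to mixtures. *)
Lemma heat_le_wide s a x : 0 < s -> 0 < a -> s <= a ^+ 2 ->
  heat s x <= Num.sqrt (4 * pi * a ^+ 2) ^+ N * heat s (rn0 : Rn R N) * heat (a ^+ 2) x.
Proof.
move=> s0 a0 sa; rewrite -[N in _ ^+ N]card_ord -prodr_const -!big_split/=.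
apply: ler_prod => i _; rewrite heat1_ge0/= tnth_mktuple /heat1.
have p0 : 0 < 4 * pi * s by rewrite !mulr_gt0// pi_gt0.
have q0 : 0 < 4 * pi * a ^+ 2 by rewrite !mulr_gt0 ?exprn_gt0// pi_gt0.
rewrite expr0n/= mul0r oppr0 expR0 mulr1.
set q := Num.sqrt (4 * pi * a ^+ 2).
rewrite [q * _]mulrC -[leRHS]mulrA mulVKf; last first.
  by rewrite gt_eqF// sqrtr_gt0.
rewrite ler_pM2l ?invr_gt0 ?sqrtr_gt0// ler_expR lerN2.
rewrite ler_wpM2l ?sqr_ge0// lef_pV2 ?posrE ?mulr_gt0 ?exprn_gt0//.
by rewrite ler_pM2l.
Qed.

Lemma cubeC a y z : cube y a z <-> cube z a y.
Proof. by split=> h i; rewrite distrC; exact: h. Qed.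

Lemma measurable_cube2 a :
  measurable [set yz : Rn R N * Rn R N | cube yz.1 a yz.2].
Proof.
rewrite (_ : [set _ | _] = (fun yz => vsub yz.2 yz.1) @^-1` (cube rn0 a)).
  rewrite -[X in measurable X]setTI.
  by apply: measurable_vsub => //; exact: measurable_cube.
by apply/seteqP; split => -[y z] h i; have := h i;
  rewrite /= tnth_vsub tnth_mktuple subr0.
Qed.

Local Open Scope ereal_scope.

Variables (a M : R) (g : Rn R N -> \bar R).
Hypotheses (a0 : (0 < a)%R) (M0 : (0 <= M)%R) (mg : measurable_fun setT g)
  (g0 : forall y, 0 <= g y)
  (gM : forall z, \int[leb N]_(y in cube z a) g y <= M%:E).

Let c : R := ((Num.sqrt 2 * expR 1) ^+ N / (2 * a) ^+ N)%R.

Let c0 : (0 <= c)%R.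
Proof. by rewrite divr_ge0 ?exprn_ge0// mulr_ge0 ?expR_ge0// ltW. Qed.

(** Averaging the displaced kernel over the cube around y and exchanging the integrals
    produces integrals of g over cubes against a kernel of mass one. *)
Lemma heat_average_wide s x : (0 < s)%R -> (a ^+ 2 <= s)%R ->
  \int[leb N]_y ((heat s (vsub x y))%:E * g y) <= (c * M)%:E.
Proof.
move=> s0 as_.
have s20 : (0 < 2 * s)%R by rewrite mulr_gt0.
pose h (yz : Rn R N * Rn R N) :=
  (heat (2 * s) (vsub x yz.2))%:E * g yz.1 * (\1_[set yz | cube yz.1 a yz.2] yz)%:E.
have mh : measurable_fun setT h.
  apply: emeasurable_funM.
    apply: emeasurable_funM.
      apply/measurable_EFinP; apply: measurable_heat.
      by apply: measurable_vsub => //; exact: measurable_cst.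
    exact: measurableT_comp.
  by apply/measurable_EFinP; apply: measurable_indic; exact: measurable_cube2.
have h0 yz : 0 <= h yz.
  by rewrite !mule_ge0// lee_fin ?heat_ge0// indicE ler0n.
have indE y z : \1_[set yz : Rn R N * Rn R N | cube yz.1 a yz.2] (y, z) = \1_(cube y a) z :> R.
  by rewrite !indicE; congr (nat_of_bool _)%:R; apply/idP/idP => /set_mem/mem_set.
have indC y z : \1_(cube y a) z = \1_(cube z a) y :> R.
  by rewrite !indicE; congr (nat_of_bool _)%:R; apply/idP/idP => /set_mem/cubeC/mem_set.
have step1 y : (heat s (vsub x y))%:E * g y <= c%:E * \int[leb N]_z h (y, z).
  rewrite /h/=.
  have -> : \int[leb N]_z ((heat (2 * s) (vsub x z))%:E * g y *
       (\1_[set yz : Rn R N * Rn R N | cube yz.1 a yz.2] (y, z))%:E) =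
     g y * \int[leb N]_z ((heat (2 * s) (vsub x z))%:E * (\1_(cube y a) z)%:E).
    rewrite -ge0_integralZl//; last 2 first.
    - apply: emeasurable_funM.
        apply/measurable_EFinP; apply: measurable_heat.
        by apply: measurable_vsub => //; exact: measurable_cst.
      by apply/measurable_EFinP; apply: measurable_indic; exact: measurable_cube.
    - by move=> z _; rewrite mule_ge0 ?lee_fin ?heat_ge0// indicE ler0n.
    by apply: eq_integral => z _; rewrite indE [_ * g y]muleC muleA.
  rewrite muleCA [leLHS]muleC; apply: lee_wpmul2l => //.
  have : \int[leb N]_(z in cube y a) (heat s (vsub x y) / (Num.sqrt 2 * expR 1) ^+ N)%:E <=
      \int[leb N]_z ((heat (2 * s) (vsub x z))%:E * (\1_(cube y a) z)%:E).
    rewrite integral_mkcond epatch_indic; apply: ge0_le_integral => //.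
    - move=> z _ /=; rewrite mule_ge0// lee_fin ?indicE ?ler0n//.
      by rewrite divr_ge0 ?heat_ge0// exprn_ge0// mulr_ge0 ?expR_ge0.
    - apply: emeasurable_funM; first exact: measurable_cst.
      by apply/measurable_EFinP; apply: measurable_indic; exact: measurable_cube.
    - apply: emeasurable_funM.
        apply/measurable_EFinP; apply: measurable_heat.
        by apply: measurable_vsub => //; exact: measurable_cst.
      by apply/measurable_EFinP; apply: measurable_indic; exact: measurable_cube.
    move=> z _; rewrite /= indicE; case: (boolP (z \in _)) => [/set_mem zy|_].
      rewrite !mule1 lee_fin ler_pdivrMr ?exprn_gt0 ?mulr_gt0 ?expR_gt0 ?sqrtr_gt0//.
      by rewrite mulrC; exact: heat_sub_le zy.
    by rewrite !mule0.
  rewrite integral_cst; last exact: measurable_cube.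
  have cubeE := leb_cube y (ltW a0).
  rewrite [X in _ * X <= _]cubeE -EFinM => hle.
  apply: le_trans (lee_wpmul2l _ hle); last by rewrite lee_fin.
  rewrite -EFinM lee_fin /c mulrA [leRHS](_ : _ = heat s (vsub x y))//.
  field; rewrite !expf_neq0// gt_eqF ?mulr_gt0 ?expR_gt0 ?sqrtr_gt0//.
apply: (@le_trans _ _ (\int[leb N]_y (c%:E * \int[leb N]_z h (y, z)))).
  apply: ge0_le_integral => //.
  - by move=> y _; rewrite mule_ge0// lee_fin heat_ge0.
  - apply: emeasurable_funM => //; apply/measurable_EFinP; apply: measurable_heat.
    by apply: measurable_vsub => //; exact: measurable_cst.
  - apply: emeasurable_funM => //.
    exact: (measurable_fun_fubini_tonelli_F _ mh h0).
rewrite ge0_integralZl//; last 2 first.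
- exact: (measurable_fun_fubini_tonelli_F _ mh h0).
- by move=> y _; exact: integral_ge0.
rewrite (EFinM c M); apply: lee_wpmul2l; first by rewrite lee_fin.
rewrite (fubini_tonelli _ mh h0).
apply: (@le_trans _ _ (\int[leb N]_z ((heat (2 * s) (vsub x z))%:E * M%:E))).
  apply: ge0_le_integral => //.
  - by move=> z _; exact: integral_ge0.
  - exact: (measurable_fun_fubini_tonelli_G _ mh h0).
  - apply: emeasurable_funM => //; apply/measurable_EFinP; apply: measurable_heat.
    by apply: measurable_vsub => //; exact: measurable_cst.
  move=> z _; rewrite /h/=.
  have -> : \int[leb N]_y ((heat (2 * s) (vsub x z))%:E * g y *
       (\1_[set yz : Rn R N * Rn R N | cube yz.1 a yz.2] (y, z))%:E) =
     (heat (2 * s) (vsub x z))%:E * \int[leb N]_y (g y * (\1_(cube z a) y)%:E).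
    rewrite -ge0_integralZl//; last 3 first.
    - apply: emeasurable_funM => //.
      by apply/measurable_EFinP; apply: measurable_indic; exact: measurable_cube.
    - by move=> y _; rewrite mule_ge0// lee_fin indicE ler0n.
    - by rewrite lee_fin heat_ge0.
    by apply: eq_integral => y _; rewrite indE indC muleA.
  apply: lee_wpmul2l; first by rewrite lee_fin heat_ge0.
  apply: le_trans (gM z).
  by rewrite [leRHS]integral_mkcond epatch_indic.
rewrite ge0_integralZr//; last 2 first.
- apply/measurable_EFinP; apply: measurable_heat.
  by apply: measurable_vsub => //; exact: measurable_cst.
- by move=> z _; rewrite lee_fin heat_ge0.
by rewrite integral_heat// mul1e.
Qed.

(** The bound is affine in the value of the kernel at the origin, hence stable under
    positive combinations of Gaussians of different widths. *)
Lemma heat_average s x : (0 < s)%R ->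
  \int[leb N]_y ((heat s (vsub x y))%:E * g y) <=
  (c * M * (1 + Num.sqrt (4 * pi * a ^+ 2) ^+ N * heat s (rn0 : Rn R N)))%:E.
Proof.
move=> s0; have cM0 : (0 <= c * M)%R by rewrite mulr_ge0.
have q0 : (0 <= Num.sqrt (4 * pi * a ^+ 2) ^+ N * heat s (rn0 : Rn R N))%R.
  by rewrite mulr_ge0 ?heat_ge0// exprn_ge0// sqrtr_ge0.
have mheat r : measurable_fun setT (fun y => (heat r (vsub x y))%:E * g y).
  apply: emeasurable_funM => //; apply/measurable_EFinP; apply: measurable_heat.
  by apply: measurable_vsub => //; exact: measurable_cst.
(* at times below a^2, the kernel at time a^2 takes over *)
have [as_|sa] := leP (a ^+ 2)%R s.
  apply: le_trans (heat_average_wide x s0 as_) _.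
  by rewrite lee_fin ler_peMr// lerDl.
have a20 : (0 < a ^+ 2)%R by rewrite exprn_gt0.
have h := heat_average_wide x a20 (lexx _).
set q := (_ * heat _ _)%R in q0 *.
apply: (@le_trans _ _ (q%:E * \int[leb N]_y ((heat (a ^+ 2) (vsub x y))%:E * g y))).
  rewrite -ge0_integralZl//; last first.
    by move=> y _; rewrite mule_ge0// lee_fin heat_ge0.
  apply: ge0_le_integral => //.
  - by move=> y _; rewrite mule_ge0// lee_fin heat_ge0.
  - exact: emeasurable_funM.
  - move=> y _; rewrite muleA; apply: lee_wpmul2r => //.
    by rewrite -EFinM lee_fin; apply: heat_le_wide => //; exact: ltW.
apply: le_trans (lee_wpmul2l _ h) _; first by rewrite lee_fin.
rewrite -EFinM lee_fin mulrDr mulr1 mulrC lerDr//.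
Qed.

End heat_average.

(** * Positive mixtures of Gaussians *)

Lemma le_of_eq d (T : porderType d) (x y : T) : x = y -> (x <= y)%O.
Proof. by move->. Qed.

Section fatou_bounds.
Context {R : realType}.
Local Open Scope ereal_scope.

Lemma limn_einf_le_cvg (u : (\bar R)^nat) (c_ : R^nat) (c : R) :
  (forall n, u n <= (c_ n)%:E) -> c_ n @[n --> \oo] --> c -> limn_einf u <= c%:E.
Proof.
move=> uc cc; have cE : (c_ n)%:E @[n --> \oo] --> c%:E.
  by apply: cvg_EFin => //; near=> n.
rewrite limn_einf_lim -(cvg_lim _ cE)//; apply: lee_lim.
- exact: is_cvg_einfs.
- by apply/cvg_ex; exists c%:E.
- near=> n; apply: le_trans (uc n).
  by apply: ereal_inf_lbound; exists n => /=.
Unshelve. all: by end_near. Qed.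

Lemma limn_einf_ge0 (u : (\bar R)^nat) : (forall n, 0 <= u n) -> 0 <= limn_einf u.
Proof.
move=> u0; rewrite limn_einf_lim; apply: lime_ge; first exact: is_cvg_einfs.
by near=> n; apply: le_ereal_inf_tmp => _ [k _ <-].
Unshelve. all: by end_near. Qed.

(** Stated with an inequality so as to cover g infinite and a zero. *)
Lemma mule_le_limn_einf (a_ : R^nat) (a : R) (g : \bar R) :
  (forall n, 0 <= a_ n)%R -> a_ n @[n --> \oo] --> a -> 0 <= g ->
  a%:E * g <= limn_einf (fun n => (a_ n)%:E * g).
Proof.
move=> a_0 aa; have a0 : (0 <= a)%R.
  by rewrite -(cvg_lim _ aa)//; apply: limr_ge; [apply/cvg_ex; exists a|near=> n].
have cv_le (u : (\bar R)^nat) l : u n @[n --> \oo] --> l -> l <= limn_einf u.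
  by move=> ul; have [-> _] := cvg_limn_einf_sup ul.
case: g => [r| |//] g0.
- apply: cv_le; apply: cvg_EFin; first by near=> n.
  by apply: cvgM => //; exact: cvg_cst.
- have [->|a_neq0] := eqVneq a 0%R.
    rewrite mul0e; apply: limn_einf_ge0 => n.
    by rewrite mule_ge0// lee_fin.
  have a_gt0 : (0 < a)%R by rewrite lt_neqAle eq_sym a_neq0.
  apply: cv_le; rewrite gt0_muley ?lte_fin//; apply: cvg_near_cst.
  have : \forall n \near \oo, (0 < a_ n)%R.
    by apply: cvgr_gt aa _ a_gt0.
  by apply: filterS => n an0; rewrite gt0_muley// lte_fin.
Unshelve. all: by end_near. Qed.

(** Passage to the limit in a bound on integrals: the limit may only decrease the left
    side, while the right side converges. *)
Lemma fatou_le d (T : measurableType d) (mu : {measure set T -> \bar R})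
    (f_ : (T -> \bar R)^nat) (f : T -> \bar R) (c_ : R^nat) (c : R) :
  (forall n, measurable_fun setT (f_ n)) -> measurable_fun setT f ->
  (forall n x, 0 <= f_ n x) -> (forall x, 0 <= f x) ->
  (forall x, f x <= limn_einf (f_^~ x)) ->
  (forall n, \int[mu]_x f_ n x <= (c_ n)%:E) -> c_ n @[n --> \oo] --> c ->
  \int[mu]_x f x <= c%:E.
Proof.
move=> mf_ mf f_0 f0 ff fc cc.
apply: (@le_trans _ _ (\int[mu]_x limn_einf (f_^~ x))).
  apply: ge0_le_integral => //.
  apply: (@emeasurable_fun_cvg _ _ R setT (fun n x => einfs (f_^~ x) n)).
    exact: measurable_fun_einfs.
  by move=> x _; rewrite limn_einf_lim; exact: is_cvg_einfs.
apply: le_trans (limn_einf_le_cvg fc cc).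
exact: fatou.
Qed.

Lemma measurable_Rintegral_param d d' (X : measurableType d) (Y : measurableType d')
    (mu : {sigma_finite_measure set Y -> \bar R}) (f : X * Y -> R) :
  measurable_fun setT f ->
  measurable_fun setT (fun x => (\int[mu]_y f (x, y))%R).
Proof.
move=> mf; have mF : measurable_fun setT (EFin \o f) by exact/measurable_EFinP.
apply: (measurableT_comp (f := fine)); first exact: fine_measurable.
rewrite (_ : (fun x => _) = (fun x => \int[mu]_y (EFin \o f)^\+ (x, y) - \int[mu]_y (EFin \o f)^\- (x, y))).
  apply: emeasurable_funB.
  - by apply: (measurable_fun_fubini_tonelli_F (EFin \o f)^\+) => //; exact: measurable_funepos.
  - by apply: (measurable_fun_fubini_tonelli_F (EFin \o f)^\-) => //; exact: measurable_funeneg.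
apply/funext => x; rewrite [LHS]integralE; congr (_ - _).
  by apply: eq_integral => y _; rewrite !funeposE.
by apply: eq_integral => y _; rewrite !funenegE.
Qed.

Lemma dominated_cvg_pointwise d (T : measurableType d) (mu : {measure set T -> \bar R})
    (f_ : nat -> T -> R) (f g : T -> R) :
  (forall n, measurable_fun setT (f_ n)) -> measurable_fun setT f ->
  mu.-integrable setT (EFin \o g) ->
  (forall x, f_ n x @[n --> \oo] --> f x)%classic ->
  (forall n x, `|f_ n x| <= g x)%R ->
  (\int[mu]_x (f_ n x)%:E @[n --> \oo] --> \int[mu]_x (f x)%:E)%classic /\
  mu.-integrable setT (EFin \o f).
Proof.
move=> mf_ mf ig ff fg.
have H1 n : measurable_fun setT (fun x => (f_ n x)%:E) by exact/measurable_EFinP.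
have H2 : measurable_fun setT (EFin \o f) by exact/measurable_EFinP.
have H3 : {ae mu, forall x, setT x -> ((f_ n x)%:E @[n --> \oo] --> (EFin \o f) x)%classic}.
  apply/aeW => x _; apply: cvg_EFin; first by near=> n.
  exact: ff.
have H4 : {ae mu, forall x n, setT x -> `|(f_ n x)%:E| <= (EFin \o g) x}.
  by apply/aeW => x n _ /=; rewrite lee_fin.
have [fi _ h] := dominated_convergence measurableT H1 H2 H3 ig H4.
exact: (conj h fi).
Unshelve. all: by end_near. Qed.

End fatou_bounds.

Section mixture.
Context {R : realType} {N : nat}.
Implicit Types (m : Rn R N -> R) (x y : Rn R N).

(** The closed convex cone generated by the Gaussians exp (-s |xi|^2), s >= 0, for
    pointwise convergence.  Closing under limits avoids any representation by a measure
    on the parameter s, and linear inequalities are proved by induction. *)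
Inductive mixture : (Rn R N -> R) -> Prop :=
| mixture_gaussian s : 0 <= s -> mixture (gaussian s)
| mixture_add m1 m2 : mixture m1 -> mixture m2 -> mixture (fun xi => m1 xi + m2 xi)
| mixture_scale c m : 0 <= c -> mixture m -> mixture (fun xi => c * m xi)
| mixture_lim (m_ : nat -> Rn R N -> R) m : (forall n, mixture (m_ n)) ->
    (forall xi, m_ n xi @[n --> \oo] --> m xi) -> mixture m.

Lemma gaussianM s s' (xi : Rn R N) : gaussian s xi * gaussian s' xi = gaussian (s + s') xi.
Proof. by rewrite /gaussian -expRD; congr expR; ring. Qed.

Lemma gaussian0 s : gaussian s (rn0 : Rn R N) = 1.
Proof. by rewrite /gaussian dotp0l mulr0 oppr0 expR0. Qed.

Lemma measurable_mixture m : mixture m -> measurable_fun setT m.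
Proof.
elim=> {m} [s s0|m1 m2 _ mm1 _ mm2|c m _ _ mm|m_ m _ mm_ mE].
- exact: measurable_gaussian.
- exact: measurable_funD.
- exact: measurable_funM.
- by apply: (measurable_fun_cvg mm_) => xi _; exact: mE.
Qed.

(** A mixture is largest at the origin, where its value is its total weight. *)
Lemma mixture_bounds m : mixture m -> forall xi, 0 <= m xi <= m rn0.
Proof.
elim=> {m} [s s0|m1 m2 _ h1 _ h2|c m c0 _ h|m_ m _ h mE] xi.
- by rewrite gaussian0 expR_ge0/= -expR0 ler_expR oppr_le0 mulr_ge0// dotp_ge0.
- move: (h1 xi) (h2 xi) => /andP[? ?] /andP[? ?].
  by rewrite addr_ge0// lerD.
- by move: (h xi) => /andP[? ?]; rewrite mulr_ge0// ler_wpM2l.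
- apply/andP; split.
    rewrite -(cvg_lim _ (mE xi))//; apply: limr_ge; first by apply/cvg_ex; exists (m xi).
    by near=> n; have /andP[] := h n xi.
  apply: (ler_cvg_to (mE xi) (mE rn0)).
  by near=> n; have /andP[] := h n xi.
Unshelve. all: by end_near. Qed.

Lemma mixture_ge0 m xi : mixture m -> 0 <= m xi.
Proof. by move=> /mixture_bounds/(_ xi)/andP[]. Qed.

(** Double induction from the product rule for Gaussians. *)
Lemma mixtureM m1 m2 : mixture m1 -> mixture m2 -> mixture (fun xi => m1 xi * m2 xi).
Proof.
move=> h1; elim: h1 m2 => {m1} [s s0|m m' _ IH _ IH'|c m c0 _ IH|m_ m _ IH mE] m2 h2.
- elim: h2 => {m2} [s' s'0|m m' _ IH _ IH'|c m c0 _ IH|m_ m _ IH mE].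
  + rewrite (_ : (fun xi => _) = gaussian (s + s')).
      by apply: mixture_gaussian; rewrite addr_ge0.
    by apply/funext => xi; rewrite gaussianM.
  + rewrite (_ : (fun xi => _) = (fun xi => gaussian s xi * m xi + gaussian s xi * m' xi)).
      exact: mixture_add.
    by apply/funext => xi; rewrite mulrDr.
  + rewrite (_ : (fun xi => _) = (fun xi => c * (gaussian s xi * m xi))).
      exact: mixture_scale.
    by apply/funext => xi; rewrite mulrCA.
  + apply: (mixture_lim IH) => xi.
    by apply: cvgM => //; exact: cvg_cst.
- rewrite (_ : (fun xi => _) = (fun xi => m xi * m2 xi + m' xi * m2 xi)).
    by apply: mixture_add; [exact: IH|exact: IH'].
  by apply/funext => xi; rewrite mulrDl.
- rewrite (_ : (fun xi => _) = (fun xi => c * (m xi * m2 xi))).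
    by apply: mixture_scale => //; exact: IH.
  by apply/funext => xi; rewrite mulrA.
- apply: (mixture_lim (fun n => IH n m2 h2)) => xi.
  by apply: cvgM => //; exact: cvg_cst.
Qed.

(** Inverse Fourier transform of an even function, where only the cosine contributes. *)
Definition ift m x : R := (2 * pi) ^- N * \int[leb N]_xi (cos (dotp x xi) * m xi).

(** Multiplication by a Gaussian makes every mixture integrable; on the other side it
    convolves the transform with the heat kernel at time k. *)
Definition reg (k : R) m : Rn R N -> R := fun xi => gaussian k xi * m xi.

Lemma measurable_ift d (X : measurableType d) m (f : X -> Rn R N) :
  measurable_fun setT m -> measurable_fun setT f ->
  measurable_fun setT (fun u => ift m (f u)).
Proof.
move=> mm mf; apply: measurable_funM => //.
apply: (@measurable_Rintegral_param R _ _ X (Rn R N) (leb N) (fun z => cos (dotp (f z.1) z.2) * m z.2)).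
apply: measurable_funM; last exact: measurableT_comp.
apply: (measurableT_comp (f := cos)).
  by apply: continuous_measurable_fun; exact: continuous_cos.
by apply: measurable_dotp => //; exact: measurableT_comp.
Qed.

Lemma integrable_reg k m : 0 < k -> mixture m ->
  (leb N).-integrable setT (EFin \o reg k m).
Proof.
move=> k0 hm.
apply: (@le_integrable _ _ _ (leb N) setT measurableT _
  (fun xi => (m rn0)%:E * (gaussian k xi)%:E)%E) => //.
- apply/measurable_EFinP; apply: measurable_funM; first exact: measurable_gaussian.
  exact: measurable_mixture.
- move=> xi _ /=; rewrite lee_fin !normrM mulrC.
  have /andP[h0 h1] := mixture_bounds hm xi.
  rewrite ler_wpM2r// ger0_norm//.
  by apply: le_trans h1 _; exact: ler_norm.
- by apply: integrableZl => //; exact: integrable_gaussian.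
Qed.

Lemma cvg_ift (m_ : nat -> Rn R N -> R) m (g : Rn R N -> R) x :
  (forall n, measurable_fun setT (m_ n)) -> measurable_fun setT m ->
  (leb N).-integrable setT (EFin \o g) ->
  (forall n xi, `|m_ n xi| <= g xi) ->
  (forall xi, m_ n xi @[n --> \oo] --> m xi) ->
  ift (m_ n) x @[n --> \oo] --> ift m x.
Proof.
move=> mm_ mm ig mg mE; apply: cvgM; first exact: cvg_cst.
have mc : measurable_fun setT (fun xi : Rn R N => cos (dotp x xi)).
  apply: (measurableT_comp (f := cos)).
    by apply: continuous_measurable_fun; exact: continuous_cos.
  exact: measurable_dotp.
have [H iH] : (\int[leb N]_xi (cos (dotp x xi) * m_ n xi)%:E)%E @[n --> \oo] -->
    (\int[leb N]_xi (cos (dotp x xi) * m xi)%:E)%E /\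
    (leb N).-integrable setT (EFin \o (fun xi => cos (dotp x xi) * m xi)).
  apply: (dominated_cvg_pointwise (g := g)) => //.
  - by move=> n; exact: measurable_funM.
  - exact: measurable_funM.
  - by move=> xi; apply: cvgM; [exact: cvg_cst|exact: mE].
  - move=> n xi; rewrite normrM; apply: le_trans (mg n xi).
    by rewrite ler_piMl// norm_cos_le1.
rewrite /Rintegral; apply: fine_cvg.
by rewrite fineK//; exact: integrable_fin_num.
Unshelve. all: by end_near. Qed.

Lemma ift_reg_gaussian k s x : 0 < k -> 0 <= s -> ift (reg k (gaussian s)) x = heat (k + s) x.
Proof.
move=> k0 s0; have ks0 : 0 < k + s by rewrite ltr_wpDr.
rewrite /ift /reg; under eq_Rintegral do rewrite gaussianM.
rewrite Rintegral_cos_gaussian// mulrA mulVf ?mul1r//.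
by rewrite expf_neq0// gt_eqF// mulr_gt0// pi_gt0.
Qed.

End mixture.

Section mixture_functional.
Context {R : realType} {N : nat}.
Implicit Types (m : Rn R N -> R) (x y z : Rn R N) (L : (Rn R N -> R) -> R).

(** Functionals that respect the three ways of forming mixtures; they are the right
    sides of the inequalities to be transferred. *)
Record mixture_functional L : Prop := MixtureFunctional {
  mixtureF_add : forall m1 m2, mixture m1 -> mixture m2 ->
    L (fun xi => m1 xi + m2 xi) = L m1 + L m2 ;
  mixtureF_scale : forall c m, 0 <= c -> mixture m -> L (fun xi => c * m xi) = c * L m ;
  mixtureF_lim : forall (m_ : nat -> Rn R N -> R) m, (forall n, mixture (m_ n)) -> mixture m ->
    (forall xi, m_ n xi @[n --> \oo] --> m xi) -> L (m_ n) @[n --> \oo] --> L m }.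

Lemma mixtureF_lin L1 L2 (c1 c2 : R) : mixture_functional L1 -> mixture_functional L2 ->
  mixture_functional (fun m => c1 * L1 m + c2 * L2 m).
Proof.
move=> [a1 s1 l1] [a2 s2 l2]; split.
- by move=> m1 m2 h1 h2; rewrite a1// a2//; ring.
- by move=> c m c0 h; rewrite s1// s2//; ring.
- move=> m_ m h_ h mE; apply: cvgD.
    by apply: cvgM; [exact: cvg_cst|exact: l1].
  by apply: cvgM; [exact: cvg_cst|exact: l2].
Qed.

Lemma mixtureF_eval x : mixture_functional (fun m => m x).
Proof. by split. Qed.

Lemma mixtureF_mul m' L : mixture m' -> mixture_functional L ->
  mixture_functional (fun m => L (fun xi => m' xi * m xi)).
Proof.
move=> hm' [a s l]; split.
- move=> m1 m2 h1 h2; rewrite -a; [|exact: mixtureM|exact: mixtureM].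
  by congr L; apply/funext => xi; rewrite mulrDr.
- move=> c m c0 h; rewrite -s//; last exact: mixtureM.
  by congr L; apply/funext => xi; rewrite mulrCA.
- move=> m_ m h_ h mE; apply: (l (fun n xi => m' xi * m_ n xi)).
  + by move=> n; exact: mixtureM.
  + exact: mixtureM.
  + by move=> xi; apply: cvgM; [exact: cvg_cst|exact: mE].
Qed.

Lemma mixtureF_ift k x : 0 < k -> mixture_functional (fun m => ift (reg k m) x).
Proof.
move=> k0; split.
- move=> m1 m2 h1 h2; rewrite /ift -mulrDr; congr (_ * _).
  rewrite -RintegralD//.
  + by apply: eq_Rintegral => xi _; rewrite /reg; ring.
  + by apply: integrable_cos_dotpM; exact: integrable_reg.
  + by apply: integrable_cos_dotpM; exact: integrable_reg.
- move=> c m c0 h; rewrite /ift mulrCA; congr (_ * _).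
  rewrite -RintegralZl//.
  + by apply: eq_Rintegral => xi _; rewrite /reg; ring.
  + by apply: integrable_cos_dotpM; exact: integrable_reg.
- move=> m_ m h_ h mE.
  have [M _ bM] : exists2 M, M \is Num.real & forall n, m_ n rn0 <= M.
    have /cvg_seq_bounded := (cvgP _ (mE rn0)).
    move=> [M [Mr hM]]; exists (M + 1); first by rewrite realD.
    by move=> n; apply: le_trans (ler_norm _) _; apply: (hM (M + 1)) => //; rewrite ltrDl.
  apply: (cvg_ift (g := fun xi => M * gaussian k xi)).
  + move=> n; apply: measurable_funM; first exact: measurable_gaussian.
    exact: measurable_mixture.
  + apply: measurable_funM; first exact: measurable_gaussian.
    exact: measurable_mixture.
  + rewrite (_ : _ \o _ = (fun xi => M%:E * (gaussian k xi)%:E)%E)//.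
    by apply: integrableZl => //; exact: integrable_gaussian.
  + move=> n xi; rewrite /reg mulrC ger0_norm; last first.
      by rewrite mulr_ge0 ?expR_ge0// mixture_ge0.
    rewrite ler_wpM2r ?expR_ge0//; apply: le_trans (bM n).
    by have /andP[] := mixture_bounds (h_ n) xi.
  + by move=> xi; apply: cvgM; [exact: cvg_cst|exact: mE].
Qed.

Lemma mixtureF_ge0 L : mixture_functional L ->
  (forall s, 0 <= s -> 0 <= L (gaussian s)) -> forall m, mixture m -> 0 <= L m.
Proof.
move=> [a s l] L0 m; elim=> {m} [r r0|m1 m2 h1 i1 h2 i2|c m c0 h i|m_ m h i mE].
- exact: L0.
- by rewrite a// addr_ge0.
- by rewrite s// mulr_ge0.
- have hm := mixture_lim h mE.
  have Lc := l m_ m h hm mE.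
  rewrite -(cvg_lim _ Lc)//; apply: limr_ge; first by apply/cvg_ex; exists (L m).
  by near=> n; exact: i.
Unshelve. all: by end_near. Qed.

Lemma ift_reg_ge0 k m x : 0 < k -> mixture m -> 0 <= ift (reg k m) x.
Proof.
move=> k0; apply: (mixtureF_ge0 (mixtureF_ift x k0)) => s s0.
by rewrite ift_reg_gaussian// heat_ge0.
Qed.

Lemma measurable_ift_reg d (X : measurableType d) k m (f : X -> Rn R N) :
  mixture m -> measurable_fun setT f ->
  measurable_fun setT (fun u => ift (reg k m) (f u)).
Proof.
move=> hm mf; apply: measurable_ift => //.
by apply: measurable_funM; [exact: measurable_gaussian|exact: measurable_mixture].
Qed.

Local Open Scope ereal_scope.

(** The transfer principle: both sides are additive and homogeneous, the left side is
    lower semicontinuous by Fatou's lemma and the right side is continuous, so an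
    inequality valid for all Gaussians holds for all mixtures. *)
Lemma mixture_transfer d (X : measurableType d) (mu : {measure set X -> \bar R})
    (phi : X -> Rn R N) (g : X -> \bar R) L k : (0 < k)%R ->
  measurable_fun setT phi -> measurable_fun setT g -> (forall u, 0 <= g u) ->
  mixture_functional L ->
  (forall s, (0 <= s)%R ->
     \int[mu]_u ((ift (reg k (gaussian s)) (phi u))%:E * g u) <= (L (gaussian s))%:E) ->
  forall m, mixture m -> \int[mu]_u ((ift (reg k m) (phi u))%:E * g u) <= (L m)%:E.
Proof.
move=> k0 mphi mg g0 [a s l] hL.
have mi m : mixture m -> measurable_fun setT (fun u => (ift (reg k m) (phi u))%:E * g u).
  move=> hm; apply: emeasurable_funM => //; apply/measurable_EFinP.
  exact: measurable_ift_reg.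
have i0 m u : mixture m -> 0 <= (ift (reg k m) (phi u))%:E * g u.
  by move=> hm; rewrite mule_ge0// lee_fin ift_reg_ge0.
have F x := mixtureF_ift x k0.
move=> m; elim=> {m} [r r0|m1 m2 h1 i1 h2 i2|c m c0 h i|m_ m h i mE].
- exact: hL.
- rewrite a// EFinD; apply: le_trans (leeD i1 i2).
  rewrite -ge0_integralD//; [|by move=> u _; exact: i0|exact: mi|by move=> u _; exact: i0|exact: mi].
  apply: le_of_eq; apply: eq_integral => u _.
  rewrite (mixtureF_add (F _))// EFinD ge0_muleDl// lee_fin; exact: ift_reg_ge0.
- rewrite s// EFinM; apply: le_trans (lee_wpmul2l _ i); last by rewrite lee_fin.
  rewrite -ge0_integralZl//; [|exact: mi|by move=> u _; exact: i0].
  apply: le_of_eq; apply: eq_integral => u _.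
  by rewrite (mixtureF_scale (F _))// EFinM muleA.
- have hm := mixture_lim h mE.
  apply: (fatou_le (f_ := fun n u => (ift (reg k (m_ n)) (phi u))%:E * g u)
    (c_ := fun n => L (m_ n))) => //.
  + by move=> n; exact: mi.
  + exact: mi.
  + by move=> n u; exact: i0.
  + by move=> u; exact: i0.
  + move=> u; apply: mule_le_limn_einf => //.
      by move=> n; exact: ift_reg_ge0.
    exact: (mixtureF_lim (F _)).
  + exact: l.
Qed.

Lemma measurable_vsubl x : measurable_fun setT (fun y => vsub x y).
Proof. by apply: measurable_vsub => //; exact: measurable_cst. Qed.

Lemma measurable_vsubr y : measurable_fun setT (fun x => vsub x y).
Proof. by apply: measurable_vsub => //; exact: measurable_cst. Qed.

Lemma integral_ift_reg k m x : (0 < k)%R -> mixture m ->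
  \int[leb N]_y (ift (reg k m) (vsub x y))%:E <= (m rn0)%:E.
Proof.
move=> k0 hm; under eq_integral do rewrite -[(ift _ _)%:E]mule1.
apply: (mixture_transfer (L := fun m => m rn0)) => //.
- exact: measurable_vsubl.
- move=> s s0; have ks0 : (0 < k + s)%R by rewrite ltr_wpDr.
  under eq_integral do rewrite mule1 ift_reg_gaussian//.
  by rewrite integral_heat// gaussian0.
Qed.

(** Two applications of the transfer principle, one for each factor, reduce the bound to
    the semigroup identity of the Gaussian heat kernels. *)
Lemma ift_reg_conv k1 k2 m1 m2 x y : (0 < k1)%R -> (0 < k2)%R ->
  mixture m1 -> mixture m2 ->
  \int[leb N]_z (ift (reg k1 m1) (vsub x z) * ift (reg k2 m2) (vsub z y))%:E <=
  (ift (reg (k1 + k2) (fun xi => m1 xi * m2 xi)%R) (vsub x y))%:E.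
Proof.
move=> k10 k20 h1 h2; have k0 : (0 < k1 + k2)%R by rewrite addr_gt0.
under eq_integral do rewrite EFinM.
rewrite (_ : (fun xi => m1 xi * m2 xi)%R = (fun xi => m2 xi * m1 xi)%R); last first.
  by apply/funext => xi; rewrite mulrC.
apply: (mixture_transfer (L := fun m => ift (reg (k1 + k2) (fun xi => m2 xi * m xi)%R) (vsub x y))) => //.
- exact: measurable_vsubl.
- apply/measurable_EFinP; apply: measurable_ift_reg => //; exact: measurable_vsubr.
- by move=> z; rewrite lee_fin ift_reg_ge0.
- exact: (mixtureF_mul _ (mixtureF_ift _ k0)).
move=> s s0; under eq_integral do rewrite muleC.
rewrite (_ : (fun xi => m2 xi * gaussian s xi)%R = (fun xi => gaussian s xi * m2 xi)%R); last first.
  by apply/funext => xi; rewrite mulrC.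
have ms : mixture (@gaussian R N s) by exact: mixture_gaussian.
apply: (mixture_transfer (phi := fun z => vsub z y)
  (g := fun z => (ift (reg k1 (gaussian s)) (vsub x z))%:E)
  (L := fun m => ift (reg (k1 + k2) (fun xi => gaussian s xi * m xi)%R) (vsub x y))) => //.
- exact: measurable_vsubr.
- apply/measurable_EFinP; apply: measurable_ift_reg => //; exact: measurable_vsubl.
- by move=> z; rewrite lee_fin ift_reg_ge0.
- exact: (mixtureF_mul _ (mixtureF_ift _ k0)).
move=> r r0.
rewrite (_ : (fun xi => gaussian s xi * gaussian r xi)%R = gaussian (s + r)); last first.
  by apply/funext => xi; rewrite gaussianM.
rewrite ift_reg_gaussian ?addr_ge0//.
under eq_integral do rewrite muleC -EFinM !ift_reg_gaussian//.
rewrite integral_heat_conv; [|by rewrite ltr_wpDr|by rewrite ltr_wpDr].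
by rewrite lee_fin addrACA.
Qed.

Lemma ift_reg_average (a M : R) (g : Rn R N -> \bar R) k m x :
  (0 < a)%R -> (0 <= M)%R -> measurable_fun setT g -> (forall y, 0 <= g y) ->
  (forall z, \int[leb N]_(y in cube z a) g y <= M%:E) -> (0 < k)%R -> mixture m ->
  \int[leb N]_y ((ift (reg k m) (vsub x y))%:E * g y) <=
  ((Num.sqrt 2 * expR 1) ^+ N / (2 * a) ^+ N * M *
    (m rn0 + Num.sqrt (4 * pi * a ^+ 2) ^+ N * ift (reg k m) (rn0 : Rn R N)))%:E.
Proof.
move=> a0 M0 mg g0 gM k0 hm.
set c := ((Num.sqrt 2 * expR 1) ^+ N / (2 * a) ^+ N * M)%R.
set q := (Num.sqrt (4 * pi * a ^+ 2) ^+ N)%R.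
have -> : (c * (m rn0 + q * ift (reg k m) (rn0 : Rn R N)) =
  c * m rn0 + (c * q) * ift (reg k m) (rn0 : Rn R N))%R by ring.
apply: (mixture_transfer (L := fun m => (c * m rn0 + (c * q) * ift (reg k m) (rn0 : Rn R N))%R)) => //.
- exact: measurable_vsubl.
- apply: (mixtureF_lin (L1 := fun m => m rn0)); last exact: mixtureF_ift.
  exact: mixtureF_eval.
move=> s s0; have ks0 : (0 < k + s)%R by rewrite ltr_wpDr.
rewrite gaussian0 ift_reg_gaussian//.
under eq_integral do rewrite ift_reg_gaussian//.
apply: le_trans (heat_average a0 M0 mg g0 gM x ks0) _.
rewrite lee_fin -/c -/q.
by apply: le_of_eq; ring.
Qed.

End mixture_functional.

(** * The fractional symbol is a mixture *)

Section binomial_series.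
Context {R : realType}.
Variable b : R.
Hypothesis b01 : 0 < b <= 1.

(** Coefficients of the power series of (1 - x)^b. *)
Fixpoint binomial_coef (n : nat) : R := if n is k.+1 then binomial_coef k * (k%:R - b) / k.+1%:R else 1.

Definition binomial_sum (n : nat) (x : R) : R := \sum_(k < n.+1) binomial_coef k * x ^+ k.
Definition dbinomial_sum (n : nat) (x : R) : R := \sum_(k < n) k.+1%:R * binomial_coef k.+1 * x ^+ k.

Lemma binomial_coefS n : n.+1%:R * binomial_coef n.+1 = (n%:R - b) * binomial_coef n.
Proof. by rewrite /= mulrC divfK ?pnatr_eq0// mulrC. Qed.

(** For 0 < b <= 1 all coefficients but the first are nonpositive, so 1 - (1-x)^b has
    nonnegative coefficients. *)
Lemma binomial_coef_le0 n : binomial_coef n.+1 <= 0.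
Proof.
have [b0 b1] := andP b01.
elim: n => [|n IH]; first by rewrite /= mul1r divr1 sub0r oppr_le0 ltW.
have -> : binomial_coef n.+2 = binomial_coef n.+1 * ((n.+1%:R - b) / n.+2%:R) by rewrite /= !mulrA.
rewrite mulr_le0_ge0// divr_ge0// subr_ge0 (le_trans b1)// ler1n//.
Qed.

(** The crude bound on the coefficients of the derivative is enough to make the remainder
    geometric. *)
Lemma norm_binomial_coef_le1 n : `|n.+1%:R * binomial_coef n.+1| <= 1.
Proof.
have [b0 b1] := andP b01.
elim: n => [|n IH]; first by rewrite binomial_coefS /= mulr1 sub0r normrN gtr0_norm.
rewrite binomial_coefS; apply: le_trans IH; rewrite !normrM ler_wpM2r//.
have n1 : 1 <= n.+1%:R :> R by rewrite ler1n.
by rewrite [leRHS]ger0_norm// ger0_norm; lra.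
Qed.

Lemma is_derive_binomial_sum n x : is_derive x (1 : R) (binomial_sum n) (dbinomial_sum n x).
Proof.
elim: n => [|n IH].
  rewrite /dbinomial_sum big_ord0 (_ : binomial_sum 0 = cst 1); first exact: is_derive_cst.
  by apply/funext => y; rewrite /binomial_sum big_ord_recr big_ord0 /= add0r mulr1.
rewrite (_ : binomial_sum n.+1 = binomial_sum n + (fun x => binomial_coef n.+1 * x ^+ n.+1)); last first.
  by apply/funext => y; rewrite /binomial_sum big_ord_recr.
rewrite /dbinomial_sum big_ord_recr -/(dbinomial_sum n x).
have dM (c : R) : is_derive x (1 : R) (fun x : R => c * x ^+ n.+1) (n.+1%:R * c * x ^+ n).
  have dX : is_derive x (1 : R) (@GRing.exp R ^~ n.+1) (n.+1%:R * x ^+ n).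
    split; first exact: exprn_derivable.
    by rewrite exp_derive /GRing.scale/= mulr1.
  apply: (@is_derive_eq _ _ _ (c \*: (@GRing.exp R ^~ n.+1 : R -> R))).
  by rewrite /GRing.scale/=; ring.
exact: is_deriveD.
Qed.

(** The partial sums solve (1 - x) y' + b y = 0, the equation of (1 - x)^b, up to their last
    term. *)
Lemma binomial_sum_ode n x : (1 - x) * dbinomial_sum n x + b * binomial_sum n x = - (n.+1%:R * binomial_coef n.+1 * x ^+ n).
Proof.
rewrite binomial_coefS; elim: n => [|n IH].
  by rewrite /dbinomial_sum /binomial_sum big_ord0 big_ord_recr big_ord0 /=; ring.
have -> : binomial_sum n.+1 x = binomial_sum n x + binomial_coef n.+1 * x ^+ n.+1 by rewrite /binomial_sum big_ord_recr.
have -> : dbinomial_sum n.+1 x = dbinomial_sum n x + n.+1%:R * binomial_coef n.+1 * x ^+ n by rewrite /dbinomial_sum big_ord_recr.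
rewrite mulrDr mulrDr addrACA IH binomial_coefS exprS.
have := binomial_coefS n; set B := binomial_coef n.+1; set B0 := binomial_coef n => BE.
have -> : - ((n%:R - b) * B0 * x ^+ n) = - (n.+1%:R * B * x ^+ n) by rewrite BE.
have -> : (1 - x) * ((n%:R - b) * B0 * x ^+ n) = (1 - x) * (n.+1%:R * B * x ^+ n) by rewrite BE.
ring.
Qed.

(** Multiplying the partial sum by (1 - x)^-b gives a function with value 1 at 0 and
    derivative of geometric size; the mean value theorem concludes. *)
Lemma cvg_binomial_sum (x : R) : 0 <= x < 1 -> binomial_sum n x @[n --> \oo] --> (1 - x) `^ b.
Proof.
move=> /andP[]; rewrite le_eqVlt => /orP[/eqP<- _|x0 x1].
  rewrite subr0 powR1; apply: cvg_near_cst; near=> n.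
  by rewrite /binomial_sum big_ord_recl/= big1 ?addr0 ?mulr1// => i _; rewrite expr0n/= mulr0.
have [b0 b1] := andP b01.
(* E is (1 - y)^-b *)
pose E (y : R) := expR (- b * ln (1 - y)).
have dE (y : R) : y < 1 -> is_derive y (1 : R) E (b / (1 - y) * E y).
  move=> y1; have y10 : 0 < 1 - y by rewrite subr_gt0.
  have d1 := is_derive1_ln y10.
  apply: (@is_derive_eq _ _ _ (expR \o (- b \*: (@ln R \o (fun y : R => 1 - y))))).
  rewrite /GRing.scale/= /E/=; ring.
pose h n (y : R) := binomial_sum n y * E y.
have dh n (y : R) : y < 1 -> is_derive y (1 : R) (h n) (- (n.+1%:R * binomial_coef n.+1) * y ^+ n * (E y / (1 - y))).
  move=> y1; have d1 := dE y y1; have d2 := is_derive_binomial_sum n y.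
  apply: (@is_derive_eq _ _ _ (binomial_sum n * E)).
  rewrite /GRing.scale/=.
  have := binomial_sum_ode n y; set D := dbinomial_sum n y; set S := binomial_sum n y => ode.
  have y10 : 1 - y != 0 by rewrite subr_eq0 gt_eqF.
  have -> : - (n.+1%:R * binomial_coef n.+1) * y ^+ n = (1 - y) * D + b * S by rewrite ode; ring.
  by field.
have h0 n : h n 0 = 1.
  rewrite /h /E subr0 ln1 mulr0 expR0 mulr1 /binomial_sum big_ord_recl/= big1 ?addr0 ?mulr1//.
  by move=> i _; rewrite expr0n/= mulr0.
have bound n : `|h n x - 1| <= x ^+ n * (E x / (1 - x) * x).
  have H1 y : y \in `]0, x[ ->
      is_derive y (1 : R) (h n) (- (n.+1%:R * binomial_coef n.+1) * y ^+ n * (E y / (1 - y))).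
    by rewrite in_itv/= => /andP[_ yx]; apply: dh; exact: lt_trans x1.
  have H2 : {within `[0, x], continuous (h n)}.
    apply: derivable_within_continuous => y; rewrite in_itv/= => /andP[_ yx].
    by have [] := dh n y (le_lt_trans yx x1).
  have [c] := MVT x0 H1 H2.
  rewrite in_itv/= => /andP[c0 cx]; rewrite h0 subr0 => ->.
  have c1 : c < 1 := lt_trans cx x1.
  have Ec : 0 <= E c / (1 - c) <= E x / (1 - x).
    have c10 : 0 <= 1 - c by rewrite subr_ge0 ltW.
    apply/andP; split; first by rewrite divr_ge0 ?expR_ge0.
    apply: ler_pM; rewrite ?expR_ge0 ?invr_ge0//.
      rewrite ler_expR !mulNr lerN2; apply: ler_wpM2l; first exact: ltW.
      by rewrite ler_ln ?posrE ?subr_gt0// lerD2l lerN2 ltW.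
    by rewrite lef_pV2 ?posrE ?subr_gt0// lerD2l lerN2 ltW.
  have /andP[Ec0 Ecx] := Ec.
  rewrite [leRHS]mulrA normrM (ger0_norm (ltW x0)) ler_pM2r//.
  rewrite normrM (ger0_norm Ec0); apply: ler_pM => //.
  rewrite normrM normrN -[leRHS]mul1r; apply: ler_pM => //; first exact: norm_binomial_coef_le1.
  by rewrite normrX (ger0_norm (ltW c0)) lerXn2r ?nnegrE ?ltW.
have hx : h n x @[n --> \oo] --> (1 : R).
  apply/subr_cvg0; apply: norm_cvg0.
  apply: (@squeeze_cvgr _ _ _ _ (fun=> 0) (fun n => x ^+ n * (E x / (1 - x) * x))).
  - by near=> n; rewrite normr_ge0/=; exact: bound.
  - exact: cvg_cst.
  - rewrite -[X in _ --> X](mul0r (E x / (1 - x) * x)); apply: cvgM; last exact: cvg_cst.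
    have := @cvg_geometric R 1 x; rewrite ger0_norm ?ltW// => /(_ x1).
    by rewrite /geometric; under eq_fun do rewrite /= mul1r.
have -> : (1 - x) `^ b = 1 * (E x)^-1.
  rewrite mul1r /E -expRN mulNr opprK /powR gt_eqF// subr_gt0//.
rewrite (_ : (fun n => binomial_sum n x) = (fun n => h n x * (E x)^-1)).
  by apply: cvgM => //; exact: cvg_cst.
by apply/funext => n; rewrite /h mulfK// gt_eqF// expR_gt0.
Unshelve. all: by end_near. Qed.

End binomial_series.

Lemma cvg_powR_seq {R : realType} (u : R^nat) (l b : R) : 0 < b -> (forall n, 0 <= u n) ->
  u n @[n --> \oo] --> l -> u n `^ b @[n --> \oo] --> l `^ b.
Proof.
move=> b0 u0 ul.
have l0 : 0 <= l.
  by rewrite -(cvg_lim _ ul)//; apply: limr_ge; [apply/cvg_ex; exists l|near=> n].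
move: l0; rewrite le_eqVlt => /orP[/eqP l0|l0].
  rewrite -l0 powR0 ?gt_eqF//; apply/cvgrPdist_le => e e0.
  have d0 : 0 < e `^ b^-1 by rewrite powR_gt0.
  move: ul; rewrite -l0 => /cvgrPdist_le/(_ _ d0); apply: filterS => n.
  rewrite !sub0r !normrN !ger0_norm ?powR_ge0// => un.
  have -> : e = (e `^ b^-1) `^ b by rewrite -powRrM mulVf ?gt_eqF// powRr1// ltW.
  by apply: ge0_ler_powR; rewrite ?nnegrE ?powR_ge0// ltW.
have cb : {for l, continuous (fun x : R => x `^ b)}.
  apply: differentiable_continuous; apply/derivable1_diffP.
  by have [] := is_derive1_powR b l0.
by apply: (cvg_comp u (fun x : R => x `^ b) ul); exact: cb.
Unshelve. all: by end_near. Qed.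

Section stable_mixture.
Context {R : realType} {N : nat}.
Implicit Types (m : Rn R N -> R).

Lemma mixture_cst (c : R) : 0 <= c -> mixture (fun _ : Rn R N => c).
Proof.
move=> c0; rewrite (_ : (fun _ => c) = (fun xi : Rn R N => c * gaussian 0 xi)).
  by apply: mixture_scale => //; exact: mixture_gaussian.
by apply/funext => xi; rewrite /gaussian mul0r oppr0 expR0 mulr1.
Qed.

Lemma mixtureX m k : mixture m -> mixture (fun xi => m xi ^+ k).
Proof.
move=> hm; elim: k => [|k IH]; first exact: mixture_cst.
rewrite (_ : (fun xi => _) = (fun xi => m xi * m xi ^+ k)); first exact: mixtureM.
by apply/funext => xi; rewrite exprS.
Qed.

Lemma mixture_sum n (f : nat -> Rn R N -> R) : (forall k, mixture (f k)) ->
  mixture (fun xi => \sum_(k < n) f k xi).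
Proof.
move=> hf; elim: n => [|n IH].
  rewrite (_ : (fun xi => _) = (fun=> 0)); first exact: mixture_cst.
  by apply/funext => xi; rewrite big_ord0.
rewrite (_ : (fun xi => _) = (fun xi => \sum_(k < n) f k xi + f n xi)).
  exact: mixture_add.
by apply/funext => xi; rewrite big_ord_recr.
Qed.

Lemma mixture_expR (c : R) m : 0 <= c -> mixture m -> mixture (fun xi => expR (c * m xi)).
Proof.
move=> c0 hm.
apply: (mixture_lim (m_ := fun n xi => \sum_(k < n) (c ^+ k / k`!%:R * m xi ^+ k))).
  move=> n; apply: (@mixture_sum n (fun k xi => c ^+ k / k`!%:R * m xi ^+ k)) => k.
  by apply: mixture_scale; [rewrite divr_ge0// exprn_ge0|exact: mixtureX].
move=> xi.
rewrite (_ : (fun n => _) = series (exp_coeff (c * m xi))).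
  exact: is_cvg_series_exp_coeff.
apply/funext => n; rewrite /series/= big_mkord; apply: eq_bigr => k _.
by rewrite /exp_coeff /= exprMn mulrAC.
Qed.

(** Termwise, by nonnegativity of the coefficients; 1 - (1-z)^b is the generating function
    of the Sibuya law. *)
Lemma mixture_sibuya (b : R) m : 0 < b <= 1 -> mixture m -> (forall xi, m xi < 1) ->
  mixture (fun xi => 1 - (1 - m xi) `^ b).
Proof.
move=> b01 hm m1.
apply: (mixture_lim (m_ := fun n xi => \sum_(k < n) (- binomial_coef b k.+1 * m xi ^+ k.+1))).
  move=> n; apply: (@mixture_sum n (fun k xi => - binomial_coef b k.+1 * m xi ^+ k.+1)) => k.
  by apply: mixture_scale; [rewrite oppr_ge0 binomial_coef_le0|exact: mixtureX].
move=> xi.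
rewrite (_ : (fun n => _) = (fun n => 1 - binomial_sum b n (m xi))).
  apply: cvgB; first exact: cvg_cst.
  by apply: cvg_binomial_sum => //; rewrite mixture_ge0// m1.
apply/funext => n; rewrite /binomial_sum big_ord_recl/= mulr1 opprD addrA subrr add0r -sumrN.
by apply: eq_bigr => k _; rewrite mulNr.
Qed.

(** Subordination without a subordinator: l^b is the limit of n^b (1 - phi_n)^b for
    phi_n close to exp (-l/n), and exp (- t n^b (1 - phi_n)^b) equals exp (- t n^b) times the
    exponential of a nonnegative multiple of the mixture 1 - (1 - phi_n)^b. *)
Lemma mixture_stable (t b : R) : 0 <= t -> 0 < b <= 1 ->
  mixture (fun xi : Rn R N => expR (- (t * dotp xi xi `^ b))).
Proof.
move=> t0 b01; have [b0 b1] := andP b01.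
(* the shift by 1/n keeps phi_n < 1 at the origin *)
pose phi (n : nat) (xi : Rn R N) := expR (- (n.+1%:R ^- 2)) * gaussian (n.+1%:R^-1) xi.
have phiE n xi : phi n xi = expR (- ((dotp xi xi + n.+1%:R^-1) / n.+1%:R)).
  by rewrite /phi /gaussian -expRD; congr expR; field.
have argP n (xi : Rn R N) : 0 < (dotp xi xi + n.+1%:R^-1) / n.+1%:R.
  by rewrite divr_gt0// ltr_wpDl ?dotp_ge0// invr_gt0.
have hphi n : mixture (phi n).
  by apply: mixture_scale; [exact: expR_ge0|apply: mixture_gaussian; rewrite invr_ge0].
have phi1 n xi : phi n xi < 1.
  by rewrite phiE -[ltRHS]expR0 ltr_expR oppr_lt0.
apply: (mixture_lim (m_ := fun n xi => expR (- (t * n.+1%:R `^ b)) *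
   expR (t * n.+1%:R `^ b * (1 - (1 - phi n xi) `^ b)))).
  move=> n; apply: mixture_scale; first exact: expR_ge0.
  apply: mixture_expR; first by rewrite mulr_ge0// powR_ge0.
  exact: mixture_sibuya.
move=> xi.
rewrite (_ : (fun n => _) = (fun n => expR (- (t * (n.+1%:R * (1 - phi n xi)) `^ b)))); last first.
  apply/funext => n; rewrite -expRD powRM//; last by rewrite subr_ge0 ltW.
  by congr expR; ring.
apply: (cvg_comp (fun n => - (t * (n.+1%:R * (1 - phi n xi)) `^ b)) expR); last exact: continuous_expR.
apply: cvgN; apply: cvgM; first exact: cvg_cst.
apply: cvg_powR_seq => //.
  by move=> n; rewrite mulr_ge0// subr_ge0 ltW.
set l := dotp xi xi.
have cV : n.+1%:R^-1 @[n --> \oo] --> (0 : R) by exact: cvg_harmonic.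
apply: (@squeeze_cvgr _ _ _ _ (fun n => (l + n.+1%:R^-1) / (1 + (l + n.+1%:R^-1) / n.+1%:R))
   (fun n => l + n.+1%:R^-1)).
- near=> n.
  have y0 := argP n xi; rewrite -/l in y0.
  set y := _ / _ in y0 *.
  have ny : n.+1%:R * y = l + n.+1%:R^-1 by rewrite /y mulrC divfK.
  rewrite phiE -/l -/y -ny -mulrA !ler_pM2l ?ltr0n//; apply/andP; split.
    have y1 : 0 < 1 + y by rewrite addr_gt0.
    have -> : y / (1 + y) = 1 - (1 + y)^-1 by field; rewrite gt_eqF.
    rewrite lerD2l lerN2 expRN lef_pV2 ?posrE ?expR_gt0//.
    exact: expR_ge1Dx.
  have := expR_ge1Dx (- y); lra.
- have c1 : l + n.+1%:R^-1 @[n --> \oo] --> l.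
    by rewrite -[X in _ --> X]addr0; apply: cvgD => //; exact: cvg_cst.
  have c2 : 1 + (l + n.+1%:R^-1) / n.+1%:R @[n --> \oo] --> (1 : R).
    rewrite -[X in _ --> X]addr0; apply: cvgD; first exact: cvg_cst.
    by rewrite -[X in _ --> X](mulr0 l); apply: cvgM.
  rewrite -[X in _ --> X]divr1; apply: cvgM => //.
  by apply: cvgV => //; rewrite oner_neq0.
- by rewrite -[X in _ --> X]addr0; apply: cvgD => //; exact: cvg_cst.
Unshelve. all: by end_near. Qed.

End stable_mixture.

(** * Estimates for the fractional heat kernel *)

Section integrable_mixture.
Context {R : realType} {N : nat}.
Implicit Types (m : Rn R N -> R) (x y z : Rn R N).

Lemma harmonic_gt0R (n : nat) : 0 < n.+1%:R^-1 :> R.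
Proof. by rewrite invr_gt0. Qed.

Lemma cvg_gaussian0 (k : R^nat) (xi : Rn R N) : k n @[n --> \oo] --> 0 ->
  gaussian (k n) xi @[n --> \oo] --> (1 : R).
Proof.
move=> k0.
have h : expR (- (k n * dotp xi xi)) @[n --> \oo] --> expR (- (0 * dotp xi xi)).
  apply: (cvg_comp (fun n => - (k n * dotp xi xi)) expR); last exact: continuous_expR.
  by apply: cvgN; apply: cvgM => //; exact: cvg_cst.
by rewrite mul0r oppr0 expR0 in h.
Qed.

(** Removes the Gaussian regularisation for integrable mixtures. *)
Lemma cvg_ift_reg m x : mixture m -> (leb N).-integrable setT (EFin \o m) ->
  ift (reg n.+1%:R^-1 m) x @[n --> \oo] --> ift m x.
Proof.
move=> hm im; apply: (cvg_ift (g := m)) => //.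
- move=> n; apply: measurable_funM; first exact: measurable_gaussian.
  exact: measurable_mixture.
- exact: measurable_mixture.
- move=> n xi; rewrite /reg ger0_norm; last by rewrite mulr_ge0 ?expR_ge0// mixture_ge0.
  rewrite ler_piMl ?mixture_ge0// -expR0 ler_expR oppr_le0 mulr_ge0// dotp_ge0//.
- move=> xi; rewrite -[X in _ --> X]mul1r; apply: cvgM; last exact: cvg_cst.
  by apply: cvg_gaussian0; exact: cvg_harmonic.
Qed.

Section kernel.
Variable m : Rn R N -> R.
Hypotheses (hm : mixture m) (im : (leb N).-integrable setT (EFin \o m)).

Lemma ift_ge0 x : 0 <= ift m x.
Proof.
have cm := @cvg_ift_reg m x hm im.
rewrite -(cvg_lim _ cm)//; apply: limr_ge; first by apply/cvg_ex; eexists; exact: cm.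
by near=> n; apply: ift_reg_ge0 => //; exact: harmonic_gt0R.
Unshelve. all: by end_near. Qed.

Local Open Scope ereal_scope.

(** Fatou's lemma carries bounds from the regularised transform to the transform. *)
Lemma ift_transfer (L : (Rn R N -> R) -> R) (l : R) (g : Rn R N -> \bar R) x :
  measurable_fun setT g -> (forall y, 0 <= g y) ->
  (forall n, \int[leb N]_y ((ift (reg n.+1%:R^-1 m) (vsub x y))%:E * g y) <=
     (L (reg n.+1%:R^-1 m))%:E) ->
  L (reg n.+1%:R^-1 m) @[n --> \oo] --> l ->
  \int[leb N]_y ((ift m (vsub x y))%:E * g y) <= l%:E.
Proof.
move=> mg g0 hL Ll.
apply: (fatou_le (f_ := fun n y => (ift (reg n.+1%:R^-1 m) (vsub x y))%:E * g y)
  (c_ := fun n => L (reg n.+1%:R^-1 m))) => //.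
- move=> n; apply: emeasurable_funM => //; apply/measurable_EFinP.
  by apply: measurable_ift_reg => //; exact: measurable_vsubl.
- apply: emeasurable_funM => //; apply/measurable_EFinP; apply: measurable_ift.
    exact: measurable_mixture.
  exact: measurable_vsubl.
- by move=> n y; rewrite mule_ge0// lee_fin ift_reg_ge0// harmonic_gt0R.
- by move=> y; rewrite mule_ge0// lee_fin ift_ge0.
- move=> y; apply: mule_le_limn_einf => //.
    by move=> n; rewrite ift_reg_ge0// harmonic_gt0R.
  exact: cvg_ift_reg.
Qed.

Lemma integral_ift_le x : \int[leb N]_y (ift m (vsub x y))%:E <= (m rn0)%:E.
Proof.
under eq_integral do rewrite -[(ift _ _)%:E]mule1.
apply: (ift_transfer (L := fun=> m rn0)) => //.
- move=> n; under eq_integral do rewrite mule1.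
  by apply: integral_ift_reg => //; exact: harmonic_gt0R.
- exact: cvg_cst.
Qed.

Lemma ift_average_le (a M : R) (g : Rn R N -> \bar R) x :
  (0 < a)%R -> (0 <= M)%R -> measurable_fun setT g -> (forall y, 0 <= g y) ->
  (forall z, \int[leb N]_(y in cube z a) g y <= M%:E) ->
  \int[leb N]_y ((ift m (vsub x y))%:E * g y) <=
  ((Num.sqrt 2 * expR 1) ^+ N / (2 * a) ^+ N * M *
    (m rn0 + Num.sqrt (4 * pi * a ^+ 2) ^+ N * ift m (rn0 : Rn R N)))%:E.
Proof.
move=> a0 M0 mg g0 gM.
set c := ((Num.sqrt 2 * expR 1) ^+ N / (2 * a) ^+ N * M)%R.
set q := (Num.sqrt (4 * pi * a ^+ 2) ^+ N)%R.
apply: (ift_transfer (L := fun m' => (c * (m rn0 + q * ift m' (rn0 : Rn R N)))%R)) => //.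
- by move=> n; apply: ift_reg_average => //; exact: harmonic_gt0R.
- apply: cvgM; first exact: cvg_cst.
  apply: cvgD; first exact: cvg_cst.
  by apply: cvgM; [exact: cvg_cst|exact: cvg_ift_reg].
Qed.

End kernel.

Local Open Scope ereal_scope.

(** The sum of the two regularisation parameters tends to 0, so the regularised
    convolution bound passes to the limit. *)
Lemma ift_conv_le m1 m2 x y : mixture m1 -> mixture m2 ->
  (leb N).-integrable setT (EFin \o m1) -> (leb N).-integrable setT (EFin \o m2) ->
  \int[leb N]_z (ift m1 (vsub x z) * ift m2 (vsub z y))%:E <=
  (ift (fun xi => m1 xi * m2 xi)%R (vsub x y))%:E.
Proof.
move=> h1 h2 i1 i2; have h12 := mixtureM h1 h2.
have mi m k (f : Rn R N -> Rn R N) : mixture m -> measurable_fun setT f ->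
    measurable_fun setT (fun z => ift (reg k m) (f z)).
  by move=> hm mf; exact: measurable_ift_reg.
have mi' m (f : Rn R N -> Rn R N) : mixture m -> measurable_fun setT f ->
    measurable_fun setT (fun z => ift m (f z)).
  by move=> hm mf; apply: measurable_ift => //; exact: measurable_mixture.
apply: (fatou_le
  (f_ := fun n z => (ift (reg n.+1%:R^-1 m1) (vsub x z) * ift (reg n.+1%:R^-1 m2) (vsub z y))%:E)
  (c_ := fun n => ift (reg (n.+1%:R^-1 + n.+1%:R^-1) (fun xi => m1 xi * m2 xi)%R) (vsub x y))).
- move=> n; apply/measurable_EFinP; apply: measurable_funM.
    by apply: mi => //; exact: measurable_vsubl.
  by apply: mi => //; exact: measurable_vsubr.
- apply/measurable_EFinP; apply: measurable_funM.
    by apply: mi' => //; exact: measurable_vsubl.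
  by apply: mi' => //; exact: measurable_vsubr.
- by move=> n z; rewrite lee_fin mulr_ge0// ift_reg_ge0// harmonic_gt0R.
- by move=> z; rewrite lee_fin mulr_ge0// ift_ge0.
- move=> z.
  have h : (ift (reg n.+1%:R^-1 m1) (vsub x z) * ift (reg n.+1%:R^-1 m2) (vsub z y))%R%:E
      @[n --> \oo] --> (ift m1 (vsub x z) * ift m2 (vsub z y))%R%:E.
    apply: cvg_EFin; first by near=> n.
    by apply: cvgM; exact: cvg_ift_reg.
  by have [-> _] := cvg_limn_einf_sup h.
- by move=> n; apply: ift_reg_conv => //; exact: harmonic_gt0R.
- apply: (cvg_ift (g := fun xi => (m2 rn0 * m1 xi)%R)).
  + move=> n; apply: measurable_funM; first exact: measurable_gaussian.
    exact: measurable_mixture.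
  + exact: measurable_mixture.
  + rewrite (_ : _ \o _ = (fun xi => (m2 rn0)%:E * (m1 xi)%:E))//.
    exact: integrableZl.
  + move=> n xi; have m10 := mixture_ge0 xi h1; have m20 := mixture_ge0 xi h2.
    rewrite /reg ger0_norm; last by rewrite mulr_ge0 ?expR_ge0// mulr_ge0.
    rewrite mulrCA [leRHS]mulrC ler_wpM2l//.
    have /andP[_ m2b] := mixture_bounds h2 xi; apply: le_trans m2b.
    rewrite ler_piMl// -expR0 ler_expR oppr_le0 mulr_ge0 ?dotp_ge0//.
  + move=> xi; rewrite -[X in _ --> X]mul1r; apply: cvgM; last exact: cvg_cst.
    apply: cvg_gaussian0.
    by rewrite -[X in _ --> X]addr0; apply: cvgD; exact: cvg_harmonic.
Unshelve. all: by end_near. Qed.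

End integrable_mixture.

Section stable_symbol.
Context {R : realType} {N : nat}.
Variable theta : R.
Hypothesis theta02 : 0 < theta <= 2.
Notation mu := (@lebesgue_measure R).

Lemma integral_cauchy (a : R) : 0 < a ->
  (\int[mu]_x ((1 + (a * x) ^+ 2)^-1)%:E = (pi / a)%:E)%E.
Proof.
move=> a0.
have intT : (\int[mu]_x ((oneDsqr x)^-1)%:E = pi%:E)%E.
  rewrite ge0_symfun_integralT.
  - rewrite (_ : [set x : R | _] = `[0, +oo[%classic); last first.
      by apply/seteqP; split => x/=; rewrite in_itv/= andbT.
    by rewrite integral0y_oneDsqr -EFinM mulrC divfK.
  - by move=> x; rewrite invr_ge0 (le_trans _ (oneDsqr_ge1 x)).
  - exact: continuous_oneDsqrV.
  - by move=> x /=; rewrite /oneDsqr sqrrN.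
have F'E : (fun x : R => a * x)^`()%classic = cst a.
  apply/funext => x; rewrite derive1E.
  have : is_derive x (1 : R) (fun x : R => a * x) a by apply: is_derive_eq; rewrite /GRing.scale/= mulr1.
  by case.
have H := @increasing_ge0_integration_by_substitutionT R (fun x => a * x) (fun x => (oneDsqr x)^-1).
have {}H : (\int[mu]_x ((oneDsqr x)^-1)%:E = \int[mu]_x ((1 + (a * x) ^+ 2)^-1 * a)%:E)%E.
  rewrite H.
  - by rewrite F'E.
  - by move=> x y xy; rewrite ltr_pM2l.
  - by rewrite F'E; exact: cst_continuous.
  - by rewrite F'E; exact: is_cvg_cst.
  - by rewrite F'E; exact: is_cvg_cst.
  - move=> x; exact: derivableM.
  - by apply/gt0_cvgMrNy => //; exact: cvg_id.
  - by apply/gt0_cvgMry => //; exact: cvg_id.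
  - exact: continuous_oneDsqrV.
  - by move=> x; rewrite invr_ge0 (le_trans _ (oneDsqr_ge1 x)).
move: H; rewrite intT; under eq_integral do rewrite EFinM.
rewrite ge0_integralZr//.
- move=> H; transitivity ((\int[mu]_x ((1 + (a * x) ^+ 2)^-1)%:E) * a%:E * (a^-1)%:E)%E.
    by rewrite -muleA -EFinM mulfV ?gt_eqF// mule1.
  by rewrite -H EFinM.
- apply/measurable_EFinP; apply: continuous_measurable_fun => x.
  apply: (@continuous_comp _ _ _ ( *%R a) (fun x => (oneDsqr x)^-1)).
    exact: mulrl_continuous.
  exact: continuous_oneDsqrV.
- by move=> x _; rewrite lee_fin invr_ge0 addr_ge0// sqr_ge0.
- by rewrite lee_fin ltW.
Qed.

(** Exponential decay in r^theta beats every polynomial: y^(K+1) is bounded by a constant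
    times exp y, and K is chosen with theta (K + 1) >= 2 n. *)
Lemma expR_powR_bound (n : nat) : exists2 C : R, 0 < C &
  forall r, 0 <= r -> expR (- (r `^ theta)) * (1 + r ^+ 2) ^+ n <= C.
Proof.
have [th0 th2] := andP theta02.
have [K hK] : exists K : nat, (2 * n)%:R / theta <= K.+1%:R.
  exists (Num.bound ((2 * n)%:R / theta : R)); apply/ltW.
  have := @archi_boundP R ((2 * n)%:R / theta).
  rewrite divr_ge0 ?ler0n ?(ltW th0)// => /(_ isT)/lt_le_trans; apply.
  by rewrite ler_nat.
have KK : 1 <= K.+1%:R ^+ K.+1 :> R by rewrite exprn_ege1// ler1n.
exists (2 ^+ n * K.+1%:R ^+ K.+1).
  by rewrite mulr_gt0 ?exprn_gt0.
move=> r r0; have [r1|r1] := leP r 1.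
  apply: le_trans (_ : 2 ^+ n <= _); last by rewrite ler_peMr// exprn_ge0.
  rewrite -[leRHS]mul1r; apply: ler_pM; rewrite ?expR_ge0 ?exprn_ge0 ?addr_ge0 ?sqr_ge0//.
    by rewrite -expR0 ler_expR oppr_le0 powR_ge0.
  rewrite lerXn2r ?nnegrE ?addr_ge0 ?sqr_ge0//.
  by rewrite -[leRHS]/(1 + 1) lerD2l expr_le1.
have y0 := powR_ge0 r theta; set y := r `^ theta in y0 *.
have yK : r ^+ (2 * n) <= y ^+ K.+1.
  rewrite -!powR_mulrn// /y -powRrM; apply: ler_powR; first exact: ltW.
  by rewrite mulrC -ler_pdivrMr.
have ey : y ^+ K.+1 <= K.+1%:R ^+ K.+1 * expR y.
  have -> : expR y = expR (y / K.+1%:R) ^+ K.+1.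
    by rewrite -expRM_natl; congr expR; rewrite mulrC divfK.
  rewrite -exprMn lerXn2r ?nnegrE ?mulr_ge0 ?expR_ge0//.
  rewrite mulrC -ler_pdivrMr//; apply: le_trans (expR_ge1Dx _).
  by rewrite lerDr.
rewrite expRN mulrC ler_pdivrMr ?expR_gt0// -mulrA.
apply: le_trans (_ : 2 ^+ n * r ^+ (2 * n) <= _); last first.
  by rewrite ler_pM2l ?exprn_gt0// (le_trans yK).
rewrite exprM -exprMn lerXn2r ?nnegrE ?mulr_ge0 ?addr_ge0 ?sqr_ge0//.
have : 1 <= r ^+ 2 by rewrite exprn_ege1// ltW.
lra.
Qed.

Definition stable_symbol (t : R) (xi : Rn R N) : R := expR (- (t * enorm xi `^ theta)).

Lemma mixture_stable_symbol t : 0 <= t -> mixture (stable_symbol t).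
Proof.
have [th0 th2] := andP theta02.
move=> t0; rewrite (_ : stable_symbol t = (fun xi => expR (- (t * dotp xi xi `^ (theta / 2))))).
  apply: mixture_stable => //; rewrite divr_gt0//= ler_pdivrMr// mul1r//.
apply/funext => xi; rewrite /stable_symbol /enorm -powR12_sqrt ?dotp_ge0//.
by rewrite -powRrM [2^-1 * _]mulrC.
Qed.

Lemma stable_symbol0 t : stable_symbol t rn0 = 1.
Proof.
have [th0 _] := andP theta02.
by rewrite /stable_symbol /enorm dotp0l sqrtr0 powR0 ?gt_eqF// mulr0 oppr0 expR0.
Qed.

Lemma stable_symbolM t s : (fun xi => stable_symbol t xi * stable_symbol s xi) = stable_symbol (t + s).
Proof.
by apply/funext => xi; rewrite /stable_symbol -expRD; congr expR; ring.
Qed.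

Lemma sqr_coord_le (xi : Rn R N) i : (tnth xi i : R) ^+ 2 <= dotp xi xi.
Proof.
rewrite /dotp (bigD1 i)//= -expr2 lerDl; apply: sumr_ge0 => j _.
by rewrite -expr2 sqr_ge0.
Qed.

(** A product of Cauchy densities dominates the symbol; its integral is explicit and has
    the right scaling in t. *)
Lemma stable_symbol_integral : exists2 C : R, 0 < C & forall t, 0 < t ->
  (\int[leb N]_xi (stable_symbol t xi)%:E <= (C * (pi / t `^ theta^-1) ^+ N)%:E)%E.
Proof.
have [th0 _] := andP theta02.
have [C C0 hC] := expR_powR_bound N; exists C => // t t0.
set a := t `^ theta^-1; have a0 : 0 < a by rewrite powR_gt0.
have bnd xi : stable_symbol t xi <= C * \prod_(i < N) (1 + (a * (tnth xi i : R)) ^+ 2)^-1.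
  have r0 : 0 <= a * enorm xi by rewrite mulr_ge0 ?enorm_ge0// ltW.
  have aE : a `^ theta = t by rewrite /a -powRrM mulVf ?gt_eqF// powRr1// ltW.
  have := hC _ r0; rewrite (powRM _ (ltW a0) (enorm_ge0 xi)) aE.
  rewrite -/(stable_symbol t xi) => h.
  have P0 : 0 < \prod_(i < N) (1 + (a * (tnth xi i : R)) ^+ 2).
    by apply: prodr_gt0 => i _; rewrite ltr_pwDl// sqr_ge0.
  rewrite prodfV ler_pdivlMr//; apply: le_trans h; rewrite ler_pM2l ?expR_gt0//.
  have expE (q : R) : q ^+ N = \prod_(i < N) q by rewrite prodr_const card_ord.
  rewrite expE; apply: ler_prod => i _.
  rewrite addr_ge0 ?sqr_ge0//= lerD2l !exprMn ler_pM2l ?exprn_gt0// sqr_enorm.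
  exact: sqr_coord_le.
have mC : measurable_fun setT (fun x : R => (1 + (a * x) ^+ 2)^-1).
  apply: continuous_measurable_fun => x.
  apply: (@continuous_comp _ _ _ ( *%R a) (fun x => (oneDsqr x)^-1)).
    exact: mulrl_continuous.
  exact: continuous_oneDsqrV.
have mP : measurable_fun setT
    (fun xi : Rn R N => \prod_(i < N) (1 + (a * (tnth xi i : R)) ^+ 2)^-1).
  apply: measurable_prod => i _.
  by apply: (measurableT_comp mC); exact: measurable_coord.
apply: (@le_trans _ _ (\int[leb N]_xi (C%:E *
    (\prod_(i < N) (1 + (a * (tnth xi i : R)) ^+ 2)^-1)%:E))%E).
  apply: ge0_le_integral => //.
  - by move=> xi _; rewrite lee_fin expR_ge0.
  - by apply/measurable_EFinP; apply: measurable_mixture; apply: mixture_stable_symbol; exact: ltW.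
  - by apply/measurable_EFinP; exact: measurable_funM.
  - by move=> xi _; rewrite -EFinM lee_fin; exact: bnd.
rewrite ge0_integralZl//; last 3 first.
- exact/measurable_EFinP.
- by move=> xi _; rewrite lee_fin prodr_ge0// => i _; rewrite invr_ge0 addr_ge0 ?sqr_ge0.
- by rewrite lee_fin ltW.
rewrite (integral_leb_prod (f := fun i x => (1 + (a * x) ^+ 2)^-1) (c := fun=> pi / a))//.
- by rewrite prodr_const card_ord -EFinM.
- by move=> i x; rewrite invr_ge0 addr_ge0 ?sqr_ge0.
- by move=> i; exact: integral_cauchy.
Qed.

Lemma integrable_stable_symbol t : 0 < t ->
  (leb N).-integrable setT (EFin \o stable_symbol t).
Proof.
move=> t0; have [C C0 hC] := stable_symbol_integral.
apply/integrableP; split.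
  by apply/measurable_EFinP; apply: measurable_mixture; apply: mixture_stable_symbol; exact: ltW.
under eq_integral do rewrite /= ger0_norm ?expR_ge0//.
by apply: le_lt_trans (hC t t0) _; rewrite ltry.
Qed.

Lemma Gamma_ift (x : Rn R N) t : Gamma theta x t = ift (stable_symbol t) x.
Proof. by []. Qed.

(** Scaling of the kernel at the origin, which makes the constant in the averaging bound
    independent of t. *)
Lemma Gamma_origin_le : exists2 C : R, 0 < C & forall t, 0 < t ->
  Gamma theta (rn0 : Rn R N) t <= C * (2 * t `^ theta^-1) ^- N.
Proof.
have [C C0 hC] := stable_symbol_integral; exists C => // t t0.
have := hC t t0; set a := t `^ theta^-1.
have it := integrable_stable_symbol t0.
have -> : Gamma theta (rn0 : Rn R N) t = (2 * pi) ^- N * \int[leb N]_xi stable_symbol t xi.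
  rewrite /Gamma; congr (_ * _); apply: eq_Rintegral => xi _.
  by rewrite dotp0l cos0 mul1r.
rewrite -(fineK (integrable_fin_num measurableT it)) lee_fin => h.
have p0 : 0 < (2 * pi) ^+ N :> R by rewrite exprn_gt0// mulr_gt0// pi_gt0.
rewrite mulrC ler_pdivrMr//; apply: le_trans h _.
have a0 : 0 < a by rewrite powR_gt0.
rewrite -mulrA ler_pM2l// -exprVn -exprMn; apply: le_of_eq; congr (_ ^+ _).
by field; rewrite gt_eqF.
Qed.

End stable_symbol.

Section balls.
Context {R : realType} {N : nat}.
Implicit Types (x y z : Rn R N).

(** The factor N + 1 is a crude substitute for the square root of N that is positive in every
    dimension. *)
Lemma cube_sub_eball z (a r : R) : 0 < a -> N.+1%:R * a <= r -> cube z a `<=` eball z r.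
Proof.
move=> a0 ar y zy; rewrite /eball/=.
have Na0 : 0 < N.+1%:R * a by rewrite mulr_gt0.
apply: lt_le_trans ar.
rewrite -(@ltr_pXn2r _ 2)// ?nnegrE ?enorm_ge0// ?(ltW Na0)// sqr_enorm.
apply: le_lt_trans (_ : \sum_(i < N) a ^+ 2 < _).
  rewrite /dotp; apply: ler_sum => i _; rewrite -expr2 tnth_vsub.
  rewrite -[leLHS]real_normK ?num_real//.
  by rewrite lerXn2r ?nnegrE ?(ltW a0)// ltW//; exact: zy.
rewrite sumr_const card_ord -[a ^+ 2 *+ N]mulr_natl exprMn ltr_pM2r ?exprn_gt0//.
by rewrite -natrX ltr_nat -mulnn mulSn ltn_addr.
Qed.

Lemma eball_sub_cube z (r : R) : eball z r `<=` cube z r.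
Proof.
move=> y zy i; apply: le_lt_trans zy.
rewrite -(@ler_pXn2r _ 2)// ?nnegrE ?enorm_ge0// sqr_enorm real_normK ?num_real//.
by rewrite -tnth_vsub; exact: sqr_coord_le.
Qed.

Lemma measurable_eball z (r : R) : measurable (eball z r).
Proof.
rewrite (_ : eball z r = (fun y => enorm (vsub y z)) @^-1` `]-oo, r[).
  rewrite -[X in measurable X]setTI.
  by apply: measurable_enorm => //; exact: measurable_vsubr.
by apply/seteqP; split => y /=; rewrite in_itv.
Qed.

Lemma leb_eball_le z (r : R) : 0 <= r -> (leb N (eball z r) <= ((2 * r) ^+ N)%:E)%E.
Proof.
move=> r0; rewrite -(leb_cube z r0); apply: le_measure; rewrite ?inE.
- exact: measurable_eball.
- exact: measurable_cube.
- exact: eball_sub_cube.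
Qed.

Lemma leb_eball_gt0 z (r : R) : 0 < r -> (0 < leb N (eball z r))%E.
Proof.
move=> r0; have a0 : 0 < r / N.+1%:R by rewrite divr_gt0.
apply: (@lt_le_trans _ _ (leb N (cube z (r / N.+1%:R)))).
  by rewrite leb_cube ?(ltW a0)// lte_fin exprn_gt0// mulr_gt0.
apply: le_measure; rewrite ?inE.
- exact: measurable_cube.
- exact: measurable_eball.
- by apply: cube_sub_eball => //; rewrite mulrC divfK.
Qed.

End balls.

Section Gamma_kernel.
Context {R : realType} {N : nat}.
Variable theta : R.
Hypothesis theta02 : 0 < theta <= 2.
Implicit Types (x y z : Rn R N) (t s : R).
Local Notation Gamma := (Gamma theta).

Lemma Gamma_ge0 x t : 0 < t -> 0 <= Gamma x t.
Proof.
move=> t0; rewrite Gamma_ift; apply: ift_ge0.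
  by apply: mixture_stable_symbol => //; exact: ltW.
exact: integrable_stable_symbol.
Qed.

Lemma integral_Gamma_le1 x t : 0 < t ->
  (\int[leb N]_y (Gamma (vsub x y) t)%:E <= 1)%E.
Proof.
move=> t0; rewrite -(stable_symbol0 theta02 t (N := N)).
apply: integral_ift_le; last exact: integrable_stable_symbol.
by apply: mixture_stable_symbol => //; exact: ltW.
Qed.

Lemma Gamma_conv_le x y t s : 0 < t -> 0 < s ->
  (\int[leb N]_z (Gamma (vsub x z) t * Gamma (vsub z y) s)%:E <=
   (Gamma (vsub x y) (t + s))%:E)%E.
Proof.
move=> t0 s0; rewrite [X in (_ <= X%:E)%E]Gamma_ift -stable_symbolM.
by apply: ift_conv_le; do ?[exact: integrable_stable_symbol];
  apply: mixture_stable_symbol => //; exact: ltW.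
Qed.

Lemma measurable_Gamma d (X : measurableType d) (f : X -> Rn R N) (g : X -> R) :
  measurable_fun setT f -> measurable_fun setT g ->
  measurable_fun setT (fun u => Gamma (f u) (g u)).
Proof.
move=> mf mg; apply: measurable_funM => //.
pose h (z : X * Rn R N) := cos (dotp (f z.1) z.2) * expR (- (g z.1 * enorm z.2 `^ theta)).
suff mh : measurable_fun setT h by exact: (measurable_Rintegral_param (leb N) mh).
apply: measurable_funM.
  apply: (measurableT_comp (f := cos)).
    by apply: continuous_measurable_fun; exact: continuous_cos.
  by apply: measurable_dotp => //; exact: measurableT_comp.
apply: (measurableT_comp (f := expR)) => //.
apply: measurableT_comp => //.
apply: measurable_funM; first exact: measurableT_comp.
by apply: (measurableT_comp (measurable_powR theta)); exact: measurable_enorm.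
Qed.

(** Averages over balls of radius t^(1/theta) bound integrals over inscribed cubes; in the
    mixture estimate with such cubes the origin term is bounded independently of t. *)
Lemma Gamma_average : exists2 C : R, 0 < C &
  forall (t A : R) (g : Rn R N -> \bar R) x, 0 < t -> 0 <= A ->
    measurable_fun setT g -> (forall y, 0 <= g y)%E ->
    (forall z, (\int[leb N]_(y in eball z (t `^ theta^-1)) g y <=
                A%:E * leb N (eball z (t `^ theta^-1)))%E) ->
    (\int[leb N]_y ((Gamma (vsub x y) t)%:E * g y) <= (C * A)%:E)%E.
Proof.
have [C0 C00 hC0] := @Gamma_origin_le R N theta theta02.
pose B : R := (Num.sqrt 2 * expR 1) ^+ N * N.+1%:R ^+ N.
pose q : R := (Num.sqrt pi / N.+1%:R) ^+ N.
have B0 : 0 < B by rewrite mulr_gt0 ?exprn_gt0// mulr_gt0 ?expR_gt0// sqrtr_gt0.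
have q0 : 0 <= q by rewrite exprn_ge0// divr_ge0// sqrtr_ge0.
exists (B * (1 + q * C0)).
  by rewrite mulr_gt0// ltr_pwDl// mulr_ge0// ltW.
move=> t A g x t0 A0 mg g0 gA; set r := t `^ theta^-1.
have r0 : 0 < r by rewrite powR_gt0.
pose a := r / N.+1%:R; have a0 : 0 < a by rewrite divr_gt0.
have gM z : (\int[leb N]_(y in cube z a) g y <= (A * (2 * r) ^+ N)%:E)%E.
  apply: (@le_trans _ _ (\int[leb N]_(y in eball z r) g y)%E).
    apply: ge0_subset_integral => //.
    - exact: measurable_cube.
    - exact: measurable_eball.
    - exact: measurable_funTS.
    - by apply: cube_sub_eball => //; rewrite mulrC divfK.
  apply: le_trans (gA z) _; rewrite EFinM; apply: lee_wpmul2l => //.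
  by apply: leb_eball_le; exact: ltW.
have t0' := ltW t0.
have := ift_average_le (mixture_stable_symbol theta02 t0')
  (integrable_stable_symbol theta02 t0) x a0 _ mg g0 gM.
move=> /(_ _)h; apply: le_trans (h _) _.
  by rewrite mulr_ge0// exprn_ge0// mulr_ge0// ltW.
rewrite lee_fin (stable_symbol0 theta02) -Gamma_ift.
have h0 := hC0 t t0; rewrite -/r in h0.
have rN : 0 < (2 * r) ^+ N by rewrite exprn_gt0// mulr_gt0.
have -> : (Num.sqrt 2 * expR 1) ^+ N / (2 * a) ^+ N * (A * (2 * r) ^+ N) = B * A.
  have -> : (2 * r) ^+ N = (2 * a) ^+ N * N.+1%:R ^+ N.
    by rewrite -exprMn; congr (_ ^+ _); rewrite /a; field.
  have : (2 * a) ^+ N != 0 by rewrite expf_neq0// gt_eqF// mulr_gt0.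
  rewrite /B; move: ((2 * a) ^+ N) => u u0; field; exact: u0.
have sqE : Num.sqrt (4 * pi * a ^+ 2) ^+ N = q * (2 * r) ^+ N.
  rewrite /q -exprMn; congr (_ ^+ _).
  have -> : 4 * pi * a ^+ 2 = (2 * a) ^+ 2 * pi by ring.
  rewrite sqrtrM ?sqr_ge0// sqrtr_sqr ger0_norm; last by rewrite mulr_ge0// ltW.
  by rewrite /a; field.
rewrite sqE [leRHS]mulrAC; apply: ler_wpM2l; first by rewrite mulr_ge0// ltW.
rewrite lerD2l -mulrA; apply: ler_wpM2l => //.
by rewrite mulrC -ler_pdivlMr.
Qed.

End Gamma_kernel.

(** * Borel representatives of Lebesgue measurable functions *)

Section completion.
Import HBNNSimple.
Context d (T : measurableType d) {R : realType} (mu : {measure set T -> \bar R}).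
Local Open Scope ereal_scope.

Lemma null_bigcup (Z : nat -> set T) : (forall n, measurable (Z n)) ->
  (forall n, mu (Z n) = 0) -> mu (\bigcup_n Z n) = 0.
Proof.
move=> mZ Z0; apply: measure_negligible; first exact: bigcupT_measurable.
by apply: negligible_bigcup => n; exists (Z n); split => //; exact: Z0.
Qed.

(** The sets that become measurable once a measurable null set is removed form a
    sigma-algebra containing the generators of the completion. *)
Lemma completed_set_trace (A : set T) :
  measurable (A : set (g_sigma_algebraType (completed_algebra_gen mu))) ->
  exists Z, [/\ measurable Z, mu Z = 0 & measurable (A `\` Z)].
Proof.
move: A; apply: smallest_sub; last first.
  move=> _ [A mA [B [Z [mZ Z0 BZ]]] <-]; exists Z; split => //.
  rewrite setDUl (_ : B `\` Z = set0) ?setU0; first exact: measurableD.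
  by apply/seteqP; split => // x [/BZ].
split.
- by exists set0; rewrite measure0 set0D; split.
- move=> A [Z [mZ Z0 mAZ]]; exists Z; split => //.
  rewrite setTD (_ : ~` A `\` Z = ~` (A `\` Z) `\` Z).
    by apply: measurableD => //; exact: measurableC.
  apply/seteqP; split => x /=; first by move=> [nA nZ]; split => // -[].
  by move=> [h nZ]; split => // Ax; apply: h.
- move=> A hA.
  have /choice[Z hZ] : forall n, exists Z, [/\ measurable Z, mu Z = 0 & measurable (A n `\` Z)].
    by move=> n; exact: hA.
  have mZ n : measurable (Z n) by have [] := hZ n.
  have mAZ n : measurable (A n `\` Z n) by have [] := hZ n.
  have mUZ : measurable (\bigcup_n Z n) by exact: bigcupT_measurable.
  exists (\bigcup_n Z n); split => //.
    by apply: null_bigcup => // n; have [] := hZ n.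
  rewrite (_ : _ `\` _ = (\bigcup_n (A n `\` Z n)) `\` \bigcup_n Z n).
    by apply: measurableD => //; exact: bigcupT_measurable.
  apply/seteqP; split => x /=.
    move=> [[n _ An] nZ]; split => //; exists n => //; split => // Zn.
    by apply: nZ; exists n.
  by move=> [[n _ [An _]] nZ]; split => //; exists n.
Qed.

Lemma completed_measurable_funS (D : set T) (f : T -> \bar R) : measurable D ->
  measurable_fun D f -> completed_measurable_fun mu D f.
Proof.
have sub (A : set T) : d.-measurable A -> measurable (A : set (g_sigma_algebraType (completed_algebra_gen mu))).
  move=> mA; apply: sub_sigma_algebra; exists A => //.
  by exists set0; [exact: negligible_set0|rewrite setU0].
by move=> mD mf _ B mB; apply: sub; exact: mf.
Qed.

(** The sets {q < f} with q rational are countably many, so one null set Z serves for all of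
    them, and f set to 0 on Z is measurable. *)
Lemma completed_measurable_fun_borel (f : T -> \bar R) : (forall x, 0 <= f x) ->
  completed_measurable_fun mu setT f ->
  exists g Z, [/\ measurable_fun setT g, (forall x, 0 <= g x),
    measurable Z, mu Z = 0 & forall x, ~ Z x -> g x = f x].
Proof.
move=> f0 mf.
pose q (n : nat) : R := ratr (odflt 0%Q (unpickle n)).
have /choice[Z hZ] : forall n, exists Z, [/\ measurable Z, mu Z = 0 &
    measurable ([set x | (q n)%:E < f x] `\` Z)].
  move=> n; apply: completed_set_trace.
  rewrite (_ : [set x | _] = setT `&` f @^-1` `](q n)%:E, +oo]).
    by apply: mf => //; exact: emeasurable_itv.
  by apply/seteqP; split => x /=; rewrite in_itv/= leey andbT; tauto.
have mZ n : measurable (Z n) by have [] := hZ n.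
pose ZZ := \bigcup_n Z n.
have mZZ : measurable ZZ by exact: bigcupT_measurable.
have ZZ0 : mu ZZ = 0 by apply: null_bigcup => // n; have [] := hZ n.
have gE x : ~ ZZ x -> (f \_ (~` ZZ)) x = f x by move=> Zx; rewrite patchE mem_set.
have gN x : ZZ x -> (f \_ (~` ZZ)) x = 0 by move=> Zx; rewrite patchE memNset//= => /(_ Zx).
have g0 x : 0 <= (f \_ (~` ZZ)) x by rewrite patchE; case: ifP.
exists (f \_ (~` ZZ)), ZZ; split => //.
have mq n : measurable [set x | (q n)%:E < (f \_ (~` ZZ)) x].
  have [q0|q0] := ltP (q n) 0%R.
    rewrite (_ : [set x | _] = setT)//; apply/seteqP; split => // x _ /=.
    by apply: lt_le_trans (g0 x); rewrite lte_fin.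
  rewrite (_ : [set x | _] = ([set x | (q n)%:E < f x] `\` Z n) `\` ZZ).
    by apply: measurableD => //; have [] := hZ n.
  apply/seteqP; split => x /=.
    have [Zx|Zx] := pselect (ZZ x).
      by rewrite (gN _ Zx) lte_fin ltNge q0.
    by rewrite gE// => h; split => //; split => // Zn; apply: Zx; exists n.
  by move=> [[h _] Zx]; rewrite gE.
apply: (measurability _ (ErealGenOInfty.measurableE R)) => // _ [_ [r ->] <-].
rewrite setTI (_ : _ @^-1` _ = \bigcup_(n in [set n | (r < q n)%R]) [set x | (q n)%:E < (f \_ (~` ZZ)) x]).
  exact: bigcup_measurable.
apply/seteqP; split => x /=; rewrite in_itv/= ?andbT.
  move=> rx.
  have [s [rs sx]] : exists s, (r < s)%R /\ s%:E < (f \_ (~` ZZ)) x.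
    move: rx; case: (_ x) => [t| |]; rewrite ?lte_fin => rt.
    - exists ((r + t) / 2)%R; rewrite lte_fin; split; lra.
    - by exists (r + 1)%R; rewrite ltry; split => //; lra.
    - by rewrite ltNge leNye in rt.
  have [k ks] := rat_in_itvoo rs.
  exists (pickle k); rewrite /= /q pickleK/=; first by move: ks; rewrite in_itv/= => /andP[].
  by apply: lt_trans sx; rewrite lte_fin; move: ks; rewrite in_itv/= => /andP[].
by move=> [n /= rn]; apply: lt_trans; rewrite lte_fin.
Qed.

(** Integrals of nonnegative functions are suprema over simple functions, and a simple
    function may be set to 0 on Z. *)
Lemma ge0_le_integral_off_null (f g : T -> \bar R) (Z : set T) :
  measurable Z -> mu Z = 0 -> (forall x, 0 <= f x) -> (forall x, 0 <= g x) ->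
  (forall x, ~ Z x -> f x = g x) -> \int[mu]_x f x <= \int[mu]_x g x.
Proof.
move=> mZ Z0 f0 g0 fg; rewrite ge0_integralTE//; apply: ge_ereal_sup => _ [h /= hf <-].
pose h' : {nnsfun T >-> R} := mul_nnsfun h (indic_nnsfun R (measurableC mZ)).
have -> : sintegral mu h = sintegral mu h'.
  rewrite -!integralT_nnsfun; apply: ge0_ae_eq_integral => //.
  - by apply/measurable_EFinP.
  - by apply/measurable_EFinP.
  - by move=> x _; rewrite lee_fin.
  - by move=> x _; rewrite lee_fin.
  exists Z; split => // x /= hx; apply: contrapT => Zx; apply: hx => _.
  by rewrite /h' /= /mindic indicE mem_set// mulr1.
rewrite ge0_integralTE//; apply: ereal_sup_ubound; exists h' => //= x.
rewrite /mindic indicE; case: (boolP (x \in _)) => [/set_mem Zx|_].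
  by rewrite mulr1 -fg.
by rewrite mulr0.
Qed.

Lemma ge0_eq_integral_off_null (D : set T) (f g : T -> \bar R) (Z : set T) :
  measurable Z -> mu Z = 0 -> (forall x, 0 <= f x) -> (forall x, 0 <= g x) ->
  (forall x, ~ Z x -> f x = g x) -> \int[mu]_(x in D) f x = \int[mu]_(x in D) g x.
Proof.
move=> mZ Z0 f0 g0 fg; rewrite integral_mkcond [RHS]integral_mkcond.
have r0 (h : T -> \bar R) x : (forall x, 0 <= h x) -> 0 <= (h \_ D) x.
  by move=> h0; rewrite patchE; case: ifP.
have e x : ~ Z x -> (f \_ D) x = (g \_ D) x by move=> Zx; rewrite !patchE fg.
apply/eqP; rewrite eq_le; apply/andP; split.
- by apply: (ge0_le_integral_off_null mZ Z0) => // x; exact: r0.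
- apply: (ge0_le_integral_off_null mZ Z0) => // x; try exact: r0.
  by move=> Zx; rewrite e.
Qed.

End completion.

(** * Monotone iteration for the Duhamel equation *)

Section iteration.
Context {R : realType}.
Local Open Scope ereal_scope.

Lemma cvg_integral_nondecreasing d (T : measurableType d) (mu : {measure set T -> \bar R})
    (D : set T) (f_ : (T -> \bar R)^nat) (f : T -> \bar R) : measurable D ->
  (forall n, measurable_fun D (f_ n)) -> (forall n x, D x -> 0 <= f_ n x) ->
  (forall x, D x -> {homo f_^~ x : n m / (n <= m)%N >-> n <= m}) ->
  (forall x, D x -> (f_ n x @[n --> \oo] --> f x)%classic) ->
  (\int[mu]_(x in D) f_ n x @[n --> \oo] --> \int[mu]_(x in D) f x)%classic.
Proof.
move=> mD mf f0 ndf ff.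
rewrite [X in _ --> X](_ : _ = \int[mu]_(x in D) limn (f_^~ x)); last first.
  by apply: eq_integral => x /set_mem Dx; rewrite (cvg_lim _ (ff x Dx)).
exact: cvg_monotone_convergence.
Qed.

Context d (X : measurableType d) (m : {sigma_finite_measure set X -> \bar R}).
Notation leb1 := (@lebesgue_measure R).
Implicit Types (z : X * measurableTypeR R) (u v w : X * measurableTypeR R -> \bar R).

Variable k : X -> X -> R -> R.
Hypothesis k0 : forall x y t, (0 <= k x y t)%R.
Hypothesis mk : forall d' (Y : measurableType d') (f g : Y -> X) (h : Y -> R),
  measurable_fun setT f -> measurable_fun setT g -> measurable_fun setT h ->
  measurable_fun setT (fun y => k (f y) (g y) (h y)).

Variable F : R -> R.
Hypothesis F0 : forall r, (0 <= F r)%R.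
Hypothesis ndF : {homo F : r s / (r <= s)%R}.
Hypothesis cF : continuous F.

Variable a : X * measurableTypeR R -> \bar R.
Hypothesis a0 : forall z, 0 <= a z.
Hypothesis ma : measurable_fun setT a.

Definition duhamel_slice u z (s : R) : \bar R :=
  \int[m]_y ((k z.1 y (z.2 - s))%:E * (F (fine (u (y, s))))%:E).

Definition duhamel u z : \bar R :=
  a z + \int[leb1]_(s in `]0%R, (z.2 : R)[%classic) duhamel_slice u z s.

Lemma duhamel_slice_ge0 u z s : 0 <= duhamel_slice u z s.
Proof. by apply: integral_ge0 => y _; rewrite mule_ge0 ?lee_fin. Qed.

Lemma duhamel_ge0 u z : 0 <= duhamel u z.
Proof. by rewrite adde_ge0//; apply: integral_ge0 => s _; exact: duhamel_slice_ge0. Qed.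

Lemma measurable_source u : measurable_fun setT u ->
  measurable_fun setT (fun z => (F (fine (u z)))%:E).
Proof.
move=> mu; apply/measurable_EFinP; apply: (measurableT_comp (f := F)).
  exact: continuous_measurable_fun.
by apply: (measurableT_comp (f := fine)) => //; exact: fine_measurable.
Qed.

Lemma measurable_duhamel_integrand u : measurable_fun setT u ->
  measurable_fun setT (fun q : ((X * measurableTypeR R) * measurableTypeR R) * X =>
    (k q.1.1.1 q.2 (q.1.1.2 - q.1.2))%:E * (F (fine (u (q.2, q.1.2))))%:E).
Proof.
move=> mu; apply: emeasurable_funM.
  apply/measurable_EFinP; apply: mk.
  - by apply: measurableT_comp => //; exact: measurableT_comp.
  - exact: measurable_snd.
  - apply: measurable_funB; last exact: measurableT_comp.
    by apply: measurableT_comp => //; exact: measurableT_comp.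
have mg : measurable_fun setT
    (fun q : ((X * measurableTypeR R) * measurableTypeR R) * X => (q.2, q.1.2)).
  apply/measurable_fun_pair => /=; first exact: measurable_snd.
  exact: measurableT_comp.
exact: (measurableT_comp (measurable_source mu) mg).
Qed.

Lemma measurable_duhamel_slice2 u : measurable_fun setT u ->
  measurable_fun setT (fun q : (X * measurableTypeR R) * measurableTypeR R =>
    duhamel_slice u q.1 q.2).
Proof.
move=> mu.
apply: (measurable_fun_fubini_tonelli_F _ (measurable_duhamel_integrand mu)).
by move=> q; rewrite mule_ge0 ?lee_fin.
Qed.

Lemma measurable_duhamel_slice u z : measurable_fun setT u ->
  measurable_fun setT (duhamel_slice u z : measurableTypeR R -> \bar R).
Proof.
move=> mu.
exact: (measurableT_comp (measurable_duhamel_slice2 mu) (measurable_pair1 z)).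
Qed.

(** Integration over the moving interval (0, t) is integration over R against the
    indicator of a measurable set. *)
Lemma measurable_duhamel u : measurable_fun setT u -> measurable_fun setT (duhamel u).
Proof.
move=> mu; apply: emeasurable_funD => //.
pose A := [set q : (X * measurableTypeR R) * measurableTypeR R | (0 < q.2 < q.1.2)%R].
have mA : measurable A.
  rewrite (_ : A = [set q | (0 < q.2)%R] `&` [set q | (q.2 < q.1.2)%R]).
    have mlt (f g : (X * measurableTypeR R) * measurableTypeR R -> R) :
        measurable_fun setT f -> measurable_fun setT g ->
        measurable [set q | (f q < g q)%R].
      move=> mf mg; have h : measurable_fun setT (fun q => f q < g q)%R by exact: measurable_fun_ltr.
      by have := h measurableT [set true] I; rewrite setTI.
    apply: measurableI; apply: mlt => //.
    by apply: measurableT_comp => //; exact: measurableT_comp.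
  by apply/seteqP; split => q; rewrite /A/= => /andP.
have mh : measurable_fun setT (fun q : (X * measurableTypeR R) * measurableTypeR R =>
    duhamel_slice u q.1 q.2 * (\1_A q)%:E).
  apply: emeasurable_funM; first exact: measurable_duhamel_slice2.
  by apply/measurable_EFinP; exact: measurable_indic.
rewrite (_ : (fun z => _) = (fun z => \int[leb1]_s (duhamel_slice u z s * (\1_A (z, s))%:E))).
  apply: (measurable_fun_fubini_tonelli_F _ mh).
  by move=> q; rewrite mule_ge0 ?duhamel_slice_ge0// lee_fin indicE ler0n.
apply/funext => z; rewrite integral_mkcond epatch_indic; apply: eq_integral => s _ /=.
by congr (_ * _%:E); rewrite !indicE; congr (nat_of_bool _)%:R.
Qed.

Lemma le_duhamel u v z : measurable_fun setT u -> measurable_fun setT v ->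
  (forall y s, (0 < s < z.2)%R -> F (fine (u (y, s))) <= F (fine (v (y, s))))%R ->
  duhamel u z <= duhamel v z.
Proof.
move=> mu mv uv; apply: leeD2l; apply: ge0_le_integral => //.
- by move=> s _; exact: duhamel_slice_ge0.
- by apply: measurable_funTS; exact: measurable_duhamel_slice.
- by apply: measurable_funTS; exact: measurable_duhamel_slice.
move=> s; rewrite /= in_itv/= => s0.
apply: ge0_le_integral => //.
- by move=> y _; rewrite mule_ge0 ?lee_fin.
- exact: (measurableT_comp (measurable_duhamel_integrand mu) (measurable_pair1 (z, s))).
- exact: (measurableT_comp (measurable_duhamel_integrand mv) (measurable_pair1 (z, s))).
- by move=> y _; rewrite lee_wpmul2l ?lee_fin//; exact: uv.
Qed.

Variables (T : R) (w : X * measurableTypeR R -> \bar R).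
Hypothesis mw : measurable_fun setT w.
Hypothesis w_fin : forall x t, (0 < t < T)%R -> w (x, t) \is a fin_num.
Hypothesis w_super : forall x t, (0 < t < T)%R -> duhamel w (x, t) <= w (x, t).

(** Starting from 0 makes the iteration nondecreasing. *)
Fixpoint picard (n : nat) : X * measurableTypeR R -> \bar R :=
  if n is n'.+1 then duhamel (picard n') else cst 0.

Lemma measurable_picard n : measurable_fun setT (picard n).
Proof. by elim: n => [|n IH]; [exact: measurable_cst|exact: measurable_duhamel]. Qed.

Lemma picard_ge0 n z : 0 <= picard n z.
Proof. by case: n => [|n] //=; exact: duhamel_ge0. Qed.

Lemma fine_le_source (r q : \bar R) : 0 <= r -> r <= q -> q \is a fin_num ->
  (F (fine r) <= F (fine q))%R.
Proof.
move=> r0 rq qf; apply: ndF; apply: fine_le => //.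
by rewrite ge0_fin_numE// (le_lt_trans rq)// -ge0_fin_numE// (le_trans r0).
Qed.

Lemma picard_le n x t : (0 < t < T)%R -> picard n (x, t) <= w (x, t).
Proof.
elim: n x t => [|n IH] x t tT /=.
  by apply: le_trans (w_super _ tT); exact: duhamel_ge0.
apply: le_trans (w_super _ tT); apply: le_duhamel => //; first exact: measurable_picard.
move=> y s /= /andP[s0 st]; have sT : (0 < s < T)%R.
  by rewrite s0 (lt_trans st)//; case/andP: tT.
by apply: fine_le_source; [exact: picard_ge0|exact: IH|exact: w_fin].
Qed.

Lemma picard_fin n x t : (0 < t < T)%R -> picard n (x, t) \is a fin_num.
Proof.
move=> tT; rewrite ge0_fin_numE ?picard_ge0//.
apply: le_lt_trans (picard_le n x tT) _; rewrite -ge0_fin_numE ?w_fin//.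
by apply: le_trans (picard_le n x tT); exact: picard_ge0.
Qed.

Lemma picard_leS n x t : (0 < t < T)%R -> picard n (x, t) <= picard n.+1 (x, t).
Proof.
elim: n x t => [|n IH] x t tT; first exact: duhamel_ge0.
apply: le_duhamel; [exact: measurable_picard|exact: (measurable_picard n.+1)|].
move=> y s /= /andP[s0 st]; have sT : (0 < s < T)%R.
  by rewrite s0 (lt_trans st)//; case/andP: tT.
by apply: fine_le_source; [exact: picard_ge0|exact: (IH y s sT)|exact: (picard_fin n.+1 y sT)].
Qed.

Lemma picard_homo x t : (0 < t < T)%R ->
  {homo picard^~ (x, t) : i j / (i <= j)%N >-> i <= j}.
Proof. by move=> tT; apply: homo_leq => //; [exact: le_trans|move=> n; exact: picard_leS]. Qed.

(** The lower limit is measurable whether or not the iterates converge; below the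
    supersolution it is their limit. *)
Definition picard_limit z : \bar R := limn_einf (picard^~ z).

Lemma measurable_picard_limit : measurable_fun setT picard_limit.
Proof.
apply: (@emeasurable_fun_cvg _ _ R setT (fun n z => einfs (picard^~ z) n)).
  by apply: measurable_fun_einfs => n; exact: measurable_picard.
by move=> z _; rewrite /picard_limit limn_einf_lim; exact: is_cvg_einfs.
Qed.

Lemma cvg_picard x t : (0 < t < T)%R ->
  (picard n (x, t) @[n --> \oo] --> picard_limit (x, t))%classic.
Proof.
move=> tT; have h := ereal_nondecreasing_is_cvgn (picard_homo x tT).
by rewrite /picard_limit is_cvg_limn_einfE.
Qed.

Lemma picard_limit_ge0 x t : (0 < t < T)%R -> 0 <= picard_limit (x, t).
Proof.
move=> tT; have h := @cvg_picard x t tT.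
rewrite -(cvg_lim _ h)//; apply: lime_ge; first by apply/cvg_ex; eexists; exact: h.
by near=> n; exact: picard_ge0.
Unshelve. all: by end_near. Qed.

Lemma picard_limit_le x t : (0 < t < T)%R -> picard_limit (x, t) <= w (x, t).
Proof.
move=> tT; have h := @cvg_picard x t tT.
rewrite -(cvg_lim _ h)//; apply: lime_le; first by apply/cvg_ex; eexists; exact: h.
by near=> n; exact: picard_le.
Unshelve. all: by end_near. Qed.

Lemma picard_limit_fin x t : (0 < t < T)%R -> picard_limit (x, t) \is a fin_num.
Proof.
move=> tT; rewrite ge0_fin_numE ?picard_limit_ge0//.
apply: le_lt_trans (picard_limit_le x tT) _; rewrite -ge0_fin_numE ?w_fin//.
by apply: le_trans (picard_limit_le x tT); exact: picard_limit_ge0.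
Qed.

(** Monotone convergence, first in y for each s, then in s. *)
Lemma picard_limit_fixpoint x t : (0 < t < T)%R ->
  picard_limit (x, t) = duhamel picard_limit (x, t).
Proof.
move=> tT.
have sub s : (0 < s < t)%R -> (0 < s < T)%R.
  by move=> /andP[-> st] /=; rewrite (lt_trans st)//; case/andP: tT.
have h1 : (picard n.+1 (x, t) @[n --> \oo] --> picard_limit (x, t))%classic.
  by have := @cvg_picard x t tT; rewrite -(cvg_shiftS).
suff h2 : (picard n.+1 (x, t) @[n --> \oo] --> duhamel picard_limit (x, t))%classic.
  exact: cvg_unique h1 h2.
have a_fin : a (x, t) \is a fin_num.
  have := picard_fin 1 x tT; rewrite /= /duhamel.
  by rewrite fin_numD => /andP[].
apply: cvgeD; [exact: fin_num_adde_defr|exact: cvg_cst|].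
apply: cvg_integral_nondecreasing => //.
- by move=> n; apply: measurable_funTS; apply: measurable_duhamel_slice; exact: measurable_picard.
- by move=> n s _; exact: duhamel_slice_ge0.
- move=> s; rewrite /= in_itv/= => st n n' nn'; apply: ge0_le_integral => //.
  + by move=> y _; rewrite mule_ge0 ?lee_fin.
  + exact: (measurableT_comp (measurable_duhamel_integrand (measurable_picard n)) (measurable_pair1 ((x, t), s))).
  + exact: (measurableT_comp (measurable_duhamel_integrand (measurable_picard n')) (measurable_pair1 ((x, t), s))).
  + move=> y _; rewrite lee_wpmul2l ?lee_fin//; apply: fine_le_source.
    * exact: picard_ge0.
    * exact: (picard_homo y (sub _ st)).
    * exact: (picard_fin n' y (sub _ st)).
move=> s; rewrite /= in_itv/= => st.
apply: cvg_integral_nondecreasing => //.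
- move=> n.
  exact: (measurableT_comp (measurable_duhamel_integrand (measurable_picard n)) (measurable_pair1 ((x, t), s))).
- by move=> n y _; rewrite mule_ge0 ?lee_fin.
- move=> y _ n n' nn'; rewrite lee_wpmul2l ?lee_fin//; apply: fine_le_source.
  + exact: picard_ge0.
  + exact: (picard_homo y (sub _ st)).
  + exact: (picard_fin n' y (sub _ st)).
- move=> y _; have h := @cvg_picard y s (sub _ st).
  apply: cvgeZl => //; apply: cvg_EFin; first by near=> n.
  apply: (cvg_comp (fun n => fine (picard n (y, s))) F); last exact: cF.
  by apply: fine_cvg; rewrite fineK// picard_limit_fin// sub.
Unshelve. all: by end_near. Qed.

End iteration.

(** * The source against the critical profile *)

Section growth.
Context {R : realType}.
Variables (F G : R -> R) (R0 d p delta b theta : R).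

Definition profile (t : R) : R := t `^ (- (p - 1)^-1) * G (t^-1) `^ (- (p - 1)^-1).

Hypothesis ndF : {in `[0, +oo[ &, {homo F : x y / x <= y}}.
Hypothesis F0 : forall tau, 0 <= tau -> 0 <= F tau.
Hypothesis R00 : 0 <= R0.
Hypothesis d1 : 1 < d.
Hypothesis ndFd : {in `]R0, +oo[ &,
    {homo (fun tau => tau `^ (- d) * F tau) : x y / x <= y}}.
Hypothesis dp : d <= p.
Hypothesis GF : succeq_infty G (fun tau => tau `^ (- p) * F tau).
Hypothesis Fpos : \forall tau \near +oo, 0 < tau `^ (- p) * F tau.
Hypothesis G_asymp : forall a b c : R, 1 <= a -> 0 < b ->
    asymp_infty (fun tau => G (a * tau `^ b * G tau `^ c)) G.
Hypothesis delta01 : 0 < delta < 1.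
Hypothesis niG : {in `]R0, +oo[ &,
      {homo (fun tau => tau `^ (- delta) * G tau) : x y / x <= y >-> y <= x}}.
Hypothesis b1 : 1 < b.
Hypothesis bd : b <= d.
Hypothesis theta0 : 0 < theta.

Let p1 : 0 < p - 1. Proof. by rewrite subr_gt0 (lt_le_trans d1). Qed.
Let q := (p - 1)^-1.
Let q0 : 0 < q. Proof. by rewrite invr_gt0. Qed.

(** Behaviour at infinity in tau becomes behaviour at small t through tau = 1/t. *)
Lemma near_inv (P : R -> Prop) : (\forall tau \near +oo, P tau) ->
  exists2 T, 0 < T & forall t, 0 < t < T -> P t^-1.
Proof.
move=> [M [_ hM]]; exists (`|M| + 1)^-1; first by rewrite invr_gt0 ltr_wpDl.
move=> t /andP[t0 tT]; apply: hM.
have : `|M| + 1 < t^-1 by rewrite -[ltLHS]invrK ltf_pV2 ?posrE// invr_gt0 ltr_wpDl.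
by have := ler_norm M; lra.
Qed.

Lemma G_pos : \forall tau \near +oo, 0 < G tau.
Proof.
have [C C0 hC] := GF; near=> tau.
have h1 : 0 < tau `^ (- p) * F tau by near: tau.
have h2 : tau `^ (- p) * F tau <= C * G tau by near: tau.
by rewrite -(pmulr_rgt0 _ C0) (lt_le_trans h1).
Unshelve. all: by end_near. Qed.

Lemma profile_gt0 t : 0 < t -> 0 < G t^-1 -> 0 < profile t.
Proof. by move=> t0 Gt0; rewrite mulr_gt0 ?powR_gt0. Qed.

Lemma profile_pow t : 0 < t -> 0 < G t^-1 -> profile t `^ (p - 1) = (t * G t^-1)^-1.
Proof.
move=> t0 Gt0; rewrite /profile -/q powRM ?powR_ge0// -!powRrM.
rewrite mulNr mulVf ?gt_eqF// !powR_inv1 ?(ltW t0) ?(ltW Gt0)//.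
by rewrite invfM.
Qed.

Lemma profileE t : 0 < t -> 0 < G t^-1 -> profile t = (t * G t^-1) `^ (- q).
Proof. by move=> t0 Gt0; rewrite powRM// ltW. Qed.

(** Monotonicity of tau^-delta G(tau) at tau = 1/t <= 1/s. *)
Lemma profile_ratio s t : 0 < s <= t -> R0 < t^-1 -> 0 < G t^-1 -> 0 < G s^-1 ->
  s * G s^-1 <= (s / t) `^ (1 - delta) * (t * G t^-1).
Proof.
move=> /andP[s0 st] Rt Gt Gs; have t0 : 0 < t := lt_le_trans s0 st.
have ts : t^-1 <= s^-1 by rewrite lef_pV2.
have := niG (x := t^-1) (y := s^-1).
rewrite !in_itv/= !andbT => /(_ Rt (lt_le_trans Rt ts) ts) h.
have powV u : 0 < u -> (u^-1) `^ (- delta) = u `^ delta.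
  by move=> u0; rewrite -powR_inv1 ?ltW// -powRrM mulN1r opprK.
move: h; rewrite !powV// => h.
have pw u : 0 < u -> u = u `^ (1 - delta) * u `^ delta.
  by move=> u0; rewrite -powRD ?subrK ?powRr1 ?(ltW u0)// gt_eqF// implybT.
rewrite {1}(pw s)// -mulrA (powRM _ (ltW s0)) ?invr_ge0 ?(ltW t0)//.
rewrite -mulrA ler_pM2l ?powR_gt0// {2}(pw t)// mulrA.
have -> : t^-1 `^ (1 - delta) * (t `^ (1 - delta) * t `^ delta) = t `^ delta.
  by rewrite mulrA -powRM ?invr_ge0 ?(ltW t0)// mulVf ?gt_eqF// powR1 mul1r.
exact: h.
Qed.

Let gamma : R := (1 - delta) * ((b - 1) * q).

(** The gain (s/t)^gamma is what makes the time integral of the source converge at 0. *)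
Lemma profile_decay s t : 0 < s <= t -> R0 < t^-1 -> 0 < G t^-1 -> 0 < G s^-1 ->
  profile s `^ (1 - b) <= (s / t) `^ gamma * profile t `^ (1 - b).
Proof.
move=> hst Rt Gt Gs; have /andP[s0 st] := hst; have t0 : 0 < t := lt_le_trans s0 st.
have E u : 0 < u -> 0 < G u^-1 -> profile u `^ (1 - b) = (u * G u^-1) `^ ((b - 1) * q).
  by move=> u0 Gu; rewrite profileE// -powRrM; congr powR; ring.
rewrite !E// /gamma (powRrM (s / t)) -powRM ?powR_ge0//; last by rewrite mulr_ge0// ltW.
apply: ge0_ler_powR.
- by rewrite mulr_ge0 ?subr_ge0 ?(ltW b1) ?(ltW q0).
- by rewrite nnegrE mulr_ge0 ?(ltW s0) ?(ltW Gs).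
- by rewrite nnegrE !mulr_ge0 ?powR_ge0 ?(ltW t0) ?(ltW Gt).
- exact: profile_ratio.
Qed.

Lemma ler_powRN (x y r : R) : 0 < r -> 0 < x -> x <= y -> y `^ (- r) <= x `^ (- r).
Proof.
move=> r0 x0 xy; have y0 : 0 < y := lt_le_trans x0 xy.
rewrite !powRN lef_pV2 ?posrE ?powR_gt0//.
by apply: ge0_ler_powR; rewrite ?nnegrE// ltW.
Qed.

Lemma near_R0 : \forall tau \near +oo, R0 < tau.
Proof. by exists R0; split => //; exact: num_real. Qed.

(** t G(1/t) tends to 0 because it is bounded by a multiple of t^(1 - delta). *)
Lemma profile_large (M : R) : exists2 T, 0 < T & forall t, 0 < t < T -> M <= profile t.
Proof.
have /andP[de0 de1] := delta01.
have [T1 T10 hT1] : exists2 T, 0 < T & forall t, 0 < t < T -> R0 < t^-1 /\ 0 < G t^-1.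
  apply: (@near_inv (fun tau => R0 < tau /\ 0 < G tau)).
  by apply: filterI; [exact: near_R0|exact: G_pos].
pose t0 := T1 / 2; have t00 : 0 < t0 by rewrite divr_gt0.
have [Rt0 Gt0] : R0 < t0^-1 /\ 0 < G t0^-1 by apply: hT1; rewrite t00 /t0; lra.
pose A := t0 * G t0^-1; have A0 : 0 < A by rewrite mulr_gt0.
pose M' := `|M| + 1; have M'0 : 0 < M' by rewrite ltr_wpDl.
pose B := M' `^ (- (p - 1)); have B0 : 0 < B by rewrite powR_gt0.
(* t <= t0 r gives t G(1/t) <= B, and B^(-1/(p-1)) = M' *)
pose r := (B / A) `^ (1 - delta)^-1; have r0 : 0 < r by rewrite powR_gt0// divr_gt0.
exists (Num.min t0 (t0 * r)); first by rewrite lt_min t00 mulr_gt0.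
move=> t /andP[tp]; rewrite lt_min => /andP[tt0 ttr].
have Gt : 0 < G t^-1 by apply: (hT1 t _).2; rewrite tp/=; apply: lt_trans tt0 _; rewrite /t0; lra.
rewrite profileE//.
have tG : t * G t^-1 <= B.
  apply: le_trans (@profile_ratio t t0 _ Rt0 Gt0 Gt) _; first by rewrite tp ltW.
  rewrite -/A -ler_pdivlMr//.
  have -> : B / A = r `^ (1 - delta).
    by rewrite /r -powRrM mulVf ?powRr1 ?divr_ge0 ?(ltW B0) ?(ltW A0)// gt_eqF// subr_gt0.
  have tr0 : 0 <= t / t0 by rewrite divr_ge0// ltW.
  apply: ge0_ler_powR; rewrite ?nnegrE ?subr_ge0 ?(ltW r0) ?(ltW de1)//.
  by rewrite ler_pdivrMr// mulrC ltW.
apply: le_trans (_ : M' <= _); first by rewrite /M'; have := ler_norm M; lra.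
have -> : M' = B `^ (- q).
  by rewrite /B -powRrM mulrNN mulfV ?gt_eqF// powRr1// ltW.
by apply: ler_powRN => //; rewrite mulr_gt0.
Qed.

(** For R0 = 0 the bound forces F 0 = 0, which holds because tau^-d F(tau) increasing makes
    F at most linear near 0. *)
Lemma source_const_small : exists2 T, 0 < T & forall t, 0 < t < T -> t * F (3 * R0) <= R0.
Proof.
move: R00; rewrite le_eqVlt => /orP[/eqP R0E|Rp]; last first.
  have FR : 0 <= F (3 * R0) by rewrite F0// mulr_ge0.
  exists (R0 / (F (3 * R0) + 1)); first by rewrite divr_gt0// ltr_wpDl.
  move=> t /andP[t0]; rewrite ltr_pdivlMr ?ltr_wpDl// => h.
  by apply: le_trans (ltW h); rewrite ler_pM2l// lerDl.
suff -> : F (3 * R0) = 0 by exists 1 => // t _; rewrite mulr0.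
rewrite -R0E mulr0; apply/eqP; rewrite eq_le F0// andbT leNgt; apply/negP => Fp.
have F1 : 0 <= F 1 by exact: F0.
have F10 : 0 < 2 * (F 1 + 1) by rewrite mulr_gt0// ltr_wpDl.
(* chosen so that tau F(1) <= F(0) / 2 *)
pose tau := Num.min 1 (F 0 / (2 * (F 1 + 1))).
have tau0 : 0 < tau by rewrite lt_min ltr01 divr_gt0.
have tau1 : tau <= 1 by rewrite ge_min lexx.
have h1 : F 0 <= F tau by apply: ndF; rewrite ?in_itv/= ?andbT// ltW.
have h2 : tau `^ (- d) * F tau <= 1 `^ (- d) * F 1.
  by apply: ndFd; rewrite ?in_itv/= ?andbT -?R0E.
have h3 : F tau <= tau * F 1.
  apply: le_trans (_ : tau `^ d * F 1 <= _).
    move: h2; rewrite powR1 mul1r powRN mulrC ler_pdivrMr ?powR_gt0// mulrC//.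
  by rewrite ler_wpM2r// ge1r_powR ?tau0// ltW.
have h4 : tau * F 1 <= F 0 / (2 * (F 1 + 1)) * F 1.
  by rewrite ler_wpM2r// ge_min lexx orbT.
have h5 : F 0 / (2 * (F 1 + 1)) * F 1 < F 0.
  rewrite mulrAC ltr_pdivrMr// ltr_pM2l//; lra.
by have := lt_le_trans (le_lt_trans h4 h5) (le_trans h1 h3); rewrite ltxx.
Qed.

Lemma powRV (u r : R) : 0 < u -> (u^-1) `^ r = u `^ (- r).
Proof. by move=> u0; rewrite -powR_inv1 ?ltW// -powRrM mulN1r. Qed.

(** The comparison of G(tau) with G(tau^b), here for b = 1/theta, converts the radius
    t^(1/theta) of the averages into the time t. *)
Lemma G_scale : exists2 C, 0 < C & exists2 T, 0 < T & forall t, 0 < t < T ->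
  G ((t `^ theta^-1)^-1) `^ (- q) <= C * G t^-1 `^ (- q).
Proof.
have th : 0 < theta^-1 by rewrite invr_gt0.
have [[C C0 hC] _] := G_asymp 0 (lexx 1) th.
have [T T0 hT] := near_inv (filterI hC G_pos).
exists (C `^ q); first by rewrite powR_gt0.
exists T => // t tT; have [] := hT t tT; have /andP[t0 _] := tT.
rewrite powRr0 mulr1 mul1r powRV// -powRN => h Gt.
have h' : G t^-1 / C <= G (t `^ (- theta^-1)) by rewrite ler_pdivrMr// mulrC.
apply: le_trans (ler_powRN q0 _ h') _; first by rewrite divr_gt0.
rewrite powRM ?(ltW Gt) ?invr_ge0 ?(ltW C0)// powRV// opprK mulrC//.
Qed.

(** The scalar content of the theorem.  With v standing for U^(1/b): a bound of the source
    by F(3 R0) plus a multiple of U that is integrable in s near 0, the absorption of the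
    time integral of that multiple into v, and the absorption of F(3 R0) into R0. *)
Lemma source_control : exists2 e, 0 < e & exists2 c, 0 < c & exists2 T, 0 < T &
  [/\ 0 < gamma,
     forall t, 0 < t < T -> [/\ 0 < G t^-1, 0 < profile t & R0 <= profile t],
     forall s t v, 0 < s <= t -> t < T -> 0 <= v <= e * profile s ->
       F (2 * v + R0) <= F (3 * R0) + v `^ b * (c * profile t `^ (1 - b) * ((s / t) `^ gamma / s)),
     forall t v, 0 < t < T -> 0 <= v <= e * profile t ->
       v `^ b * (c * profile t `^ (1 - b) / gamma) <= v &
     forall t, 0 < t < T -> t * F (3 * R0) <= R0 ].
Proof.
have /andP[de0 de1] := delta01.
have b0 : 0 < b by rewrite (lt_trans _ b1).
have gamma0 : 0 < gamma by rewrite !mulr_gt0// subr_gt0.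
have [C2 C20 hC2] := GF.
have [_ [C3 C30 hC3]] := G_asymp (- q) (lexx 1) q0.
move: hC2 => [M2 [_ hM2]].
have [T1 T10 hT1] := near_inv (filterI (filterI near_R0 G_pos) hC3).
have [T2 T20 hT2] := profile_large (Num.max R0 (`|M2| + 1)).
have [T3 T30 hT3] := source_const_small.
(* smallness of e' is used as e'^(d-1) <= D, which makes the absorbed term at most v *)
pose D := gamma / (3 * (C2 * C3)); have D0 : 0 < D by rewrite divr_gt0// !mulr_gt0.
pose e' := Num.min 1 (D `^ (d - 1)^-1).
have e'0 : 0 < e' by rewrite lt_min ltr01 powR_gt0.
have e'1 : e' <= 1 by rewrite ge_min lexx.
have e'D : e' `^ (d - 1) <= D.
  have -> : D = (D `^ (d - 1)^-1) `^ (d - 1).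
    by rewrite -powRrM mulVf ?powRr1 ?(ltW D0)// gt_eqF// subr_gt0.
  apply: ge0_ler_powR; rewrite ?nnegrE ?subr_ge0 ?(ltW d1) ?(ltW e'0) ?powR_ge0//.
  by rewrite ge_min lexx orbT.
have [c cE] : exists c, c = 3 `^ b * (C2 * C3) * e' `^ (d - b) by eexists.
have c0 : 0 < c by rewrite cE !mulr_gt0 ?powR_gt0.
(* the factor 3 yields 3 v <= e' k, so F is compared at 3 v with F at k *)
exists (e' / 3); first by rewrite divr_gt0.
exists c => //; exists (Num.min T1 (Num.min T2 T3)); first by rewrite !lt_min T10 T20.
have small t : 0 < t < Num.min T1 (Num.min T2 T3) ->
    [/\ 0 < t < T1, 0 < t < T2 & 0 < t < T3].
  by move=> /andP[->]; rewrite !lt_min => /and3P[-> -> ->].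
have profP t : 0 < t < Num.min T1 (Num.min T2 T3) ->
    [/\ 0 < G t^-1, 0 < profile t & R0 <= profile t].
  move=> /small[/hT1[[_ Gt] _] t2 _]; have /andP[t0 _] := t2; split => //.
    exact: profile_gt0.
  by have := hT2 t t2; rewrite ge_max => /andP[].
split => //.
- move=> s t v hst tT /andP[v0 vK]; have /andP[s0 st] := hst.
  have sT : 0 < s < Num.min T1 (Num.min T2 T3) by rewrite s0 (le_lt_trans st).
  have tT' : 0 < t < Num.min T1 (Num.min T2 T3) by rewrite (lt_le_trans s0 st).
  have [Gs ks0 Rks] := profP s sT; have [Gt kt0 _] := profP t tT'.
  have [/hT1[[_ _] hs3] s2 _] := small s sT; have [/hT1[[Rt _] _] _ _] := small t tT'.
  have rest0 : 0 <= v `^ b * (c * profile t `^ (1 - b) * ((s / t) `^ gamma / s)).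
    by rewrite !mulr_ge0 ?powR_ge0 ?invr_ge0 ?(ltW c0) ?(ltW s0).
  have [vR|Rv] := leP v R0.
    rewrite -[leLHS]addr0; apply: lerD => //.
    by apply: ndF; rewrite ?in_itv/= ?andbT; lra.
  apply: le_trans (_ : F (3 * v) <= _).
    apply: ndF; rewrite ?in_itv/= ?andbT.
    - by rewrite addr_ge0// mulr_ge0.
    - by rewrite mulr_ge0.
    - by move: (ltW Rv); lra.
  have vp : 0 < v by exact: le_lt_trans Rv.
  set k := profile s in ks0 Rks vK.
  have v3k : 3 * v <= e' * k by move: vK; rewrite mulrAC ler_pdivlMr// mulrC.
  have v3k' : 3 * v <= k by apply: le_trans v3k _; rewrite ler_piMl// ltW.
  have R3v : R0 < 3 * v by lra.
  have h1 : (3 * v) `^ (- d) * F (3 * v) <= k `^ (- d) * F k.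
    by apply: ndFd; rewrite ?in_itv/= ?andbT//; apply: lt_le_trans v3k'.
  have h2 : k `^ (- p) * F k <= C2 * G k.
    apply: hM2; have := hT2 s s2; rewrite ge_max => /andP[_]; rewrite -/k.
    by have := ler_norm M2; lra.
  have h3 : G k <= C3 * G s^-1.
    by move: hs3; rewrite mul1r powRV// -/(profile s).
  have vp3 : 0 < 3 * v by rewrite mulr_gt0.
  have E1 : F (3 * v) = (3 * v) `^ d * ((3 * v) `^ (- d) * F (3 * v)).
    by rewrite mulrA -powRD ?addrN ?powRr0 ?mul1r// (gt_eqF vp3) implybT.
  have E2 : k `^ (- d) * F k = k `^ (p - d) * (k `^ (- p) * F k).
    by rewrite mulrA -powRD ?(gt_eqF ks0) ?implybT//; congr (powR _ _ * _); ring.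
  have h4 : (3 * v) `^ d <= 3 `^ b * v `^ b * (e' `^ (d - b) * k `^ (d - b)).
    have -> : (3 * v) `^ d = (3 * v) `^ b * (3 * v) `^ (d - b).
      by rewrite -powRD ?(gt_eqF vp3) ?implybT//; congr powR; ring.
    rewrite -(powRM b) ?(ltW vp)// ler_pM2l ?powR_gt0//.
    rewrite -powRM ?(ltW e'0) ?(ltW ks0)//.
    have ek0 : 0 <= e' * k by exact: le_trans (ltW vp3) v3k.
    apply: ge0_ler_powR => //; first by rewrite subr_ge0.
    by rewrite nnegrE; exact: ltW.
  have h5 : F (3 * v) <= v `^ b * (c * (k `^ (1 - b) / s)).
    rewrite E1; apply: le_trans (ler_wpM2l (powR_ge0 _ _) h1) _; rewrite E2.
    apply: le_trans (_ : (3 * v) `^ d * (k `^ (p - d) * (C2 * (C3 * G s^-1))) <= _).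
      rewrite ler_pM2l ?powR_gt0// ler_pM2l ?powR_gt0//.
      by apply: le_trans h2 _; rewrite ler_pM2l.
    apply: le_trans (ler_wpM2r _ h4) _.
      by rewrite !mulr_ge0 ?powR_ge0 ?(ltW C20) ?(ltW C30) ?(ltW Gs).
    apply: le_of_eq.
    have E3 : k `^ (d - b) * (k `^ (p - d) * G s^-1) = k `^ (1 - b) / s.
      rewrite mulrA -powRD ?(gt_eqF ks0) ?implybT//.
      have -> : d - b + (p - d) = 1 - b + (p - 1) by ring.
      rewrite powRD ?(gt_eqF ks0) ?implybT// profile_pow// -mulrA; congr (_ * _).
      by field; rewrite !gt_eqF.
    rewrite -E3 cE; ring.
  apply: le_trans h5 _; rewrite -[leLHS]add0r; apply: lerD; first by rewrite F0// mulr_ge0.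
  rewrite ler_pM2l ?powR_gt0// -mulrA ler_pM2l// [leRHS]mulrA ler_pM2r ?invr_gt0//.
  by rewrite mulrC; exact: profile_decay.
- move=> t v tT /andP[]; rewrite le_eqVlt => /orP[/eqP<- _|v0 vK].
    by rewrite powR0 ?gt_eqF// mul0r.
  have [Gt kt0 _] := profP t tT; set k := profile t in kt0 vK *.
  have E1 : v `^ b = v * v `^ (b - 1).
    by rewrite mulr_powRB1 ?(ltW v0)//.
  have h1 : v `^ (b - 1) <= (e' / 3) `^ (b - 1) * k `^ (b - 1).
    rewrite -powRM ?divr_ge0 ?(ltW e'0) ?(ltW kt0)//.
    have ek0 : 0 <= e' / 3 * k by exact: le_trans (ltW v0) vK.
    apply: ge0_ler_powR => //; first by rewrite subr_ge0 ltW.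
    by rewrite nnegrE; exact: ltW.
  rewrite E1 -[leLHS]mulrA ler_piMr ?(ltW v0)//.
  apply: le_trans (ler_wpM2r _ h1) _.
    by rewrite mulr_ge0 ?invr_ge0 ?(ltW gamma0)// mulr_ge0 ?powR_ge0 ?(ltW c0).
  have -> : (e' / 3) `^ (b - 1) * k `^ (b - 1) * (c * k `^ (1 - b) / gamma) =
     e' `^ (d - 1) / D.
    have K1 : k `^ (b - 1) * k `^ (1 - b) = 1.
      rewrite -powRD ?(gt_eqF kt0) ?implybT// (_ : _ + _ = 0) ?powRr0//; ring.
    have K2 : 3^-1 `^ (b - 1) * 3 `^ b = 3 :> R.
      rewrite powRV// -powRD ?pnatr_eq0 ?implybT// (_ : _ + _ = 1) ?powRr1//; ring.
    have K3 : e' `^ (b - 1) * e' `^ (d - b) = e' `^ (d - 1).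
      by rewrite -powRD ?(gt_eqF e'0) ?implybT//; congr powR; ring.
    rewrite powRM ?(ltW e'0) ?invr_ge0// cE -K3 /D.
    transitivity ((e' `^ (b - 1) * e' `^ (d - b)) * (3^-1 `^ (b - 1) * 3 `^ b) *
      (k `^ (b - 1) * k `^ (1 - b)) * (C2 * C3) / gamma); first by ring.
    rewrite K1 K2 mulr1; field; rewrite !gt_eqF//.
  by rewrite ler_pdivrMr// mul1r.
- by move=> t /small[_ _ /hT3].
Qed.

End growth.

(** * A supersolution from the linear flow *)

Section jensen.
Context {R : realType}.
Local Open Scope ereal_scope.

(** Young's inequality: the convex function g^r lies above its tangent at c. *)
Lemma poweR_tangent (r c : R) (g : \bar R) : (1 < r)%R -> (0 < c)%R -> 0 <= g ->
  (r * c `^ (r - 1))%R%:E * g <= g `^ r + ((r - 1) * c `^ r)%R%:E.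
Proof.
move=> r1 c0; have r0 : (0 < r)%R by rewrite (lt_trans _ r1).
have r10 : (0 < r - 1)%R by rewrite subr_gt0.
case: g => [g| |//].
- rewrite lee_fin => g0; rewrite poweR_EFin -EFinM -EFinD lee_fin.
  have q0 : (0 < r / (r - 1))%R by rewrite divr_gt0.
  have rq : (r^-1 + (r / (r - 1))^-1 = 1)%R by field; rewrite !gt_eqF.
  have := conjugate_powR g0 (powR_ge0 c (r - 1)) r0 q0 rq.
  rewrite -powRrM (_ : (r - 1) * (r / (r - 1)) = r)%R; last by field; rewrite gt_eqF.
  move=> h; have := ler_wpM2l (ltW r0) h.
  rewrite (_ : r * (g `^ r / r + c `^ r / (r / (r - 1))) = g `^ r + (r - 1) * c `^ r)%R; last first.
    by field; rewrite !gt_eqF.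
  by rewrite [(g * _)%R]mulrC mulrA.
- by move=> _; rewrite poweRyr ?gt_eqF// addye// leey.
Qed.

Context d (X : measurableType d) (m : {measure set X -> \bar R}).
Variable k : X -> R.
Hypotheses (k0 : forall y, (0 <= k y)%R) (mk : measurable_fun setT k)
  (k1 : \int[m]_y (k y)%:E <= 1).

Lemma measurable_kernelM (g : X -> \bar R) : measurable_fun setT g ->
  measurable_fun setT (fun y => (k y)%:E * g y).
Proof. by move=> mg; apply: emeasurable_funM => //; exact/measurable_EFinP. Qed.

Lemma measurable_poweR_fun (r : R) (g : X -> \bar R) : measurable_fun setT g ->
  measurable_fun setT (fun y => g y `^ r).
Proof. by move=> mg; apply: (measurableT_comp (measurable_poweR r)). Qed.

(** Integrating the tangent inequality at the mean c gives Jensen's inequality; a mass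
    smaller than 1 only improves the constant term. *)
Lemma jensen_subprobability (g : X -> \bar R) (r : R) : (1 <= r)%R ->
  measurable_fun setT g -> (forall y, 0 <= g y) ->
  (\int[m]_y ((k y)%:E * g y)) `^ r <= \int[m]_y ((k y)%:E * g y `^ r).
Proof.
move=> r1 mg g0; move: r1; rewrite le_eqVlt => /orP[/eqP<-|r1].
  rewrite poweRe1; last by apply: integral_ge0 => y _; rewrite mule_ge0 ?lee_fin.
  by apply: le_of_eq; apply: eq_integral => y _; rewrite poweRe1.
have r0 : (0 < r)%R by rewrite (lt_trans _ r1).
have kg0 y : 0 <= (k y)%:E * g y by rewrite mule_ge0 ?lee_fin.
have kgr0 y : 0 <= (k y)%:E * g y `^ r by rewrite mule_ge0 ?lee_fin// poweR_ge0.
have mkg := measurable_kernelM mg.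
have mkgr := measurable_kernelM (measurable_poweR_fun r mg).
have tang (c : R) : (0 < c)%R ->
    (r * c `^ (r - 1))%R%:E * \int[m]_y ((k y)%:E * g y) <=
    \int[m]_y ((k y)%:E * g y `^ r) + ((r - 1) * c `^ r)%R%:E.
  move=> c0; have cr0 : (0 <= r * c `^ (r - 1))%R by rewrite mulr_ge0 ?powR_ge0 ?(ltW r0).
  have d0 : (0 <= (r - 1) * c `^ r)%R by rewrite mulr_ge0 ?powR_ge0 ?subr_ge0 ?(ltW r1).
  apply: (@le_trans _ _ (\int[m]_y ((k y)%:E * g y `^ r + ((r - 1) * c `^ r)%R%:E * (k y)%:E))).
    rewrite -ge0_integralZl//; apply: ge0_le_integral => //.
    - by move=> y _; rewrite mule_ge0.
    - by apply: emeasurable_funM.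
    - by apply: emeasurable_funD => //; apply: emeasurable_funM => //; exact/measurable_EFinP.
    - move=> y _; rewrite muleCA [X in _ + X]muleC -muleDr; last 2 first.
      + by [].
      + by rewrite ge0_adde_def// inE ?poweR_ge0// lee_fin.
      by rewrite lee_wpmul2l ?lee_fin//; exact: poweR_tangent.
  rewrite ge0_integralD//; last 2 first.
  - by move=> y _; rewrite mule_ge0 ?lee_fin.
  - by apply: emeasurable_funM => //; exact/measurable_EFinP.
  rewrite leeD2l// ge0_integralZl//; last 2 first.
  - exact/measurable_EFinP.
  - by move=> y _; rewrite lee_fin.
  by rewrite -[leRHS]mule1 lee_wpmul2l.
have I0 : 0 <= \int[m]_y ((k y)%:E * g y) by exact: integral_ge0.
(* the tangent at 1 shows that the right side is infinite when the mean is *)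
have := tang 1%R ltr01; rewrite !powR1 !mulr1 => h1.
move: I0 h1 tang; case: (\int[m]_y ((k y)%:E * g y)) => [c| |//].
- rewrite lee_fin le_eqVlt => /orP[/eqP<- _ _|c0 _ tang].
    by rewrite poweR0r ?gt_eqF// integral_ge0.
  have := tang c c0; rewrite poweR_EFin -EFinM.
  have -> : (r * c `^ (r - 1) * c = c `^ r + (r - 1) * c `^ r)%R.
    rewrite -mulrA [(_ * c)%R]mulrC mulr_powRB1 ?(ltW c0)//; ring.
  by rewrite EFinD leeD2rE.
- move=> _; rewrite gt0_muley ?lte_fin// => h _.
  rewrite poweRyr ?gt_eqF//; move: h.
  by case: (\int[m]_y _) => [z| |]; rewrite ?leye_eq.
Qed.

Lemma power_mean_mono (g : X -> \bar R) (a b : R) : (0 < a)%R -> (a <= b)%R ->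
  measurable_fun setT g -> (forall y, 0 <= g y) ->
  (\int[m]_y ((k y)%:E * g y `^ a)) `^ a^-1 <= (\int[m]_y ((k y)%:E * g y `^ b)) `^ b^-1.
Proof.
move=> a0 ab mg g0; have b0 : (0 < b)%R := lt_le_trans a0 ab.
have ba : (1 <= b / a)%R by rewrite ler_pdivlMr// mul1r.
have := jensen_subprobability ba (measurable_poweR_fun a mg) (fun y => poweR_ge0 _ _).
rewrite [X in _ <= X](eq_integral (fun y => (k y)%:E * g y `^ b)); last first.
  by move=> y _; rewrite -poweRrM mulrC divfK ?gt_eqF.
set I := \int[m]_y _; set J := \int[m]_y _ => h.
have -> : I `^ a^-1 = (I `^ (b / a)) `^ b^-1.
  by rewrite -poweRrM; congr poweR; field; rewrite !gt_eqF.
apply: gt0_ler_poweR => //; first by rewrite invr_ge0 ltW.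
- by rewrite in_itv/= poweR_ge0 leey.
- rewrite in_itv/= leey andbT; apply: integral_ge0 => y _.
  by rewrite mule_ge0 ?lee_fin// poweR_ge0.
Qed.

End jensen.

Section time_integral.
Context {R : realType}.
Notation mu := (@lebesgue_measure R).

Lemma measurable_power_rate (t g : R) : measurable_fun `]0%R, t[%classic
  (fun s : measurableTypeR R => (s / t) `^ g / s).
Proof.
apply: (eq_measurable_fun (fun s : measurableTypeR R => (s / t) `^ g * s `^ (-1))).
  move=> s /set_mem/=; rewrite in_itv/= => /andP[s0 _].
  by rewrite powR_inv1// ltW.
apply: measurable_funTS; apply: measurable_funM => //.
by apply: (measurableT_comp (measurable_powR g)); exact: measurable_funM.
Qed.

(** The antiderivative is (s/t)^g / g; the intervals [t/(n+2), t] exhaust (0, t] from within. *)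
Lemma integral_power_le (t g : R) : 0 < t -> 0 < g ->
  (\int[mu]_(s in `]0%R, t[%classic) ((s / t) `^ g / s)%:E <= (g^-1)%:E)%E.
Proof.
move=> t0 g0.
pose h (s : R) := t `^ (- g) * s `^ (g - 1).
pose H (s : R) := t `^ (- g) / g * s `^ g.
have h0 s : 0 <= h s by rewrite mulr_ge0 ?powR_ge0.
have hE (s : R) : 0 < s -> (s / t) `^ g / s = h s.
  move=> s0; rewrite powRM ?invr_ge0 ?(ltW s0) ?(ltW t0)// powRV// mulrAC mulrC.
  congr (_ * _); apply: (mulIf (_ : s != 0)); first by rewrite gt_eqF.
  by rewrite divfK ?gt_eqF// mulrC mulr_powRB1// ltW.
pose D (n : nat) : set R := `[t / n.+2%:R, t]%classic.
have a0 n : 0 < t / n.+2%:R by rewrite divr_gt0.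
have at_ n : t / n.+2%:R < t by rewrite ltr_pdivrMr// ltr_pMr// ltr1n.
have dH (s : R) : 0 < s -> is_derive s (1 : R) H (h s).
  move=> s0; have d1 := is_derive1_powR g s0.
  rewrite (_ : H = (t `^ (- g) / g) \*: (fun s : R => s `^ g))//.
  apply: is_derive_eq; rewrite /GRing.scale/= /h mulrA divfK ?gt_eqF//.
have ch n : {within `[t / n.+2%:R, t], continuous h}.
  apply: derivable_within_continuous => s; rewrite in_itv/= => /andP[as_ _].
  have s0 : 0 < s := lt_le_trans (a0 n) as_.
  apply: derivableM; first exact: derivable_cst.
  by have [] := is_derive1_powR (g - 1) s0.
have cH (s : R) : 0 < s -> {for s, continuous H}.
  move=> s0; apply: differentiable_continuous; apply/derivable1_diffP.
  by have [] := dH s s0.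
have ID n : (\int[mu]_(s in D n) (h s)%:E <= (g^-1)%:E)%E.
  rewrite (@continuous_FTC2 _ h H)//.
  - rewrite -EFinB lee_fin; have -> : H t = g^-1.
      by rewrite /H powRN mulrAC mulVf ?mul1r// gt_eqF// powR_gt0.
    by rewrite gerBl /H !mulr_ge0 ?powR_ge0 ?invr_ge0 ?(ltW g0).
  - split.
    + move=> s; rewrite in_itv/= => /andP[as_ _].
      by have [] := dH s (lt_trans (a0 n) as_).
    + by apply: cvg_at_right_filter; exact: cH.
    + by apply: cvg_at_left_filter; exact: cH.
  - move=> s; rewrite in_itv/= => /andP[as_ _]; rewrite derive1E.
    by have [_] := dH s (lt_trans (a0 n) as_).
rewrite (_ : (\int[mu]_(s in _) _ = \int[mu]_(s in `]0%R, t[%classic) (h s)%:E)%E); last first.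
  by apply: eq_integral => s /set_mem/=; rewrite in_itv/= => /andP[s0 _]; rewrite hE.
have mh : measurable_fun setT (fun s : measurableTypeR R => (h s)%:E).
  apply/measurable_EFinP; exact: measurable_funM.
have mhD n : measurable_fun setT ((fun s : measurableTypeR R => (h s)%:E) \_ (D n) : measurableTypeR R -> \bar R).
  apply: (measurable_restrictT _ _).1; first exact: measurable_itv.
  exact: measurable_funTS.
have hD0 n s : (0 <= ((fun s : measurableTypeR R => (h s)%:E) \_ (D n)) s)%E.
  by rewrite patchE; case: ifP => // _; rewrite lee_fin.
have cv : (\int[mu]_(s in `]0%R, t[%classic) ((fun s : measurableTypeR R => (h s)%:E) \_ (D n)) s)%E @[n --> \oo] -->
    (\int[mu]_(s in `]0%R, t[%classic) (h s)%:E)%E.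
  apply: cvg_integral_nondecreasing => //.
  - by move=> n; exact: (@measurable_funTS _ _ _ _ _ _ (mhD n)).
  - move=> s _ n n' nn'; rewrite !patchE; case: ifP => [/set_mem|_].
      rewrite /D/= in_itv/= => /andP[as_ st]; rewrite mem_set//= in_itv/= st andbT.
      apply: le_trans as_; rewrite ler_pM2l// lef_pV2 ?posrE//.
      by rewrite ler_nat !ltnS.
    by case: ifP => // _; rewrite lee_fin.
  - move=> s; rewrite /= in_itv/= => /andP[s0 st]; apply: cvg_near_cst.
    near=> n; rewrite patchE mem_set//= /D/= in_itv/= (ltW st) andbT.
    rewrite ler_pdivrMr// mulrC -ler_pdivrMr//.
    apply: (@le_trans _ _ n%:R); last by rewrite ler_nat ltnW.
    by near: n; exact: nbhs_infty_ger.
rewrite -(cvg_lim _ cv)//; apply: lime_le; first by apply/cvg_ex; eexists; exact: cv.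
near=> n; apply: le_trans (ID n); rewrite [leRHS]integral_mkcond.
by apply: ge0_subset_integral => //; exact: measurable_itv.
Unshelve. all: by end_near. Qed.

End time_integral.

Section supersolution.
Context {R : realType}.
Local Open Scope ereal_scope.
Context d (X : measurableType d) (m : {sigma_finite_measure set X -> \bar R}).
Notation leb1 := (@lebesgue_measure R).

Variable k : X -> X -> R -> R.
Hypothesis k0 : forall x y t, (0 <= k x y t)%R.
Hypothesis mk : forall d' (Y : measurableType d') (f g : Y -> X) (h : Y -> R),
  measurable_fun setT f -> measurable_fun setT g -> measurable_fun setT h ->
  measurable_fun setT (fun y => k (f y) (g y) (h y)).
Hypothesis k1 : forall x t, (0 < t)%R -> \int[m]_y (k x y t)%:E <= 1.
Hypothesis kS : forall x z t s, (0 < t)%R -> (0 < s)%R ->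
  \int[m]_y (k x y t * k y z s)%:E <= (k x z (t + s))%:E.

Definition potential (g : X -> \bar R) (z : X * measurableTypeR R) : \bar R :=
  \int[m]_y ((k z.1 y z.2)%:E * g y).

Lemma potential_ge0 g z : (forall y, 0 <= g y) -> 0 <= potential g z.
Proof. by move=> g0; apply: integral_ge0 => y _; rewrite mule_ge0 ?lee_fin. Qed.

Lemma measurable_potential g : measurable_fun setT g -> (forall y, 0 <= g y) ->
  measurable_fun setT (potential g).
Proof.
move=> mg g0.
apply: (@measurable_fun_fubini_tonelli_F _ _ _ _ _ m
  (fun q : (X * measurableTypeR R) * X => (k q.1.1 q.2 q.1.2)%:E * g q.2)); last first.
  by move=> q; rewrite mule_ge0 ?lee_fin.
apply: emeasurable_funM; last exact: measurableT_comp.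
apply/measurable_EFinP; apply: mk.
- exact: measurableT_comp.
- exact: measurable_snd.
- exact: measurableT_comp.
Qed.

(** Tonelli's theorem and the subsolution property of the kernel under convolution. *)
Lemma potential_semigroup g x t s : measurable_fun setT g -> (forall y, 0 <= g y) ->
  (0 < t)%R -> (0 < s)%R ->
  \int[m]_y ((k x y t)%:E * potential g (y, s)) <= potential g (x, (t + s)%R).
Proof.
move=> mg g0 t0 s0.
have mk1 (y : X) : measurable_fun setT (fun z => (k y z s)%:E).
  by apply/measurable_EFinP; exact: mk.
have mkg (y : X) : measurable_fun setT (fun z => (k y z s)%:E * g z).
  by apply: emeasurable_funM.
rewrite (eq_integral (fun y => \int[m]_z ((k x y t)%:E * ((k y z s)%:E * g z)))); last first.
  move=> y _; rewrite ge0_integralZl ?lee_fin//.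
  by move=> z _; rewrite mule_ge0 ?lee_fin.
rewrite (fubini_tonelli (fun q : X * X => (k x q.1 t)%:E * ((k q.1 q.2 s)%:E * g q.2))); last 2 first.
- apply: emeasurable_funM; first by apply/measurable_EFinP; exact: mk.
  apply: emeasurable_funM; last exact: measurableT_comp.
  by apply/measurable_EFinP; exact: mk.
- by move=> q; rewrite !mule_ge0 ?lee_fin.
have mkk (z : X) : measurable_fun setT (fun y => (k x y t * k y z s)%:E).
  by apply/measurable_EFinP; apply: measurable_funM; exact: mk.
rewrite /fubini_G/=.
apply: ge0_le_integral => //.
- by move=> z _; apply: integral_ge0 => y _; rewrite !mule_ge0 ?lee_fin.
- apply: (@measurable_fun_fubini_tonelli_G _ _ _ _ _ m
    (fun q : X * X => (k x q.1 t)%:E * ((k q.1 q.2 s)%:E * g q.2))); last first.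
    by move=> q; rewrite !mule_ge0 ?lee_fin.
  apply: emeasurable_funM; first by apply/measurable_EFinP; exact: mk.
  apply: emeasurable_funM; last exact: measurableT_comp.
  by apply/measurable_EFinP; exact: mk.
- by apply: emeasurable_funM => //; apply/measurable_EFinP; exact: mk.
- move=> z _.
  rewrite (eq_integral (fun y => (k x y t * k y z s)%:E * g z)); last first.
    by move=> y _; rewrite EFinM muleA.
  rewrite ge0_integralZr//; last by move=> y _; rewrite lee_fin mulr_ge0.
  by apply: lee_wpmul2r => //; exact: kS.
Qed.

Variable F : R -> R.
Hypothesis F0 : forall r, (0 <= F r)%R.
Hypothesis cF : continuous F.

Variables (nu : X -> \bar R) (b R0 T M g : R) (K L : R -> R).
Hypothesis mnu : measurable_fun setT nu.
Hypothesis nu0 : forall y, 0 <= nu y.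
Hypothesis b1 : (1 < b)%R.
Hypothesis g0 : (0 < g)%R.
Hypothesis M0 : (0 <= M)%R.
Hypothesis L0 : forall t, (0 <= L t)%R.
Hypothesis nuK : forall x t, (0 < t < T)%R ->
  potential (fun y => nu y `^ b) (x, t) `^ b^-1 <= (K t)%:E.
Hypothesis FL : forall s t v, (0 < s <= t)%R -> (t < T)%R -> (0 <= v <= K s)%R ->
  (F (2 * v + R0) <= M + v `^ b * (L t * ((s / t) `^ g / s)))%R.
Hypothesis LK : forall t v, (0 < t < T)%R -> (0 <= v <= K t)%R ->
  (v `^ b * (L t / g) <= v)%R.
Hypothesis MR : forall t, (0 < t < T)%R -> (t * M <= R0)%R.

Let U := potential (fun y => nu y `^ b).

(** One copy of the power mean of order b pays for the datum, the other for the source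
    above the level R0. *)
Definition supersolution z : \bar R :=
  2%:E * potential (fun y => nu y `^ b) z `^ b^-1 + R0%:E.

Let mnub : measurable_fun setT (fun y => nu y `^ b).
Proof. exact: measurable_poweR_fun. Qed.

Let nub0 y : 0 <= nu y `^ b. Proof. exact: poweR_ge0. Qed.

Let U0 z : 0 <= U z. Proof. exact: potential_ge0. Qed.

Lemma measurable_supersolution : measurable_fun setT supersolution.
Proof.
apply: emeasurable_funD => //; apply: emeasurable_funM => //.
apply: (measurableT_comp (measurable_poweR _)).
exact: measurable_potential.
Qed.

Let rootU x t : (0 < t < T)%R -> exists v, [/\ (0 <= v <= K t)%R,
  U (x, t) `^ b^-1 = v%:E & U (x, t) = (v `^ b)%:E].
Proof.
move=> tT; have b0 : (0 < b)%R by rewrite (lt_trans _ b1).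
have := nuK x tT; rewrite -/U => h.
have E : U (x, t) = (U (x, t) `^ b^-1) `^ b.
  by rewrite -poweRrM mulVf ?gt_eqF// poweRe1.
move: h E (poweR_ge0 (U (x, t)) b^-1).
case: (U (x, t) `^ b^-1) => [v| |] //; rewrite !lee_fin => vK E v0.
by exists v; rewrite v0 vK; split => //; rewrite E poweR_EFin.
Qed.

Lemma supersolution_fin x t : (0 < t < T)%R -> supersolution (x, t) \is a fin_num.
Proof. by move=> tT; rewrite /supersolution -/U; have [v [_ -> _]] := rootU x tT. Qed.

(** The linear part is at most v by Jensen's inequality, the constant part of the source
    contributes at most R0, and the rest at most v, where v is the power mean at (x, t). *)
Lemma duhamel_supersolution x t : (0 < t < T)%R ->
  duhamel m k F (potential nu) supersolution (x, t) <= supersolution (x, t).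
Proof.
move=> tT; have /andP[t0 tT'] := tT; have b0 : (0 < b)%R by rewrite (lt_trans _ b1).
have [v [vK rv Uv]] := rootU x tT; have /andP[v0 _] := vK.
have init : potential nu (x, t) <= v%:E.
  rewrite -rv; have := power_mean_mono (k0 x ^~ t) _ (k1 x t0) ltr01 (ltW b1) mnu nu0.
  rewrite invr1 poweRe1; last by apply: integral_ge0 => y _; rewrite mule_ge0 ?lee_fin ?poweR_ge0.
  under eq_integral do rewrite poweRe1//.
  by apply; exact: mk.
pose h s := (L t * ((s / t) `^ g / s))%R.
have h0 s : (0 < s)%R -> (0 <= h s)%R.
  by move=> s0; rewrite !mulr_ge0 ?powR_ge0 ?invr_ge0 ?(ltW s0).
have mw := measurable_supersolution.
have slice s : (0 < s < t)%R ->
    duhamel_slice m k F supersolution (x, t) s <= M%:E + (h s)%:E * (v `^ b)%:E.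
  move=> /andP[s0 st]; have sT : (0 < s < T)%R by rewrite s0 (lt_trans st).
  have ts0 : (0 < t - s)%R by rewrite subr_gt0.
  have mky : measurable_fun setT (fun y => (k x y (t - s))%:E).
    by apply/measurable_EFinP; exact: mk.
  have mUs : measurable_fun setT (fun y => U (y, s)).
    exact: (measurableT_comp (measurable_potential mnub nub0) (measurable_pair2 s)).
  have mkU : measurable_fun setT (fun y => (k x y (t - s))%:E * U (y, s)).
    exact: emeasurable_funM.
  apply: (@le_trans _ _ (\int[m]_y (M%:E * (k x y (t - s))%:E +
      (h s)%:E * ((k x y (t - s))%:E * U (y, s))))).
    apply: ge0_le_integral => //.
    - by move=> y _; rewrite mule_ge0 ?lee_fin.
    - apply: emeasurable_funM => //.
      exact: (measurableT_comp (measurable_source cF mw) (measurable_pair2 s)).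
    - by apply: emeasurable_funD; apply: emeasurable_funM.
    - move=> y _ /=; rewrite /supersolution -/U.
      have [r [rK -> ->]] := rootU y sT.
      rewrite -!EFinM -!EFinD lee_fin /=.
      have := FL _ tT' rK; rewrite s0 (ltW st) => /(_ isT).
      move=> /(ler_wpM2l (k0 x y (t - s))) /le_trans; apply.
      by apply: le_of_eq; rewrite /h; ring.
  rewrite ge0_integralD//; last 4 first.
  - by move=> y _; rewrite mule_ge0 ?lee_fin.
  - exact: emeasurable_funM.
  - by move=> y _; rewrite !mule_ge0 ?lee_fin ?h0.
  - exact: emeasurable_funM.
  rewrite !ge0_integralZl ?lee_fin ?h0//; last 2 first.
  - by move=> y _; rewrite mule_ge0 ?lee_fin.
  - by move=> y _; rewrite lee_fin.
  apply: leeD.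
    by rewrite -[leRHS]mule1 lee_wpmul2l ?lee_fin//; exact: k1.
  rewrite lee_wpmul2l ?lee_fin ?h0// -Uv.
  have := potential_semigroup x mnub nub0 ts0 s0.
  by rewrite subrK.
have mh : measurable_fun `]0%R, t[%classic (fun s : measurableTypeR R => (h s)%:E).
  by apply/measurable_EFinP; apply: measurable_funM => //; exact: measurable_power_rate.
have tail : \int[leb1]_(s in `]0%R, t[%classic) duhamel_slice m k F supersolution (x, t) s
    <= (R0 + v)%:E.
  apply: (@le_trans _ _ (\int[leb1]_(s in `]0%R, t[%classic) (M%:E + (h s)%:E * (v `^ b)%:E))).
    apply: ge0_le_integral => //.
    - by move=> s _; apply: integral_ge0 => y _; rewrite mule_ge0 ?lee_fin.
    - apply: measurable_funTS; exact: measurable_duhamel_slice.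
    - by apply: emeasurable_funD => //; exact: emeasurable_funM.
  rewrite ge0_integralD//; last 2 first.
  - by move=> s /=; rewrite in_itv/= => /andP[s0 _]; rewrite mule_ge0 ?lee_fin ?h0 ?powR_ge0.
  - exact: emeasurable_funM.
  rewrite EFinD; apply: leeD.
    rewrite integral_cst//= lebesgue_measure_itv/= lte_fin t0 sube0 -EFinM lee_fin mulrC.
    exact: MR.
  rewrite ge0_integralZr//; last 2 first.
  - by move=> s /=; rewrite in_itv/= => /andP[s0 _]; rewrite lee_fin h0.
  - by rewrite lee_fin powR_ge0.
  under eq_integral do rewrite EFinM.
  rewrite ge0_integralZl ?lee_fin//; last 2 first.
  - by apply/measurable_EFinP; exact: measurable_power_rate.
  - move=> s /=; rewrite in_itv/= => /andP[s0 _]; rewrite lee_fin.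
    by rewrite mulr_ge0 ?powR_ge0 ?invr_ge0 ?(ltW s0).
  apply: (@le_trans _ _ ((L t)%:E * (g^-1)%:E * (v `^ b)%:E)).
    rewrite lee_wpmul2r ?lee_fin ?powR_ge0// lee_wpmul2l ?lee_fin//.
    exact: integral_power_le.
  by rewrite -!EFinM lee_fin mulrC; exact: LK.
rewrite /duhamel /= [leRHS]/supersolution -/U rv.
apply: le_trans (leeD init tail) _.
by rewrite -EFinD -EFinM -EFinD lee_fin; apply: le_of_eq; ring.
Qed.

Lemma duhamel_solution : {homo F : r s / (r <= s)%R} ->
  exists2 u : X * measurableTypeR R -> \bar R, measurable_fun setT u &
    forall x t, (0 < t < T)%R ->
      [/\ 0 <= u (x, t), u (x, t) \is a fin_num,
          u (x, t) = duhamel m k F (potential nu) u (x, t) &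
          u (x, t) <= supersolution (x, t)].
Proof.
move=> ndF.
have a0 z : 0 <= potential nu z by exact: potential_ge0.
have ma := measurable_potential mnu nu0.
have mw := measurable_supersolution.
exists (picard_limit m k F (potential nu)); first exact: measurable_picard_limit.
have H1 := supersolution_fin; have H2 := duhamel_supersolution.
move=> x t tT; split.
- exact: (picard_limit_ge0 k0 mk F0 ndF cF a0 ma mw H1 H2 x tT).
- exact: (picard_limit_fin k0 mk F0 ndF cF a0 ma mw H1 H2 x tT).
- exact: (picard_limit_fixpoint k0 mk F0 ndF cF a0 ma mw H1 H2 x tT).
- exact: (picard_limit_le k0 mk F0 ndF cF a0 ma mw H1 H2 x tT).
Qed.

End supersolution.

(** * Existence for the fractional heat equation *)

Section causal_kernel.
Context {R : realType} {N : nat}.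
Variable theta : R.
Hypothesis theta02 : 0 < theta <= 2.
Implicit Types (x y z : Rn R N) (t s : R).

(** Extending the kernel by 0 to nonpositive times makes it nonnegative and jointly
    measurable on the whole line. *)
Definition causal_Gamma x y t : R := if 0 < t then Gamma theta (vsub x y) t else 0.

Lemma causal_GammaE x y t : 0 < t -> causal_Gamma x y t = Gamma theta (vsub x y) t.
Proof. by rewrite /causal_Gamma => ->. Qed.

Lemma causal_Gamma_ge0 x y t : 0 <= causal_Gamma x y t.
Proof. by rewrite /causal_Gamma; case: ltP => // t0; exact: Gamma_ge0. Qed.

Lemma measurable_causal_Gamma d (Y : measurableType d) (f g : Y -> Rn R N) (h : Y -> R) :
  measurable_fun setT f -> measurable_fun setT g -> measurable_fun setT h ->
  measurable_fun setT (fun u => causal_Gamma (f u) (g u) (h u)).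
Proof.
move=> mf mg mh; apply: measurable_fun_ifT => //.
  exact: measurable_fun_ltr.
by apply: measurable_Gamma => //; exact: measurable_vsub.
Qed.

Lemma integral_causal_Gamma_le1 x t : 0 < t ->
  (\int[leb N]_y (causal_Gamma x y t)%:E <= 1)%E.
Proof.
move=> t0; under eq_integral do rewrite causal_GammaE//.
exact: integral_Gamma_le1.
Qed.

Lemma causal_Gamma_conv_le x z t s : 0 < t -> 0 < s ->
  (\int[leb N]_y (causal_Gamma x y t * causal_Gamma y z s)%:E <=
   (causal_Gamma x z (t + s))%:E)%E.
Proof.
move=> t0 s0; under eq_integral do rewrite !causal_GammaE//.
by rewrite causal_GammaE ?addr_gt0//; exact: Gamma_conv_le.
Qed.

End causal_kernel.

Section datum.
Context {R : realType} {N : nat}.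
Implicit Types (x y z : Rn R N).

(** Undoes the power mean: the ball has positive finite volume. *)
Lemma integral_eball_le_power_mean (alpha sigma B : R) (mu : Rn R N -> \bar R) x :
  0 < alpha -> 0 < sigma -> 0 <= B -> (forall y, 0 <= mu y)%E ->
  (power_mean alpha mu x sigma <= B%:E)%E ->
  (\int[leb N]_(y in eball x sigma) (mu y `^ alpha) <=
   (B `^ alpha)%:E * leb N (eball x sigma))%E.
Proof.
move=> al0 s0 B0 mu0; rewrite /power_mean.
have Lpos := leb_eball_gt0 x s0.
have Lfin : leb N (eball x sigma) \is a fin_num.
  by rewrite ge0_fin_numE// (le_lt_trans (leb_eball_le x (ltW s0)))// ltry.
have l0 : 0 < fine (leb N (eball x sigma)) by rewrite fine_gt0// Lpos -ge0_fin_numE.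
set l := fine _ in l0 *.
have -> : leb N (eball x sigma) = l%:E by rewrite fineK.
set I := (\int[_]_(_ in _) _)%E => h.
have I0 : (0 <= I)%E by apply: integral_ge0 => y _; exact: poweR_ge0.
have A0 : (0 <= (l^-1)%:E * I)%E by rewrite mule_ge0// lee_fin invr_ge0 ltW.
have : (((l^-1)%:E * I) `^ alpha^-1 `^ alpha <= B%:E `^ alpha)%E.
  apply: gt0_ler_poweR => //; first exact: ltW.
  - by rewrite in_itv/= poweR_ge0 leey.
  - by rewrite in_itv/= lee_fin B0 leey.
rewrite -poweRrM mulVf ?gt_eqF// poweRe1// poweR_EFin lee_pdivrMl//.
by rewrite -EFinM mulrC.
Qed.

End datum.

(** Extension of F to the whole line by composing with the positive part. *)
Lemma continuous_positive_part (R : realType) (F : R -> R) :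
  {within `[0, +oo[, continuous F} -> continuous (fun r : R => F (Num.max r 0)).
Proof.
move=> /subspace_continuousP cF x.
have /cF h : `[0, +oo[%classic (Num.max x 0) by rewrite /= in_itv/= andbT le_max lexx orbT.
apply: cvg_trans h => P /= hP.
have cmax : {for x, continuous (fun r : R => Num.max r (0 : R))}.
  by apply: continuous_max; [exact: cvg_id|exact: cvg_cst].
have H : \forall r \near x, `[0, +oo[%classic (Num.max r (0 : R)) -> P (F (Num.max r (0 : R))).
  exact: (cmax _ hP).
suff : \forall r \near x, P (F (Num.max r (0 : R))) by [].
near=> r; apply: (near H r) => //; rewrite /=.
by rewrite in_itv/= andbT le_max lexx orbT.
Unshelve. all: by end_near. Qed.

Theorem theorem4p3 (R : realType) (N : nat) (theta : R) (F G : R -> R)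
    (R0 d p alpha : R) :
  (1 <= N)%N -> 0 < theta <= 2 ->
  {in `[0, +oo[ &, {homo F : x y / x <= y}} ->
  (forall tau, 0 <= tau -> 0 <= F tau) ->
  {within `[0, +oo[, continuous F} ->
  0 <= R0 -> 1 < d ->
  (forall tau, R0 < tau -> 0 < tau `^ (- d) * F tau) ->
  {in `]R0, +oo[ &,
    {homo (fun tau => tau `^ (- d) * F tau) : x y / x <= y}} ->
  {within `[R0, +oo[, continuous G} ->
  d <= p < d + 1 ->
  succeq_infty G (fun tau => tau `^ (- p) * F tau) ->
  (\forall tau \near +oo, 0 < tau `^ (- p) * F tau) ->
  (forall a b c : R, 1 <= a -> 0 < b ->
    asymp_infty (fun tau => G (a * tau `^ b * G tau `^ c)) G) ->
  (exists2 delta : R, 0 < delta < 1 &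
    {in `]R0, +oo[ &,
      {homo (fun tau => tau `^ (- delta) * G tau) : x y / x <= y >-> y <= x}}) ->
  1 < alpha ->
  exists2 eps : R, 0 < eps &
    forall mu : Rn R N -> \bar R,
      (forall y, (0 <= mu y)%E) ->
      completed_measurable_fun (leb N) setT mu ->
      (exists2 sigma0 : R, 0 < sigma0 &
        forall sigma : R, 0 < sigma < sigma0 ->
          (ereal_sup (range (fun x => power_mean alpha mu x sigma)) <=
           (eps * sigma `^ (- (theta / (p - 1))) *
            G (sigma^-1) `^ (- (p - 1)^-1))%:E)%E) ->
      exists2 T : R, 0 < T &
        exists2 u : Rn R N * measurableTypeR R -> \bar R,
          is_solution theta F mu T u &
          exists2 C : R, 0 < C &
            forall (x : Rn R N) (t : R), 0 < t < T ->
              [/\ (0 <= u (x, t))%E,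
                  (u (x, t) <=
                   2%:E * heat_semigroup theta t (fun y => mu y `^ alpha) x
                            `^ alpha^-1 + R0%:E)%E &
                  (2%:E * heat_semigroup theta t (fun y => mu y `^ alpha) x
                            `^ alpha^-1 + R0%:E <=
                   (C * t `^ (- (p - 1)^-1) *
                    G (t^-1) `^ (- (p - 1)^-1))%:E)%E].
Proof.
move=> _ th02 ndF F0 cF R00 d1 _ ndFd _ /andP[dp _] GF Fpos Gasymp [delta d01 niG] al1.
have /andP[th0 _] := th02.
have al0 : 0 < alpha by rewrite (lt_trans _ al1).
have p1 : 0 < p - 1 by rewrite subr_gt0 (lt_le_trans d1).
have [Cg Cg0 hCg] := @Gamma_average R N theta th02.
have [C6 C60 [T6 T60 hT6]] := G_scale d1 dp GF Fpos Gasymp th0.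
have [b bE] : exists b, b = Num.min alpha d by eexists.
have b1 : 1 < b by rewrite bE lt_min al1.
have b0 : 0 < b by rewrite (lt_trans _ b1).
have bd : b <= d by rewrite bE ge_min lexx orbT.
have bal : b <= alpha by rewrite bE ge_min lexx.
have [e e0 [c c0 [T1 T10 [gm0 prof src absorb small]]]] :=
  source_control ndF F0 R00 d1 ndFd dp GF Fpos Gasymp d01 niG b1 bd.
have CC0 : 0 < Cg `^ alpha^-1 * C6 by rewrite mulr_gt0// powR_gt0.
(* Cg and C6 are lost in bounding S(t) mu^alpha by the profile *)
exists (e / (Cg `^ alpha^-1 * C6)); first by rewrite divr_gt0.
move: (e / _) (divrK (unitf_gt0 CC0) e) (divr_gt0 e0 CC0) => eps epsE eps0.
move=> mu mu0 mmu [sg sg0 hsg].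
have [nu [Z [mnu nu0 mZ Z0 nuE]]] := completed_measurable_fun_borel mu0 mmu.
have powE y : ~ Z y -> (nu y `^ alpha = mu y `^ alpha)%E by move=> /nuE ->.
(* below sg `^ theta, the radius t^(1/theta) is smaller than sg *)
pose T := Num.min T1 (Num.min T6 (sg `^ theta)).
have T0 : 0 < T by rewrite !lt_min T10 T60 powR_gt0.
have subT t : 0 < t < T -> [/\ 0 < t < T1, 0 < t < T6 & 0 < t `^ theta^-1 < sg].
  move=> /andP[t0]; rewrite !lt_min t0 => /and3P[-> -> tsg]; split => //.
  rewrite powR_gt0//=; have -> : sg = (sg `^ theta) `^ theta^-1.
    by rewrite -powRrM mulfV ?gt_eqF// powRr1// ltW.
  by apply: gt0_ltr_powR; rewrite ?invr_gt0 ?nnegrE ?powR_ge0 ?(ltW t0).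
pose k := @causal_Gamma R N theta.
have k0 x y t : 0 <= k x y t by exact: causal_Gamma_ge0.
have mk := @measurable_causal_Gamma R N theta.
have k1 x t : 0 < t -> (\int[leb N]_y (k x y t)%:E <= 1)%E.
  exact: integral_causal_Gamma_le1.
have kS x z t s : 0 < t -> 0 < s ->
    (\int[leb N]_y (k x y t * k y z s)%:E <= (k x z (t + s))%:E)%E.
  exact: causal_Gamma_conv_le.
pose K t := e * profile G p t.
have heatE x t (f g : Rn R N -> \bar R) : 0 < t -> (forall y, 0 <= f y)%E ->
    (forall y, 0 <= g y)%E -> (forall y, ~ Z y -> f y = g y) ->
    potential (leb N) k f (x, t) = heat_semigroup theta t g x.
  move=> t0 f0 g0 fg; apply: (ge0_eq_integral_off_null setT mZ Z0).
  - by move=> y; rewrite mule_ge0 ?lee_fin.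
  - by move=> y; rewrite mule_ge0 ?lee_fin ?Gamma_ge0.
  - by move=> y /fg ->; rewrite /k causal_GammaE.
have nuK x t : 0 < t < T ->
    (potential (leb N) k (fun y => nu y `^ alpha) (x, t) `^ alpha^-1 <= (K t)%:E)%E.
  move=> tT; have /andP[t0 _] := tT; have [tT1 tT6 tsg] := subT t tT.
  have [Gt pt _] := prof t tT1.
  set B := eps * C6 * profile G p t.
  have B0 : 0 <= B := ltW (mulr_gt0 (mulr_gt0 eps0 C60) pt).
  have hB z : (power_mean alpha mu z (t `^ theta^-1) <= B%:E)%E.
    have hz : range (fun x => power_mean alpha mu x (t `^ theta^-1))
        (power_mean alpha mu z (t `^ theta^-1)) by exists z.
    apply: le_trans (ereal_sup_ubound hz) _; apply: le_trans (hsg _ tsg) _; rewrite lee_fin -powRrM.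
    have -> : theta^-1 * - (theta / (p - 1)) = - (p - 1)^-1 by field; rewrite !gt_eqF.
    rewrite /B /profile -[leLHS]mulrA -[leRHS]mulrA ler_pM2l// mulrCA.
    by rewrite ler_wpM2l ?powR_ge0//; exact: hT6.
  have hnu z : (\int[leb N]_(y in eball z (t `^ theta^-1)) (nu y `^ alpha) <=
      (B `^ alpha)%:E * leb N (eball z (t `^ theta^-1)))%E.
    rewrite (ge0_eq_integral_off_null (g := fun y => (mu y `^ alpha)%E) _ mZ Z0).
    - by apply: integral_eball_le_power_mean => //; case/andP: tsg.
    - by move=> y; exact: poweR_ge0.
    - by move=> y; exact: poweR_ge0.
    - exact: powE.
  have h := hCg t (B `^ alpha) _ x t0 (powR_ge0 _ _)
    (measurable_poweR_fun alpha mnu) (fun y => poweR_ge0 _ _) hnu.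
  have U0 : (0 <= potential (leb N) k (fun y => nu y `^ alpha) (x, t))%E.
    by apply: potential_ge0 => // y; exact: poweR_ge0.
  apply: (@le_trans _ _ ((Cg * B `^ alpha)%:E `^ alpha^-1)%E).
    apply: gt0_ler_poweR.
    - by rewrite invr_ge0 ltW.
    - by rewrite in_itv/= U0 leey.
    - by rewrite in_itv/= lee_fin leey andbT mulr_ge0 ?powR_ge0// ltW.
    by apply: le_trans h; apply: le_of_eq; apply: eq_integral => y _; rewrite /k causal_GammaE.
  rewrite poweR_EFin lee_fin powRM ?powR_ge0 ?(ltW Cg0)// -powRrM mulfV ?gt_eqF//.
  rewrite powRr1// /B /K -epsE; apply: le_of_eq; ring.
(* Jensen's inequality, as b <= alpha *)
have nuKb x t : 0 < t < T ->
    (potential (leb N) k (fun y => nu y `^ b) (x, t) `^ b^-1 <=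
     potential (leb N) k (fun y => nu y `^ alpha) (x, t) `^ alpha^-1)%E.
  move=> /andP[t0 _]; apply: power_mean_mono => //; first exact: mk.
  exact: k1.
pose Fp (r : R) := F (Num.max r 0).
have FpE r : 0 <= r -> Fp r = F r by move=> r0; rewrite /Fp max_l.
have max0 (r : R) : 0 <= Num.max r 0 by rewrite le_max lexx orbT.
have Fp0 r : 0 <= Fp r by exact: F0.
have ndFp : {homo Fp : r s / r <= s}.
  move=> r s rs; apply: ndF; rewrite ?in_itv/= ?andbT//.
  by rewrite ge_max !le_max rs lexx orbT.
have cFp : continuous Fp by exact: continuous_positive_part.
have FL s t v : 0 < s <= t -> t < T -> 0 <= v <= K s ->
    Fp (2 * v + R0) <= F (3 * R0) +
      v `^ b * (c * profile G p t `^ (1 - b) * ((s / t) `^ ((1 - delta) * ((b - 1) / (p - 1))) / s)).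
  move=> /andP[s0 st] tT vK; have /andP[v0 _] := vK.
  rewrite FpE; last by rewrite addr_ge0// mulr_ge0.
  apply: src => //; first by rewrite s0.
  by have [/andP[]] := subT t (introT andP (conj (lt_le_trans s0 st) tT)).
have LK t v : 0 < t < T -> 0 <= v <= K t ->
    v `^ b * (c * profile G p t `^ (1 - b) / ((1 - delta) * ((b - 1) / (p - 1)))) <= v.
  by move=> /subT[tT1 _ _]; exact: absorb.
have MR t : 0 < t < T -> t * F (3 * R0) <= R0 by move=> /subT[tT1 _ _]; exact: small.
have [u mu_ hu] := @duhamel_solution R _ _ (leb N) k k0 mk k1 kS Fp Fp0 cFp nu b R0 T
  (F (3 * R0)) _ K (fun t => c * profile G p t `^ (1 - b)) mnu nu0 b1 gm0
  (F0 _ (mulr_ge0 (ler0n R 3) R00)) (fun t => mulr_ge0 (ltW c0) (powR_ge0 _ _))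
  (fun x t tT => le_trans (nuKb x t tT) (nuK x t tT)) FL LK MR ndFp.
exists T => //; exists u.
  have mcyl : measurable (@cylinder R N T).
    rewrite (_ : cylinder T = setT `*` `]0, T[%classic); first exact: measurableX.
    by apply/seteqP; split => -[x t] /=; rewrite /cylinder/= in_itv/=; tauto.
  split.
  - by move=> [x t] tT; have [] := hu x t tT.
  - by apply: completed_measurable_funS => //; exact: measurable_funTS.
  - by apply: aeW => -[x t] tT; have [] := hu x t tT.
  apply: aeW => -[x t] tT; have /andP[t0 _] := tT; have [_ _ -> _] := hu x t tT.
  rewrite /duhamel/=; congr (_ + _)%E.
    by apply: heatE => // y /nuE.
  apply: eq_integral => s /set_mem/=; rewrite in_itv/= => /andP[s0 st].
  have ts0 : 0 < t - s by rewrite subr_gt0.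
  have sT : 0 < s < T by rewrite s0 (lt_trans st)//; case/andP: tT.
  apply: eq_integral => y _; rewrite /k causal_GammaE// FpE// fine_ge0//.
  by have [] := hu y s sT.
exists (2 * e + 1); first by rewrite addr_gt0// mulr_gt0.
move=> x t tT; have /andP[t0 _] := tT; have [tT1 _ _] := subT t tT.
have [_ pt Rp] := prof t tT1.
have [u0 _ _ uw] := hu x t tT; split => //.
  apply: le_trans uw _; rewrite /supersolution leeD2r// lee_wpmul2l ?lee_fin//.
  rewrite -(heatE x t (fun y => nu y `^ alpha)%E)//.
  - exact: nuKb.
  - by move=> y; exact: poweR_ge0.
  - by move=> y; exact: poweR_ge0.
rewrite -(heatE x t (fun y => nu y `^ alpha)%E)//; last 2 first.
- by move=> y; exact: poweR_ge0.
- by move=> y; exact: poweR_ge0.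
apply: (@le_trans _ _ (2%:E * (K t)%:E + R0%:E)%E).
  by rewrite leeD2r// lee_wpmul2l ?lee_fin//; exact: nuK.
rewrite -EFinM -EFinD lee_fin.
apply: (@le_trans _ _ (2 * K t + profile G p t)); first by rewrite lerD2l.
by apply: le_of_eq; rewrite /K /profile; ring.
Qed.
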